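(* Let $n\ge 1$ and let $P,Q\in\mathbb C[z_1,\dots,z_n]$ be polynomials such that: (1) both $P$ and $Q$ are $\mathbb D$-stable; (2) there exist a vector $\boldsymbol\ell=(\ell_1,\dots,\ell_n)$ of positive integers and a constant $\eta\in\mathbb C$ such that $$Q(z_1,\dots,z_n)=\eta\, z_1^{\ell_1}z_2^{\ell_2}\cdots z_n^{\ell_n}\,P(1/z_1,\dots,1/z_n).$$ Let $b_1,\dots,b_n>1$ be real numbers, put $\xi_j=\ln b_j>0$, and let $F(s)=P(e^{-\xi_1 s},\dots,e^{-\xi_n s})$ for $s\in\mathbb C$. All zeros of the entire function $F$ lie on the imaginary axis. Define $$\mu=\sum_{\lambda\in\Lambda} m(\lambda)\,\delta_\lambda,\qquad \Lambda=\{\gamma\in\mathbb R: F(i\gamma)=0\},$$ where $m(\lambda)$ is the multiplicity of $i\lambda$ as a zero of $F$. Then $\mu$ is a positive crystalline measure; moreover $\mu$ is a Fourier quasicrystal and an almost periodic measure.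
   Context: $\mathbb D=\{z\in\mathbb C:|z|<1\}$. A polynomial $P$ in $n$ complex variables is $\mathbb D$-stable if $P(z_1,\dots,z_n)\ne 0$ whenever $z_j\in\mathbb D$ for all $j$. The Fourier transform of a test function is $\hat h(\gamma)=\int_{\mathbb R}h(t)e^{i\gamma t}\,dt$, extended to tempered distributions by duality, $\langle\hat\mu,h\rangle=\langle\mu,\hat h\rangle$. $\delta_\xi$ denotes the unit point mass at $\xi$. A crystalline measure on $\mathbb R$ is a tempered distribution of the form $\mu=\sum_{\lambda\in\Lambda}a_\lambda\delta_\lambda$ whose Fourier transform has the form $\hat\mu=\sum_{s\in S}b_s\delta_s$, where $\Lambda$ and $S$ are discrete subsets of $\mathbb R$ (discrete meaning locally finite: finite intersection with every bounded interval). It is positive if all $a_\lambda\ge 0$. It is a Fourier quasicrystal if in addition both $|\mu|=\sum_{\lambda\in\Lambda}|a_\lambda|\delta_\lambda$ and $|\hat\mu|=\sum_{s\in S}|b_s|\delta_s$ are tempered. A measure $\mu$ on $\mathbb R$ is an almost periodic measure if for every compactly supported continuous function $g$ on $\mathbb R$ the convolution $\mu*g$ is an almost periodic function in the sense of Bohr. *)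

(* Defs.v *)
From HB Require Import structures.
From mathcomp Require Import all_boot all_order all_algebra.
From mathcomp Require Import all_classical all_reals all_analysis.
From mathcomp Require Import complex.
From mathcomp Require mpoly.
Import Order.TTheory GRing.Theory Num.Theory.
Import numFieldNormedType.Exports.

Set Implicit Arguments.
Unset Strict Implicit.
Unset Printing Implicit Defensive.

Local Open Scope classical_set_scope.
Local Open Scope complex_scope.
Local Open Scope ring_scope.

(* The complex field, typed as a [numFieldType] so that it carries the topology
   and the normed module structure over itself: [derivable] and [derive1n] on
   [CC R -> CC R] are complex differentiation. *)
Definition CC (R : realType) : numFieldType := R[i].

Section Analysis.
Variable R : realType.
Local Notation C := (CC R).

Definition cexp (z : C) : C :=
  (expR (complex.Re z) * cos (complex.Im z))
  +i* (expR (complex.Re z) * sin (complex.Im z)).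

(* The order of vanishing: the least [k] with [F^(k)(z) != 0].  Such a [k] exists
   for every entire [F] that is not identically zero; the default [0] is used
   otherwise. *)
Definition zero_mult (F : C -> C) (z : C) : nat :=
  xget 0%N [set k | derive1n k F z != 0
                    /\ forall j, (j < k)%N -> derive1n j F z = 0].

Definition cintegral (f : R -> C) : C :=
  Rintegral lebesgue_measure setT (fun t => complex.Re (f t))
  +i* Rintegral lebesgue_measure setT (fun t => complex.Im (f t)).

Definition cderivn (m : nat) (f : R -> C) (t : R) : C :=
  derive1n m (fun x => complex.Re (f x)) t
  +i* derive1n m (fun x => complex.Im (f x)) t.

Definition smooth (f : R -> C) : Prop :=
  forall m t, derivable (derive1n m (fun x => complex.Re (f x))) t 1
              /\ derivable (derive1n m (fun x => complex.Im (f x))) t 1.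

Definition compactly_supported (f : R -> C) : Prop :=
  exists M : R, forall t, M < `|t| -> f t = 0.

Definition test_function (f : R -> C) : Prop :=
  smooth f /\ compactly_supported f.

Definition schwartz_weight (k m : nat) (f : R -> C) (t : R) : R :=
  `|t| ^+ k * Normc.normc (cderivn m f t).

Definition schwartz (f : R -> C) : Prop :=
  smooth f /\ forall k m, has_ubound (range (schwartz_weight k m f)).

Definition schwartz_seminorm (k m : nat) (f : R -> C) : R :=
  sup (range (schwartz_weight k m f)).

(* Functionals are total on [R -> C]; only the values on Schwartz functions are
   constrained (and meaningful). *)
Definition tempered_distribution (T : (R -> C) -> C) : Prop :=
  (forall (c : C) (f g : R -> C), schwartz f -> schwartz g ->
     T (fun t => c * f t + g t) = c * T f + T g)
  /\ exists (N : nat) (M : R), forall f : R -> C, schwartz f ->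
       Normc.normc (T f)
         <= M * \sum_(k < N.+1) \sum_(m < N.+1) schwartz_seminorm k m f.

Definition fourier (h : R -> C) (gamma : R) : C :=
  cintegral (fun t => h t * cexp (0 +i* (gamma * t))).

Definition fourier_distribution (T : (R -> C) -> C) : (R -> C) -> C :=
  fun h => T (fourier h).

Definition locally_finite (A : set R) : Prop :=
  forall x y : R, finite_set (A `&` `[x, y]).

(* Pairing of [\sum_(x in A) a x delta_x] with [f].  When [A] is locally finite and
   [f] has compact support the sum has finitely many nonzero terms; on other [f]
   the value need not be meaningful. *)
Definition point_masses (A : set R) (a : R -> C) : (R -> C) -> C :=
  fun f => \sum_(x \in A) (a x * f x).

(* Temperedness of [\sum_(x in A) a x delta_x] is that of the distribution it
   defines on test functions: it extends continuously to the Schwartz space,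
   which does not presuppose convergence of the sum on Schwartz functions. *)
Definition represents (T : (R -> C) -> C) (A : set R) (a : R -> C) : Prop :=
  forall f, test_function f -> T f = point_masses A a f.

Definition tempered (A : set R) (a : R -> C) : Prop :=
  exists T, tempered_distribution T /\ represents T A a.

Definition discrete_fourier_pair
    (A : set R) (a : R -> C) (S : set R) (b : R -> C) : Prop :=
  [/\ locally_finite A, locally_finite S &
      exists T, [/\ tempered_distribution T, represents T A a &
                    represents (fourier_distribution T) S b]].

Definition crystalline (A : set R) (a : R -> C) : Prop :=
  exists (S : set R) (b : R -> C), discrete_fourier_pair A a S b.

(* In the order of [R[i]], [0 <= z] says that [z] is real and nonnegative. *)
Definition positive_masses (A : set R) (a : R -> C) : Prop :=
  forall x, A x -> 0 <= a x.

Definition fourier_quasicrystal (A : set R) (a : R -> C) : Prop :=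
  exists (S : set R) (b : R -> C),
    [/\ discrete_fourier_pair A a S b,
        tempered A (fun x => `|a x|) & tempered S (fun s => `|b s|)].

Definition bohr_almost_periodic (f : R -> C) : Prop :=
  continuous f /\
  forall eps : R, 0 < eps ->
    exists L : R, 0 < L /\
      forall x : R, exists tau : R, x <= tau <= x + L /\
        forall t : R, Normc.normc (f (t + tau) - f t) < eps.

(* A measure enters through its integration functional on compactly supported
   continuous functions. *)
Definition convolution (mu : (R -> C) -> C) (g : R -> C) (x : R) : C :=
  mu (fun y => g (x - y)).

Definition almost_periodic_measure (mu : (R -> C) -> C) : Prop :=
  forall g : R -> C, continuous g -> compactly_supported g ->
    bohr_almost_periodic (convolution mu g).

End Analysis.

Definition D_stable (R : realType) (n : nat) (P : mpoly.mpoly n (CC R)) : Prop :=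
  forall z : 'I_n -> CC R, (forall j, `|z j| < 1) -> mpoly.meval z P != 0.

(* [Q(z) = eta z^ell P(1/z)], as an identity of functions where all [z_j != 0]. *)
Definition reciprocal_pair (R : realType) (n : nat)
    (P Q : mpoly.mpoly n (CC R)) (ell : 'I_n -> nat) (eta : CC R) : Prop :=
  forall z : 'I_n -> CC R, (forall j, z j != 0) ->
    mpoly.meval z Q
    = eta * (\prod_(j < n) z j ^+ ell j) * mpoly.meval (fun j => (z j)^-1) P.

Definition exp_poly (R : realType) (n : nat) (P : mpoly.mpoly n (CC R))
    (xi : 'I_n -> R) (s : CC R) : CC R :=
  mpoly.meval (fun j => cexp (- (xi j)%:C * s)) P.

(* Main.v *)
(* Let [F_th(s)] be [P] at the point [z_j = exp (i th_j - xi_j s)].  If every [xi_j] is a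
   rational number [a_j / N], then [F_th] is a polynomial in [exp (- s / N)], and the
   stability of [P] and [Q] forces it to be [P(0)] times a product of factors
   [1 - exp ((i y - s) / N)] over finitely many real [y], [|y| <= pi N].  Approximating
   [xi] by such vectors, these [y] converge to the zeros of [F_th] with their
   multiplicities: the ratio [|F_th(2s + ig)|^2 / |F_th(s + ig)|^2] tends to [4^m] as [s]
   decreases to 0, where [m] is the multiplicity at [ig], while for an approximant it is
   an explicit product whose factors are close to 4 for [y] near [g] and close to 1 for the
   other [y].

   By Newton's identities, the power sum of index [k > 0] of the numbers [exp (i y / N)] is
   [- k] times the sum of the coefficients [c_m] of [log (P / P(0))] over the monomials [m]
   with [<m, a> = k], and choosing [a] so that a single monomial occurs gives
   [|c_m| <= 2 (ell_1 + ... + ell_n)].  Summing over [y] a Riemann sum for the Fourier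
   transform of a test function [h] therefore produces a finite combination of values of
   [h], and in the limit the Fourier transform of the zero measure is supported by 0 and
   the points [+- <m, xi>], with coefficients of polynomial growth.

   Translating the zero measure by [t] moves [th] to [th - t xi].  Pairing with a fixed
   compactly supported function is continuous in [th] and periodic, hence uniformly
   continuous, and the pigeonhole principle on the torus gives the almost periods. *)

Require Import Defs.
From HB Require Import structures.
From mathcomp Require Import all_boot all_order all_algebra.
From mathcomp Require Import all_classical all_reals all_analysis.
From mathcomp Require Import complex.
From mathcomp Require mpoly.
From mathcomp Require Import finmap ring lra.
Import (canonicals,coercions,hints) mpoly.
Import Order.TTheory GRing.Theory Num.Theory.
Import numFieldNormedType.Exports.

Set Implicit Arguments.
Unset Strict Implicit.
Unset Printing Implicit Defensive.

Local Open Scope classical_set_scope.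
Local Open Scope complex_scope.
Local Open Scope ring_scope.

(** * The logarithm of a stable polynomial *)

Section Algebra.
Variables (C : numClosedFieldType) (n : nat).
Implicit Types (P Q : mpoly.mpoly n C) (a : 'I_n -> nat) (v : 'I_n -> C).
Implicit Types (m : mpoly.multinom n) (p q : {poly C}) (zs : seq C).

(** Hurwitz's theorem usually compares functions on circles around a zero. Here approximants and
    limit are compared only on Re s > 0, where stability makes all of them nonzero, and the zeros
    are read off at the boundary. The ratio at 2s and s suits this because, after multiplication by
    an exponential in s, it is for an approximant a product of factors 1 + gain with gain >= 0.
    Contributions cannot cancel, so a bound on the product bounds the number of zeros near g, and
    its value at s = 1 bounds the sum of 1 / (1 + y^2) over all zeros of an approximant, uniformly
    in N. The same uniformity shapes the limit for test functions. A Riemann sum of step 1 / N has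
    period 2 pi N in y, so it decays at best on the one period |y| <= pi N that contains the zeros.
    There it is shown to decay like (1 + y^2)^-2 with a constant free of N: one factor is summed by
    the density bound, the other makes the tail small. *)

Definition wt a m : nat := (\sum_j m j * a j)%N.

(* The one-variable polynomial [P(v_1 X^{a_1}, ..., v_n X^{a_n})]. *)
Definition upoly v a P : {poly C} :=
  mpoly.mmap polyC (fun j => v j *: 'X^(a j)) P.

Definition const_coef P : C := mpoly.mcoeff mpoly.mnm0 P.

Lemma horner_upoly v a P w :
  (upoly v a P).[w] = mpoly.meval (fun j => v j * w ^+ a j) P.
Proof.
rewrite /upoly /mpoly.mmap mpoly.mevalE horner_sum; apply: eq_bigr => m _.
rewrite hornerM hornerC /mpoly.mmap1 horner_prod; congr (_ * _).
by apply: eq_bigr => j _; rewrite horner_exp hornerZ hornerXn.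
Qed.

Lemma meval0 P : mpoly.meval (fun=> 0) P = const_coef P.
Proof.
rewrite mpoly.mevalE /const_coef.
rewrite (eq_bigr (fun m => mpoly.mcoeff m P * (m == mpoly.mnm0)%:R)); last first.
  move=> m _; congr (_ * _); case: eqP => [->|/eqP m0].
    by rewrite big1 // => i _; rewrite mpoly.mnm0E expr0.
  move: m0; rewrite -mpoly.mdeg_eq0 mpoly.mdegE sum_nat_eq0 negb_forall.
  case/existsP=> i mi; rewrite (bigD1 i) //= expr0n.
  by rewrite implyTb in mi; rewrite (negbTE mi) mul0r.
case: (boolP (mpoly.mnm0 \in mpoly.msupp P)) => h.
  rewrite (bigD1_seq (@mpoly.mnm0 n)) ?mpoly.msupp_uniq //= eqxx mulr1.
  by rewrite big1 ?addr0 // => i /negbTE ->; rewrite mulr0.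
rewrite (mpoly.memN_msupp_eq0 h) big_seq big1 // => m hm.
case: eqP => [e|]; last by rewrite mulr0.
by rewrite e (negbTE h) in hm.
Qed.

Lemma upoly0 v a P : (forall j, 0 < a j)%N -> (upoly v a P)`_0 = const_coef P.
Proof.
move=> a0; rewrite -horner_coef0 horner_upoly -meval0; apply: mpoly.meval_eq.
by move=> j; rewrite expr0n -[_ == _]negbK -lt0n a0 mulr0.
Qed.

(** The factor ['X] turns 0 into a root as well, so the naturals below [size (r * 'X)], distinct in
    characteristic 0, are too many roots. *)
Lemma poly_eq_nonzero p q :
  (forall x, x != 0 -> p.[x] = q.[x]) -> p = q.
Proof.
move=> h; apply/eqP; rewrite -subr_eq0; apply/eqP.
set r := p - q.
have rX : r * 'X = 0.
  apply: (@roots_geq_poly_eq0 _ _ [seq i%:R | i <- iota 0 (size (r * 'X))]).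
  - apply/allP => _ /mapP [i _ ->]; apply/rootP; rewrite hornerM hornerX.
    case: i => [|i]; first by rewrite mulr0.
    by rewrite /r hornerD hornerN h ?subrr ?mul0r // pnatr_eq0.
  - by rewrite map_inj_uniq ?iota_uniq // => i j /eqP; rewrite eqr_nat => /eqP.
  - by rewrite size_map size_iota.
by apply/eqP; move/eqP: rX; rewrite mulf_eq0 polyX_eq0 orbF.
Qed.

Lemma horner_prod1 zs x : (\prod_(z <- zs) (1 - z *: 'X)).[x] =
  \prod_(z <- zs) (1 - z * x).
Proof.
by rewrite horner_prod; apply: eq_bigr => z _; rewrite !hornerE.
Qed.

(** A root [z] of modulus below 1 would give [P] a zero in the polydisc at the points
    [v j * z ^+ a j]; one of modulus above 1 would give [Q] a zero there, by reciprocity at [z^-1].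
    The [zs] are the inverses of the roots, which normalizes the product to 1 at 0. *)
Lemma stable_factor P Q (ell : 'I_n -> nat) (eta : C) v a :
  (forall z : 'I_n -> C, (forall j, `|z j| < 1) -> mpoly.meval z P != 0) ->
  (forall z : 'I_n -> C, (forall j, `|z j| < 1) -> mpoly.meval z Q != 0) ->
  (forall z : 'I_n -> C, (forall j, z j != 0) -> mpoly.meval z Q =
     eta * (\prod_(j < n) z j ^+ ell j) * mpoly.meval (fun j => (z j)^-1) P) ->
  (forall j, `|v j| = 1) -> (forall j, 0 < a j)%N ->
  exists zs, [/\ {in zs, forall z, `|z| = 1},
    size zs = (\sum_j ell j * a j)%N &
    upoly v a P = const_coef P *: \prod_(z <- zs) (1 - z *: 'X)].
Proof.
move=> Ps Qs PQ v1 a0; set p := upoly v a P.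
have P0 : const_coef P != 0 by rewrite -meval0; apply: Ps => j; rewrite normr0.
have p0 : p`_0 = const_coef P by rewrite upoly0.
have pn0 : p != 0 by apply: contra_neq P0 => e; rewrite -p0 e coef0.
have [rs prs] := closed_field_poly_normal p.
have lc0 : lead_coef p != 0 by rewrite lead_coef_eq0.
have v0 j : v j != 0 by rewrite -normr_gt0 v1.
pose vi j := (v j)^-1; set q := upoly vi a Q.
have q0 : q`_0 != 0.
  by rewrite upoly0 // -meval0; apply: Qs => j; rewrite normr0.
have qE w : w != 0 -> q.[w] = eta * (\prod_(j < n) vi j ^+ ell j) *
    w ^+ (\sum_j ell j * a j)%N * p.[w^-1].
  move=> w0; rewrite !horner_upoly PQ; last first.
    by move=> j; rewrite mulf_neq0 ?expf_neq0 // invr_neq0.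
  rewrite -!mulrA; congr (_ * _); rewrite mulrA; congr (_ * _).
    rewrite expr_sum -big_split /=; apply: eq_bigr => j _.
    by rewrite exprMn -exprM mulnC.
  by apply: mpoly.meval_eq => j; rewrite invfM invrK exprVn.
have rs1 : {in rs, forall z, `|z| = 1}.
  move=> z zrs; have pz : p.[z] = 0.
    by apply/eqP; rewrite -[_ == _]/(root p z) prs rootZ // root_prod_XsubC.
  have z0 : z != 0 by apply: contra_neq P0 => e; rewrite -p0 -horner_coef0 -e pz.
  apply/eqP; rewrite eq_le; apply/andP; split; rewrite real_leNgt //;
    apply/negP => z1.
  - have : q.[z^-1] != 0.
      rewrite horner_upoly; apply: Qs => j.
      rewrite normrM normfV v1 invr1 mul1r normrX exprn_ilt1 //.
        by rewrite -lt0n.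
      by rewrite normfV invf_lt1 ?(lt_trans ltr01 z1).
    by rewrite qE ?invr_neq0 // invrK pz mulr0 eqxx.
  - have : p.[z] != 0.
      rewrite horner_upoly; apply: Ps => j.
      by rewrite normrM v1 mul1r normrX exprn_ilt1 // -lt0n.
    by rewrite pz eqxx.
have rs0 : {in rs, forall z, z != 0} by move=> z /rs1 e; rewrite -normr_gt0 e.
pose D := (\sum_j ell j * a j)%N; pose d := size rs.
(* The orders of vanishing at 0 of the two sides of [E] are [d] and [D]: [q] and the product are
   nonzero at 0. A strict inequality would make [q] at 0 or [kap] vanish. *)
have sz : d = D.
  pose kap := eta * (\prod_(j < n) vi j ^+ ell j) * lead_coef p.
  have E : q * 'X^d = kap *: ('X^D * \prod_(z <- rs) (1 - z *: 'X)).
    apply: poly_eq_nonzero => w w0; rewrite hornerM hornerXn qE //.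
    rewrite hornerZ hornerM hornerXn horner_prod1 {1}prs hornerZ horner_prod.
    have -> : \prod_(z <- rs) (1 - z * w) =
              (\prod_(z <- rs) ('X - z%:P).[w^-1]) * w ^+ d.
      rewrite /d; elim: (rs) => [|z s IH]; first by rewrite !big_nil expr0 mulr1.
      rewrite !big_cons /= exprS IH hornerXsubC.
      have -> : 1 - z * w = (w^-1 - z) * w by rewrite mulrBl mulVf.
      by ring.
    by rewrite /kap -/D; ring.
  have kap0 : kap != 0.
    apply: contra_neq q0 => e; move/eqP: E; rewrite e scale0r mulf_eq0.
    by rewrite (negbTE (monic_neq0 (monicXn _ _))) orbF => /eqP ->; rewrite coef0.
  have r0 : (\prod_(z <- rs) (1 - z *: 'X))`_0 = 1.
    rewrite -horner_coef0 horner_prod1 big1_seq // => z _.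
    by rewrite mulr0 subr0.
  case: (ltngtP d D) => // h; move/(congr1 (fun r : {poly C} => r`_(minn d D))): E.
  - rewrite coefMXn coefZ coefXnM !(minn_idPl (ltnW h)) ltnn h mulr0 subnn.
    by move=> e; rewrite e eqxx in q0.
  - rewrite coefMXn coefZ coefXnM !(minn_idPr (ltnW h)) ltnn h subnn r0 mulr1.
    by move=> e; rewrite -e eqxx in kap0.
exists (map (fun z => z^-1) rs); split.
- by move=> _ /mapP [z /rs1 z1 ->]; rewrite normfV z1 invr1.
- by rewrite size_map -/d sz.
have E : p = (lead_coef p * \prod_(z <- rs) (- z)) *:
             \prod_(z <- map (fun z => z^-1) rs) (1 - z *: 'X).
  rewrite {1}prs -scalerA; congr (_ *: _); rewrite big_map.
  rewrite -scaler_prod; apply: eq_big_seq => z /rs0 z0.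
  by rewrite scalerBr scalerA mulNr divff // scaleN1r opprK addrC -polyC1 scale_polyC mulr1 polyCN.
rewrite {1}E; congr (_ *: _); rewrite -p0 [in RHS]E coefZ -horner_coef0 horner_prod1.
by rewrite [X in _ = _ * X]big1 ?mulr1 // => z _; rewrite mulr0 subr0.
Qed.

(** This is the logarithmic derivative [- g' / g = \sum_z z / (1 - z X)], with its geometric series
    cut at order [K]. *)
Lemma newton_trunc zs K : exists r : {poly C},
  (\prod_(z <- zs) (1 - z *: 'X)) *
    (\sum_(j < K) (\sum_(z <- zs) z ^+ j.+1) *: 'X^j)
  = - (\prod_(z <- zs) (1 - z *: 'X))^`() + 'X^K * r.
Proof.
elim: zs => [|z s [r IH]].
  exists 0; rewrite !big_nil derivC oppr0 add0r mulr0 mul1r big1 // => j _.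
  by rewrite big_nil scale0r.
rewrite big_cons; set g := \prod_(z <- s) _ in IH *.
have geo : (1 - z *: 'X) * (\sum_(j < K) z ^+ j.+1 *: 'X^j)
    = z%:P - z ^+ K.+1 *: 'X^K.
  elim: K {IH} => [|K IH].
    by rewrite big_ord0 mulr0 expr0 expr1 alg_polyC subrr.
  rewrite big_ord_recr /= mulrDr IH mulrBl mul1r -addrA addKr.
  by rewrite -scalerAl -scalerAr scalerA -exprS -exprS.
exists ((1 - z *: 'X) * r - z ^+ K.+1 *: g).
rewrite (eq_bigr (fun j : 'I_K => z ^+ j.+1 *: 'X^j +
    (\sum_(y <- s) y ^+ j.+1) *: 'X^j)); last first.
  by move=> j _; rewrite big_cons scalerDl.
rewrite big_split /= mulrDr mulrAC geo -mulrA IH.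
rewrite derivM derivB derivC derivZ derivX -!mul_polyC.
by ring.
Qed.

(* The power series [log (P / P(0))] truncated at degree [K]; [logc P m] is its
   coefficient at the monomial [m]. *)
Definition logpoly P K : mpoly.mpoly n C :=
  - \sum_(1 <= k < K.+1) (k%:R : C)^-1 *: (1 - (const_coef P)^-1 *: P) ^+ k.

Definition logc P m : C := mpoly.mcoeff m (logpoly P (mpoly.mdeg m)).

Lemma mcoeff_expr_small (X : mpoly.mpoly n C) k m :
  const_coef X = 0 -> (mpoly.mdeg m < k)%N -> mpoly.mcoeff m (X ^+ k) = 0.
Proof.
move=> X0; elim: k m => // k IH m mk; rewrite exprS mpoly.mcoeffM big1 //.
move=> [[k1 ?] [k2 ?]] /= /eqP em; have [e|k10] := eqVneq k1 mpoly.mnm0.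
  by rewrite e -/(const_coef X) X0 mul0r.
rewrite IH ?mulr0 //; move: mk; rewrite em mpoly.mdegD ltnS.
rewrite -mpoly.mdeg_eq0 -lt0n in k10; apply: leq_trans.
by rewrite -[X in (X < _)%N]add0n ltn_add2r.
Qed.

Lemma const_coef_sub1 P : const_coef P != 0 ->
  const_coef (1 - (const_coef P)^-1 *: P) = 0.
Proof.
move=> P0; rewrite /const_coef mpoly.mcoeffB mpoly.mcoeff1 mpoly.mcoeffZ eqxx.
by rewrite mulVf ?subrr.
Qed.

Lemma mcoeff_logpoly P K m : const_coef P != 0 -> (mpoly.mdeg m <= K)%N ->
  mpoly.mcoeff m (logpoly P K) = logc P m.
Proof.
move=> P0 mK; rewrite /logc /logpoly !raddfN; congr (- _).
rewrite (@big_cat_nat _ _ _ (mpoly.mdeg m).+1) //= mpoly.mcoeffD.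
rewrite [X in _ + X]raddf_sum /= [X in _ + X]big_nat [X in _ + X]big1 ?addr0 //.
move=> k /andP[mk _]; rewrite mpoly.mcoeffZ mcoeff_expr_small ?mulr0 //.
exact: const_coef_sub1.
Qed.

Lemma upoly_logpoly v a P K :
  upoly v a (logpoly P K) =
  - \sum_(1 <= k < K.+1) (k%:R : C)^-1 *: (1 - (const_coef P)^-1 *: upoly v a P) ^+ k.
Proof.
rewrite /upoly /logpoly rmorphN rmorph_sum /=; congr (- _).
apply: eq_bigr => k _; rewrite mpoly.mmapZ rmorphXn /= rmorphB rmorph1 /=.
by rewrite mpoly.mmapZ !mul_polyC.
Qed.

(** With [x = 1 - p / P(0)], the derivative of the truncation is [p' / P(0)] times
    [1 + x + ... + x^(K-1)], and [1 - x = p / P(0)] closes the geometric sum. *)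
Lemma deriv_logpoly v a P K : const_coef P != 0 ->
  upoly v a P * (upoly v a (logpoly P K))^`() =
  (1 - (1 - (const_coef P)^-1 *: upoly v a P) ^+ K) * (upoly v a P)^`().
Proof.
move=> P0; rewrite upoly_logpoly; set p := upoly v a P; set c := const_coef P.
elim: K => [|K IH].
  by rewrite big_nil expr0 subrr mul0r derivN derivC oppr0 mulr0.
rewrite big_nat_recr //= opprD derivD mulrDr IH derivN derivZ.
pose x := 1 - c^-1 *: p; rewrite -/x deriv_exp /= exprS.
have -> : (K.+1%:R : C)^-1 *: (x^`() * x ^+ K *+ K.+1) = - (c^-1 *: (p^`() * x ^+ K)).
  rewrite -(scaler_nat _ (x^`() * x ^+ K)) scalerA mulVf ?pnatr_eq0 // scale1r.
  by rewrite /x derivB derivC derivZ sub0r mulNr scalerAl.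
rewrite opprK -scalerAr scalerAl.
have -> : c^-1 *: p = 1 - x by rewrite /x subKr.
by ring.
Qed.

(** Modulo ['X^K], multiplication by [p] turns the derivative of the logarithm and the generating
    function [S] of the power sums into [p'] and [- p']. Since [p] is prime to ['X], their sum is
    divisible by ['X^K]. *)
Lemma log_newton v a P zs K i :
  const_coef P != 0 -> (forall j, 0 < a j)%N ->
  upoly v a P = const_coef P *: \prod_(z <- zs) (1 - z *: 'X) -> (i < K)%N ->
  (upoly v a (logpoly P K))`_i.+1 *+ i.+1 = - \sum_(z <- zs) z ^+ i.+1.
Proof.
move=> P0 a0 pE iK; set l := upoly v a (logpoly P K).
have [r Nr] := newton_trunc zs K; set S := \sum_(j < K) _ in Nr.
set p := upoly v a P; set x := 1 - (const_coef P)^-1 *: p.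
have x0 : root x 0.
  by rewrite /root horner_coef0 coefB coef1 coefZ upoly0 // mulVf ?subrr.
have [y xy] : exists y, x = y * 'X.
  by have /factor_theorem[y] := x0; rewrite subr0 => ->; exists y.
have E : p * (l^`() + S) = 'X^K * (const_coef P *: r - y ^+ K * p^`()).
  rewrite mulrDr deriv_logpoly // -/p -/x xy exprMn.
  have -> : p * S = const_coef P *: (\prod_(z <- zs) (1 - z *: 'X) * S).
    by rewrite /p pE scalerAl.
  have -> : p^`() = const_coef P *: (\prod_(z <- zs) (1 - z *: 'X))^`().
    by rewrite /p pE derivZ.
  rewrite Nr -!mul_polyC.
  by ring.
have dv : 'X^K %| (l^`() + S).
  rewrite -(@Gauss_dvdpr _ _ p); first by rewrite E dvdp_mulIl.
  rewrite coprimep_expl // coprimep_sym coprimepX.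
  by rewrite /root horner_coef0 upoly0.
have: (l^`() + S)`_i = 0.
  by case/dvdpP: dv => g ->; rewrite coefMXn iK.
rewrite coefD coef_deriv => /eqP; rewrite addr_eq0 => /eqP ->.
congr (- _); rewrite coef_sum (bigD1 (Ordinal iK)) //= coefZ coefXn eqxx mulr1.
rewrite [X in _ + X]big1 ?addr0 // => j ji; rewrite coefZ coefXn.
by move: ji; rewrite -val_eqE /= eq_sym => /negbTE ->; rewrite mulr0.
Qed.

Lemma coef_upoly1 a P i : (upoly (fun=> 1) a P)`_i =
  \sum_(m <- mpoly.msupp P | wt a m == i) mpoly.mcoeff m P.
Proof.
rewrite /upoly /mpoly.mmap coef_sum [RHS]big_mkcond; apply: eq_bigr => m _.
rewrite coefCM /mpoly.mmap1 (eq_bigr (fun j => 'X ^+ (m j * a j)%N)); last first.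
  by move=> j _; rewrite scale1r -exprM mulnC.
by rewrite prodrXr coefXn eq_sym; case: eqP; rewrite ?mulr1 ?mulr0.
Qed.

Lemma wt_ge_deg a m : (forall j, 0 < a j)%N -> (mpoly.mdeg m <= wt a m)%N.
Proof.
by move=> a0; rewrite mpoly.mdegE; apply: leq_sum => j _; rewrite leq_pmulr.
Qed.

(** Positive weights bound the degree of a monomial by its weight, so truncation at order [i]
    already gives exact coefficients. The list [s] is left free: one use takes a box of monomials,
    another a single monomial. *)
Lemma power_sum_logc a P zs i (s : seq (mpoly.multinom n)) :
  const_coef P != 0 -> (forall j, 0 < a j)%N ->
  upoly (fun=> 1) a P = const_coef P *: \prod_(z <- zs) (1 - z *: 'X) ->
  (0 < i)%N -> uniq s -> (forall m, wt a m = i -> m \in s) ->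
  \sum_(z <- zs) z ^+ i = - (i%:R * \sum_(m <- s | wt a m == i) logc P m).
Proof.
move=> P0 a0 pE; case: i => // i _ us sP.
have := log_newton P0 a0 pE (ltnSn i); rewrite coef_upoly1.
set L := logpoly P i.+1 => e; apply: oppr_inj; rewrite opprK -e mulr_natl.
congr (_ *+ _).
have -> : \sum_(m <- mpoly.msupp L | wt a m == i.+1) mpoly.mcoeff m L =
    \sum_(m <- mpoly.msupp L | wt a m == i.+1) logc P m.
  apply: eq_bigr => m /eqP mi; rewrite mcoeff_logpoly //.
  by rewrite -mi wt_ge_deg.
rewrite -[RHS]big_filter -[LHS]big_filter.
rewrite [RHS](bigID (mem (mpoly.msupp L))) /= [X in _ = _ + X]big_seq_cond.
rewrite [X in _ = _ + X]big1 ?addr0; last first.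
  move=> m; rewrite mem_filter => /andP[/andP[/eqP mi _] /mpoly.memN_msupp_eq0].
  by rewrite mcoeff_logpoly // -mi wt_ge_deg.
rewrite -[RHS]big_filter; apply: perm_big; apply: uniq_perm.
- by rewrite filter_uniq ?mpoly.msupp_uniq.
- by rewrite !filter_uniq.
move=> m; rewrite !mem_filter; case: (boolP (m \in _)); rewrite ?andbF //= => _.
by rewrite andbT; case: eqP => //= /sP ->.
Qed.

(** The weight is the degree in units of [K.+1 ^ n.+1] plus the number with base [K.+1] digits
    [m j]. For degree at most [K] that number is below one unit, so a monomial of degree above [K]
    is too heavy, and equal weights mean equal digits. *)
Lemma wt_sep K m m' : let a j := ((K.+1) ^ n.+1 + (K.+1) ^ j)%N in
  (mpoly.mdeg m <= K)%N -> wt a m' = wt a m -> m' = m.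
Proof.
move=> a mK.
have aE (m1 : mpoly.multinom n) : wt a m1 =
   (mpoly.mdeg m1 * K.+1 ^ n.+1 + \sum_(j < n) m1 j * K.+1 ^ j)%N.
  rewrite mpoly.mdegE big_distrl -big_split; apply: eq_bigr => j _.
  by rewrite /a mulnDr.
have low (m1 : mpoly.multinom n) : (mpoly.mdeg m1 <= K)%N ->
    (\sum_(j < n) m1 j * K.+1 ^ j < K.+1 ^ n.+1)%N.
  move=> m1K; apply: (@leq_ltn_trans (K * K.+1 ^ n)%N).
    apply: leq_trans (_ : mpoly.mdeg m1 * K.+1 ^ n <= _)%N.
      rewrite mpoly.mdegE big_distrl; apply: leq_sum => j _.
      by rewrite leq_mul2l leq_pexp2l ?orbT // -ltnS (leq_trans (ltn_ord j)).
    by rewrite leq_mul2r m1K orbT.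
  by rewrite expnS ltn_mul2r expn_gt0 /= ltnSn.
move=> e; move: (e); rewrite !aE => e'.
have m'K : (mpoly.mdeg m' <= K)%N.
  rewrite leqNgt; apply/negP => h.
  have := low _ mK; rewrite ltnNge => /negP; apply.
  rewrite -(leq_add2l (mpoly.mdeg m * K.+1 ^ n.+1)) -e'.
  apply: leq_trans (leq_addr _ _); rewrite -mulSnr leq_mul2r.
  by rewrite (leq_ltn_trans mK h) orbT.
have q : (\sum_(j < n) m' j * K.+1 ^ j = \sum_(j < n) m j * K.+1 ^ j)%N.
  move/(congr1 (fun x => x %% K.+1 ^ n.+1)%N): e'.
  by rewrite !modnMDl !modn_small ?low.
have dig (f g : nat -> nat) k : (forall j, f j <= K)%N -> (forall j, g j <= K)%N ->
   (\sum_(j < k) f j * K.+1 ^ j = \sum_(j < k) g j * K.+1 ^ j)%N ->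
   forall j, (j < k)%N -> f j = g j.
  elim: k f g => // k IH f g fK gK; rewrite !big_ord_recl !expn0 !muln1 => E.
  have sh (h : nat -> nat) : (\sum_(i < k) h (lift ord0 i) * K.+1 ^ lift ord0 i =
      (\sum_(i < k) h i.+1 * K.+1 ^ i) * K.+1)%N.
    rewrite big_distrl; apply: eq_bigr => i _.
    by rewrite lift0 expnSr mulnA.
  rewrite !sh /= in E.
  have E0 : f 0%N = g 0%N.
    move/(congr1 (fun x => x %% K.+1)%N): E.
    by rewrite ![(_ 0%N + _)%N]addnC !modnMDl !modn_small ?ltnS.
  move: E; rewrite E0 => /addnI /eqP; rewrite eqn_pmul2r // => /eqP E.
  by case=> // j; rewrite ltnS => /(IH (f \o S) (g \o S) _ _ E); apply => i /=.
have le1 (m1 : mpoly.multinom n) i : (m1 i <= mpoly.mdeg m1)%N.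
  by rewrite mpoly.mdegE (bigD1 i) //= leq_addr.
pose ext (m1 : mpoly.multinom n) j := if insub j is Some i then m1 i else 0%N.
have extE (m1 : mpoly.multinom n) (i : 'I_n) : ext m1 i = m1 i.
  by rewrite /ext valK.
have extK (m1 : mpoly.multinom n) : (mpoly.mdeg m1 <= K)%N -> forall j, (ext m1 j <= K)%N.
  move=> m1K j; rewrite /ext; case: insubP => // i _ _.
  exact: leq_trans (le1 _ _) m1K.
apply/mpoly.mnmP => i; rewrite -!extE.
apply: (dig (ext m') (ext m) n); rewrite ?ltn_ord //; [exact: extK|exact: extK|].
have extS (m1 : mpoly.multinom n) :
    (\sum_(j < n) ext m1 j * K.+1 ^ j = \sum_(j < n) m1 j * K.+1 ^ j)%N.
  by apply: eq_bigr => j _; rewrite extE.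
by rewrite !extS.
Qed.

(** All [a j] lie between [B] and [2 * B]. So at most [2 * B * \sum_j ell j] unimodular numbers
    enter the power sum, in which the coefficient is multiplied by [wt a m >= B]. *)
Lemma logc_bound P Q (ell : 'I_n -> nat) (eta : C) m :
  (forall z : 'I_n -> C, (forall j, `|z j| < 1) -> mpoly.meval z P != 0) ->
  (forall z : 'I_n -> C, (forall j, `|z j| < 1) -> mpoly.meval z Q != 0) ->
  (forall z : 'I_n -> C, (forall j, z j != 0) -> mpoly.meval z Q =
     eta * (\prod_(j < n) z j ^+ ell j) * mpoly.meval (fun j => (z j)^-1) P) ->
  m != mpoly.mnm0 -> `|logc P m| <= (2 * \sum_j ell j)%:R.
Proof.
move=> Ps Qs PQ m0; set K := mpoly.mdeg m.
(* These weights separate all monomials of degree at most [K], so that the power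
   sum of index [wt a m] consists of the single coefficient [logc P m]. *)
pose B := (K.+1 ^ n.+1)%N; pose a (j : 'I_n) := (B + K.+1 ^ j)%N.
have B0 : (0 < B)%N by rewrite expn_gt0.
have a0 j : (0 < a j)%N by rewrite /a addn_gt0 B0.
have P0 : const_coef P != 0 by rewrite -meval0; apply: Ps => j; rewrite normr0.
have [||zs [zs1 szs pE]] := @stable_factor P Q ell eta (fun=> 1) a Ps Qs PQ.
- by move=> j; rewrite normr1.
- exact: a0.
have wB : (B <= wt a m)%N.
  apply: (@leq_trans (K * B)).
    by rewrite -[X in (X <= _)%N]mul1n leq_mul2r lt0n mpoly.mdeg_eq0 m0 orbT.
  rewrite /wt /K mpoly.mdegE big_distrl; apply: leq_sum => j _.
  by rewrite leq_mul2l leq_addr orbT.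
have w0 : (0 < wt a m)%N := leq_trans B0 wB.
have := @power_sum_logc a P zs (wt a m) [:: m] P0 a0 pE w0 isT.
rewrite big_cons big_nil eqxx addr0 => /(_ _)/(congr1 Num.norm).
rewrite normrN normrM normr_nat => E.
rewrite -(ler_pM2l (_ : 0 < (wt a m)%:R)) ?ltr0n // -E; last first.
  by move=> m' /(@wt_sep K) -> //; rewrite mem_head.
apply: le_trans (ler_norm_sum _ _ _) _.
rewrite (eq_big_seq (fun=> 1)); last by move=> z /zs1 z1; rewrite normrX z1 expr1n.
rewrite big_const_seq count_predT iter_addr_0 szs -natrM ler_nat.
apply: (@leq_trans (B * (2 * \sum_j ell j))); last by rewrite leq_mul2r wB orbT.
rewrite mulnA big_distrr; apply: leq_sum => j _; rewrite mulnC leq_mul2r.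
by rewrite /a muln2 -addnn leq_add2l leq_pexp2l ?orbT // ltnW // ltnS ltnW.
Qed.

End Algebra.

(** * A Hurwitz theorem on the boundary *)

Section RealBounds.
Variable R : realType.
Implicit Types (x y t u v c : R).

Lemma sin_le_id x : 0 <= x -> sin x <= x.
Proof.
rewrite le_eqVlt => /orP[/eqP <-|x0]; first by rewrite sin0.
have [|c _] := @MVT R sin cos 0 x x0 (fun z _ => is_derive_sin z).
  by apply: continuous_subspaceT => z; exact: continuous_sin.
rewrite sin0 !subr0 => ->; rewrite -[leRHS]mul1r; apply: ler_wpM2r.
  exact: ltW.
exact: cos_le1.
Qed.

Lemma normr_sin_le x : `|sin x| <= `|x|.
Proof.
wlog x0 : x / 0 <= x => [H|].
  case: (leP 0 x) => [/H //|xn]; rewrite -normrN -sinN -(normrN x).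
  by apply: H; rewrite oppr_ge0 ltW.
rewrite (ger0_norm x0) ler_norml sin_le_id // andbT.
have [xpi|pix] := leP x pi.
  by rewrite (le_trans _ (sin_ge0_pi _)) ?x0 // oppr_le0.
apply: le_trans (sin_geN1 _); rewrite lerN2.
by apply: le_trans (ltW pix); apply: le_trans (pi_ge2 _); rewrite ler1n.
Qed.

Lemma one_sub_cos v : 1 - cos v = 2 * sin (v / 2) ^+ 2.
Proof.
have -> : cos v = cos ((v / 2) *+ 2) by congr cos; field.
by rewrite cos_mulr2n cos2sin2; ring.
Qed.

Lemma one_sub_cos_le v : 1 - cos v <= v ^+ 2 / 2.
Proof.
rewrite one_sub_cos.
have : sin (v / 2) ^+ 2 <= (v / 2) ^+ 2.
  by rewrite -[X in X <= _]real_normK ?num_real // -[leRHS]real_normK ?num_real //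
     ler_sqr ?nnegrE // normr_sin_le.
rewrite expr_div_n; lra.
Qed.

Lemma cos_lt_pi x y : 0 <= x -> x < y -> y <= pi -> cos y < cos x.
Proof.
move=> x0 xy ypi; have y0 := le_trans x0 (ltW xy).
by rewrite ltr_cos // in_itv /= ?x0 ?y0 //= (le_trans (ltW xy)).
Qed.

Lemma cos_le_pi x y : 0 <= x -> x <= y -> y <= pi -> cos y <= cos x.
Proof.
move=> x0; rewrite le_eqVlt => /orP[/eqP -> //|xy ypi].
exact: ltW (cos_lt_pi _ _ _).
Qed.

Lemma sin_ge_mul_cos x : 0 <= x <= pi / 2 -> x * cos x <= sin x.
Proof.
case/andP; rewrite le_eqVlt => /orP[/eqP <- _|x0 xpi].
  by rewrite mul0r sin0.
have [|c] := @MVT R sin cos 0 x x0 (fun z _ => is_derive_sin z).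
  by apply: continuous_subspaceT => z; exact: continuous_sin.
rewrite in_itv /= sin0 !subr0 => /andP[c0 cx] ->; rewrite mulrC; apply: ler_wpM2r; first exact: ltW.
have p0 := pi_gt0 R.
by apply: cos_le_pi; lra.
Qed.

(** For [v >= 0], [1 - cos v = 2 sin^2 (v / 2)] and [sin (v / 2) = 2 cos (v / 4) sin (v / 4) >= (v /
    2) cos^2 (v / 4)]; here [c] is [cos^2 (3 pi / 8)]. The range [3 pi / 2] covers [(y - g) / N] for
    [|y| <= pi N] and [|g| <= pi N / 2]. *)
Lemma one_sub_cos_ge : exists2 k : R, 0 < k &
  forall v, `|v| <= 3 / 2 * pi -> k * v ^+ 2 <= 1 - cos v.
Proof.
have p0 := pi_gt0 R.
pose c := (1 + cos (3 / 4 * pi)) / 2 : R.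
have c0 : 0 < c.
  have : cos pi < cos (3 / 4 * pi) :> R.
    by apply: cos_lt_pi; lra.
  rewrite cospi /c; lra.
exists (c ^+ 2 / 2); first by rewrite divr_gt0 ?exprn_gt0.
move=> v; wlog v0 : v / 0 <= v => [H hv|].
  case: (leP 0 v) => [/H|vn]; first exact.
  by rewrite -cosN -(sqrrN v); apply: H; rewrite ?normrN // oppr_ge0 ltW.
rewrite (ger0_norm v0) => hv; rewrite one_sub_cos.
have h1 : c * (v / 2) <= sin (v / 2).
  have -> : sin (v / 2) = 2 * (cos (v / 4) * sin (v / 4)).
    by rewrite mulr_natl -sin_mulr2n; congr sin; field.
  have h4 : (v / 4) * cos (v / 4) <= sin (v / 4).
    by apply: sin_ge_mul_cos; apply/andP; split; lra.
  have c4 : 0 <= cos (v / 4).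
    by apply: cos_ge0_pihalf; apply/andP; split; lra.
  have c2 : c <= cos (v / 4) ^+ 2.
    have := cos_mulr2n (v / 4).
    have -> : v / 4 *+ 2 = v / 2 by field.
    have : cos (3 / 4 * pi) <= cos (v / 2).
      by apply: cos_le_pi; lra.
    move=> h1 h2; rewrite /c ler_pdivrMr //; apply: le_trans (_ : 1 + cos (v / 2) <= _).
      by rewrite lerD2l.
    by rewrite h2 addrC subrK mulr_natr.
  nra.
have cv : 0 <= c * (v / 2) by rewrite mulr_ge0 ?divr_ge0 // ltW.
have : (c * (v / 2)) ^+ 2 <= sin (v / 2) ^+ 2.
  by rewrite ler_sqr ?nnegrE // (le_trans cv).
by rewrite exprMn expr_div_n; lra.
Qed.

Lemma one_sub_expRN_le u : 1 - expR (- u) <= u.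
Proof. by have := expR_ge1Dx (- u); lra. Qed.

Lemma one_sub_expRN_ge u : 0 <= u <= 1 -> u / 2 <= 1 - expR (- u).
Proof.
case/andP=> u0 u1; have e0 := expR_gt0 u; have := expR_ge1Dx u => h.
rewrite expRN; have e1 := expRxMexpNx_1 u.
have h2 : expR u * (expR u)^-1 = 1 by rewrite divff // gt_eqF.
have : 0 < (expR u)^-1 by rewrite invr_gt0.
by nra.
Qed.

(* [dist2 x (cos t) = |1 - x e^{it}|^2], and
   [1 + gain x (cos t) = |1 - x^2 e^{it}|^2 / (x |1 - x e^{it}|^2)]. *)
Definition dist2 x c := (1 - x) ^+ 2 + 2 * x * (1 - c).

Definition gain x c := (1 - x) ^+ 2 * (1 + x + x ^+ 2) / (x * dist2 x c).

Lemma dist2_gt0 x c : 0 < x < 1 -> c <= 1 -> 0 < dist2 x c.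
Proof.
move=> /andP[x0 x1] c1; rewrite /dist2.
have : 0 < (1 - x) ^+ 2 by rewrite exprn_gt0 // subr_gt0.
have : 0 <= x * (1 - c) by apply: mulr_ge0; rewrite ?subr_ge0 // ltW.
lra.
Qed.

(** In [dist2 (x ^+ 2) c - x * dist2 x c] the terms in [c] cancel and [(1 - x)^2 (1 + x + x^2)]
    remains. Splitting off a factor [x] thus makes the gain nonnegative. *)
Lemma dist2_sqr x c : 0 < x < 1 -> c <= 1 ->
  dist2 (x ^+ 2) c = x * ((1 + gain x c) * dist2 x c).
Proof.
move=> x01 c1; have d0 := dist2_gt0 x01 c1; case/andP: x01 => x0 x1.
rewrite mulrDl mul1r mulrDr /gain.
have -> : x * ((1 - x) ^+ 2 * (1 + x + x ^+ 2) / (x * dist2 x c) * dist2 x c) =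
   (1 - x) ^+ 2 * (1 + x + x ^+ 2).
  by field; rewrite !gt_eqF.
rewrite /dist2; ring.
Qed.

Lemma gain_ge0 x c : 0 < x < 1 -> c <= 1 -> 0 <= gain x c.
Proof.
move=> x01 c1; have d0 := dist2_gt0 x01 c1; case/andP: x01 => x0 x1.
apply: divr_ge0; last by apply: ltW; exact: mulr_gt0.
by apply: mulr_ge0; rewrite ?sqr_ge0 // ltW // !addr_gt0 ?exprn_gt0.
Qed.

(** The bound is [(4 t^2 + v^2) / (t^2 + v^2) - 1], the gain of a linear function with a zero at
    height [v] on the axis when the distance [t] to the axis is doubled. *)
Lemma gain_ge x c v t : 0 < x < 1 -> c <= 1 -> 2 * (1 - c) <= v ^+ 2 ->
  0 < t <= 1 - x -> 3 * t ^+ 2 / (t ^+ 2 + v ^+ 2) <= gain x c.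
Proof.
move=> x01 c1 cv /andP[t0 tx]; have d0 := dist2_gt0 x01 c1.
case/andP: x01 => x0 x1; rewrite /gain.
have t20 : 0 < t ^+ 2 by rewrite exprn_gt0.
have v20 : 0 <= v ^+ 2 by rewrite sqr_ge0.
rewrite ler_pdivrMr; last lra.
rewrite mulrAC ler_pdivlMr ?mulr_gt0 // /dist2.
set s := 1 - x in tx *; set a := v ^+ 2 in cv v20 *.
have s2 : t ^+ 2 <= s ^+ 2 by rewrite ler_sqr ?nnegrE // ?ltW // (lt_le_trans t0).
set T := t ^+ 2 in t20 s2 *; set S := s ^+ 2 in s2 *.
have h1 : 2 * x * (1 - c) <= a.
  have : x * (1 - c) <= 1 * (1 - c) by apply: ler_wpM2r; rewrite ?subr_ge0 // ltW.
  lra.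
have h2 : 3 * x <= 1 + x + x ^+ 2 by have := sqr_ge0 (1 - x); rewrite sqrrB; lra.
have h3 : T * (S + 2 * x * (1 - c)) <= S * (T + a).
  have : 0 <= 2 * x * (1 - c) by apply: mulr_ge0; rewrite ?subr_ge0 // mulr_ge0 // ltW.
  set q := 2 * x * (1 - c) in h1 *; nra.
have q0 : 0 <= T * (S + 2 * x * (1 - c)).
  apply: mulr_ge0; first exact: ltW.
  apply: addr_ge0; first exact: sqr_ge0.
  by apply: mulr_ge0; rewrite ?subr_ge0 // mulr_ge0 // ltW.
set q := T * _ in h3 q0; set w := S * (T + a) in h3.
have -> : 3 * T * (x * (S + 2 * x * (1 - c))) = 3 * x * q by rewrite /q; ring.
have -> : S * (1 + x + x ^+ 2) * (T + a) = (1 + x + x ^+ 2) * w by rewrite /w; ring.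
by nra.
Qed.

Lemma gain_le x c : 0 < x < 1 -> c <= 1 -> gain x c <= 3 / x.
Proof.
move=> x01 c1; have d0 := dist2_gt0 x01 c1.
case/andP: x01 => x0 x1; rewrite /gain invfM mulrA ler_pdivrMr //.
rewrite [leRHS]mulrAC; apply: ler_wpM2r; first by rewrite invr_ge0 ltW.
rewrite /dist2.
have : 0 <= x * (1 - c) by apply: mulr_ge0; rewrite ?subr_ge0 // ltW.
have s0 : 0 <= (1 - x) ^+ 2 by rewrite sqr_ge0.
have : (1 - x) ^+ 2 * (1 + x + x ^+ 2) <= (1 - x) ^+ 2 * 3.
  by apply: ler_wpM2l => //; nra.
by lra.
Qed.

(** Gains of far zeros at a small scale are compared with their gains at scale [t1], whose sum can
    be controlled; the ratio is quadratic in the scale. The constant is 12, from the upper bound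
    [12 (1 - x)^2 / d], divided by [3 / 4 / (1 + 1 / k)], from the lower bound. *)
Lemma gain_far x c x1 t1 k : 0 < x < 1 -> 1 / 2 <= x -> c < 1 -> 0 < x1 < 1 ->
  0 < t1 -> 1 - x1 <= t1 -> t1 <= 2 * (1 - x1) -> 0 < k ->
  k * t1 ^+ 2 <= 2 * (1 - c) ->
  gain x c <= 16 * (1 + k^-1) * ((1 - x) / t1) ^+ 2 * gain x1 c.
Proof.
move=> x01 xh cl x101 t10 xt1 t1x k0 kc.
have [x0 xl] := andP x01; have [x10 x1l] := andP x101.
set d := 2 * (1 - c) in kc; have d0 : 0 < d by rewrite /d; lra.
have U : gain x c <= 12 * (1 - x) ^+ 2 / d.
  rewrite /gain ler_pdivrMr; last by rewrite mulr_gt0 ?dist2_gt0 ?(ltW cl).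
  rewrite [leRHS]mulrAC ler_pdivlMr //.
  have s0 : 0 <= (1 - x) ^+ 2 by rewrite sqr_ge0.
  have hD : x * d <= dist2 x c by rewrite /dist2 /d; lra.
  set s := (1 - x) ^+ 2 in s0 *; set D := dist2 x c in hD *.
  have h1 : x * (x * d) <= x * D by rewrite ler_pM2l.
  have h2 : d / 4 <= x * (x * d).
    by rewrite mulrA mulrC; apply: ler_wpM2r; [rewrite ltW|nra].
  have h3 : (1 + x + x ^+ 2) * d <= 3 * d by apply: ler_wpM2r; [rewrite ltW|nra].
  have -> : 12 * s * (x * D) = s * (12 * (x * D)) by ring.
  by rewrite -mulrA; apply: ler_wpM2l => //; lra.
have L : 3 / 4 * (1 / (1 + k^-1)) * t1 ^+ 2 / d <= gain x1 c.
  apply: (@le_trans _ _ (3 * (1 - x1) ^+ 2 / ((1 - x1) ^+ 2 + (Num.sqrt d) ^+ 2))).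
    rewrite (sqr_sqrtr (ltW d0)).
    have tp : 0 < (1 - x1) ^+ 2 by rewrite exprn_gt0 // subr_gt0.
    have h1 : (1 - x1) ^+ 2 <= t1 ^+ 2 by rewrite ler_sqr ?nnegrE; lra.
    have h2 : t1 ^+ 2 <= 4 * (1 - x1) ^+ 2 by nra.
    set T := t1 ^+ 2 in kc h1 h2 *; set S := (1 - x1) ^+ 2 in tp h1 h2 *.
    have h3 : S <= d / k by rewrite ler_pdivlMr // mulrC (le_trans _ kc) // ler_pM2l.
    have q0 : 0 < k^-1 by rewrite invr_gt0.
    set q := k^-1 in h3 q0 *.
    rewrite ler_pdivlMr ?addr_gt0 // mulrAC ler_pdivrMr //.
    have -> : 3 / 4 * (1 / (1 + q)) * T * (S + d) = 3 / 4 * T * ((S + d) / (1 + q)).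
      by ring.
    have : (S + d) / (1 + q) <= d by rewrite ler_pdivrMr; nra.
    move=> hw; apply: (@le_trans _ _ (3 / 4 * T * d)).
      by apply: ler_wpM2l => //; lra.
    by apply: ler_wpM2r; [rewrite ltW|lra].
  apply: gain_ge => //; first by rewrite ltW.
    by rewrite (sqr_sqrtr (ltW d0)).
  by rewrite subr_gt0 x1l lexx.
apply: le_trans U _.
have A0 : 0 <= 16 * (1 + k^-1) * ((1 - x) / t1) ^+ 2.
  have : 0 < k^-1 by rewrite invr_gt0.
  by move=> q0; apply: mulr_ge0; rewrite ?sqr_ge0 // mulr_ge0 // addr_ge0 // ltW.
apply: le_trans (ler_wpM2l A0 L).
have -> : 16 * (1 + k^-1) * ((1 - x) / t1) ^+ 2 * (3 / 4 * (1 / (1 + k^-1)) * t1 ^+ 2 / d)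
   = 12 * (1 - x) ^+ 2 / d.
  have : 0 < k^-1 by rewrite invr_gt0.
  move=> ?; field; rewrite !gt_eqF //; lra.
by [].
Qed.

End RealBounds.

(** * Gains of zeros at scale 1 / N *)

Section ScaledGain.
Variable R : realType.
Implicit Types (k d s y g c : R) (N : nat).

Lemma cos_far k d N y g : 0 < k ->
  (forall v : R, `|v| <= 3 / 2 * pi -> k * v ^+ 2 <= 1 - cos v) ->
  (0 < N)%N -> 0 < d -> `|y| <= pi * N%:R -> `|g| <= 1 / 2 * pi * N%:R ->
  d < `|y - g| ->
  2 * k * d ^+ 2 * (1 / N%:R) ^+ 2 <= 2 * (1 - cos ((y - g) / N%:R)).
Proof.
move=> k0 kP N0 d0 yN gN dy; have Nr : 0 < N%:R :> R by rewrite ltr0n.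
have h : k * ((y - g) / N%:R) ^+ 2 <= 1 - cos ((y - g) / N%:R).
  apply: kP; rewrite normrM (ger0_norm (_ : 0 <= N%:R^-1)) ?invr_ge0 //.
  rewrite ler_pdivrMr //; apply: le_trans (ler_normB _ _) _; lra.
apply: le_trans (ler_wpM2l _ h) => //.
have -> : 2 * k * d ^+ 2 * (1 / N%:R) ^+ 2 = 2 * (k * (d ^+ 2 / N%:R ^+ 2)).
  by rewrite expr_div_n expr1n; ring.
rewrite ler_pM2l // ler_pM2l // expr_div_n; apply: ler_wpM2r.
  by rewrite invr_ge0 exprn_ge0.
by rewrite -[leRHS]real_normK ?num_real // ler_sqr ?nnegrE // ltW.
Qed.

Lemma gain_far_scaled k s N c : (2 <= N)%N -> 0 < s <= 1 / 2 -> 0 < k ->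
  c <= 1 -> k * (1 / N%:R) ^+ 2 <= 2 * (1 - c) ->
  gain (expR (- (s / N%:R))) c <=
  16 * (1 + k^-1) * s ^+ 2 * gain (expR (- (1 / N%:R))) c.
Proof.
move=> N2 /andP[s0 s1] k0 c1 kc.
have N0 : (0 < N)%N by apply: leq_trans N2.
have Nr : 0 < N%:R :> R by rewrite ltr0n.
have Ni1 : 0 < 1 / N%:R :> R by rewrite divr_gt0.
have Ni2 : 1 / N%:R <= 1 / 2 :> R by rewrite !div1r lef_pV2 ?posrE // ler_nat.
have sN : 0 < s / N%:R by rewrite divr_gt0.
have sN2 : s / N%:R <= 1 / 2 * (1 / N%:R).
  by rewrite [leRHS]mulrA mulr1; apply: ler_wpM2r => //; rewrite invr_ge0.
have x01 (t : R) : 0 < t -> 0 < expR (- (t / N%:R)) < 1.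
  by move=> t0; rewrite expR_gt0 expR_lt1 oppr_lt0 divr_gt0.
have cl : c < 1.
  have : 0 < k * (1 / N%:R) ^+ 2 by rewrite mulr_gt0 // exprn_gt0.
  by move=> ?; lra.
have h1 := one_sub_expRN_le (s / N%:R).
have h2 := one_sub_expRN_le (1 / N%:R : R).
have h3 : 1 / N%:R / 2 <= 1 - expR (- (1 / N%:R)) :> R.
  by apply: one_sub_expRN_ge; rewrite ltW //=; lra.
have xs := x01 s s0; have x1 := x01 1 ltr01.
apply: le_trans (@gain_far _ _ c _ (1 / N%:R) k xs _ cl x1 Ni1 h2 _ k0 kc) _.
- by lra.
- by lra.
apply: ler_wpM2r; first exact: gain_ge0.
have k1 : 0 < 16 * (1 + k^-1) by rewrite mulr_gt0 // addr_gt0 // invr_gt0.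
rewrite ler_pM2l // ler_sqr ?nnegrE ?(ltW s0) //.
  by rewrite ler_pdivrMr // mulrA mulr1.
by apply: divr_ge0; [rewrite subr_ge0 ltW //; case/andP: xs|exact: ltW].
Qed.

End ScaledGain.

(** * Separation of finitely many points *)

Section SeqLemmas.
Variable R : realType.

Lemma seq_lower_bound (s : seq R) (f : R -> R) :
  {in s, forall y, 0 < f y} -> exists2 d, 0 < d & {in s, forall y, d < f y}.
Proof.
elim: s => [|a s IH] h; first by exists 1.
have [|d d0 hd] := IH; first by move=> y ys'; apply: h; rewrite inE ys' orbT.
have a0 : 0 < f a / 2 by rewrite divr_gt0 // h ?mem_head.
exists (Num.min d (f a / 2)); first by rewrite lt_min d0 a0.
move=> y; rewrite inE => /orP[/eqP ->|/hd]; last by rewrite gt_min => ->.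
by rewrite gt_min; apply/orP; right; have := h a (mem_head _ _); lra.
Qed.

Lemma seq_separated (s : seq R) : exists2 d : R, 0 < d &
  {in s &, forall a b, a != b -> 2 * d < `|a - b|}.
Proof.
elim: s => [|c s [d d0 hd]]; first by exists 1.
have [|e e0 he] := @seq_lower_bound [seq b <- s | b != c] (fun b => `|c - b|).
  by move=> b; rewrite mem_filter normr_gt0 subr_eq0 eq_sym => /andP[].
have m0 : 0 < Num.min d (e / 2) by rewrite lt_min d0 divr_gt0.
have m1 : 2 * Num.min d (e / 2) <= 2 * d by rewrite ler_pM2l // ge_min lexx.
have m2 : 2 * Num.min d (e / 2) <= e.
  have : Num.min d (e / 2) <= e / 2 by rewrite ge_min lexx orbT.
  by lra.
exists (Num.min d (e / 2)) => // a b; rewrite !inE.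
case: (eqVneq a c) => [->|ac] /= ha; case: (eqVneq b c) => [->|bc] //= hb ab.
- by apply: le_lt_trans m2 _; apply: he; rewrite mem_filter bc.
- by rewrite distrC; apply: le_lt_trans m2 _; apply: he; rewrite mem_filter ac.
- by apply: le_lt_trans m1 _; apply: hd.
Qed.

Lemma count_near_le1 (s : seq R) (d y : R) : uniq s ->
  {in s &, forall a b, a != b -> 2 * d < `|a - b|} ->
  (count (fun g : R => (`|y - g| <= d)%R) s <= 1)%N.
Proof.
elim: s => //= a s IH /andP[as' us] sep.
have seps : {in s &, forall a b, a != b -> 2 * d < `|a - b|}.
  by move=> b c bs cs; apply: sep; rewrite inE ?bs ?cs orbT.
case: (boolP (`|y - a| <= d)) => [ya|_]; last by rewrite add0n IH.
rewrite (_ : count _ s = 0%N) //; apply/eqP; rewrite -leqn0 leqNgt -has_count.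
apply/hasPn => b bs; apply/negP => yb.
have ab : a != b by apply: contraNneq as' => ->.
have : `|a - b| <= 2 * d.
  have -> : a - b = (y - b) - (y - a) by ring.
  by apply: le_trans (ler_normB _ _) _; lra.
by apply/negP; rewrite -ltNge; apply: sep => //; rewrite inE ?eqxx ?bs ?orbT.
Qed.

Lemma sum_const_seq_cond (T : Type) (s : seq T) (P : pred T) (c : R) :
  \sum_(y <- s | P y) c = (count P s)%:R * c.
Proof. by rewrite big_const_seq iter_addr_0 mulr_natl. Qed.

End SeqLemmas.

(* In the application [G s g = |F(s + ig)|^2], while [G_ i] is the same function for an
   approximant of [F] that is a polynomial in [exp (- z / N i)] with all its zeros,
   the [i * y] for [y] in [ys i], on the imaginary axis. *)
Section Hurwitz.
Variables (R : realType) (I : Type) (Fl : set_system I).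
Context {FF : ProperFilter Fl}.
Variables (N : I -> nat) (ys : I -> seq R) (G_ : I -> R -> R -> R).
Variables (G : R -> R -> R) (kap Lam : R) (mult : R -> nat).
Hypothesis N_ge : forall K, \forall i \near Fl, (K <= N i)%N.
Hypothesis ys_le : forall i y, y \in ys i -> `|y| <= pi * (N i)%:R.
Hypothesis kap_gt0 : 0 < kap.
Hypothesis G_E : forall i s g, G_ i s g =
  kap * \prod_(y <- ys i) dist2 (expR (- (s / (N i)%:R))) (cos ((y - g) / (N i)%:R)).
Hypothesis size_cvg : (size (ys i))%:R / (N i)%:R @[i --> Fl] --> Lam.
Hypothesis G_cvg : forall s g, 0 < s -> G_ i s g @[i --> Fl] --> G s g.
Hypothesis G_gt0 : forall s g, 0 < s -> 0 < G s g.
Hypothesis multP : forall g, G (2 * s) g / G s g @[s --> 0^'+] --> (4 : R) ^+ mult g.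

Let x i s : R := expR (- (s / (N i)%:R)).
Let gn i s g y := gain (x i s) (cos ((y - g) / (N i)%:R)).
(* [A i s g] is [e^{s Lam} |F(2s + ig)|^2 / |F(s + ig)|^2] for the approximant. A zero
   at distance [D] from [g] contributes about [(4 s^2 + D^2) / (s^2 + D^2)]. *)
Let A i s g := \prod_(y <- ys i) (1 + gn i s g y).
Let cnt i (g d : R) : nat := count (fun y : R => `|y - g| <= d) (ys i).
Let AA s g := expR (s * Lam) * (G (2 * s) g / G s g).

Lemma sum_le_prod1D (s : seq R) (f : R -> R) :
  {in s, forall y, 0 <= f y} -> 1 + \sum_(y <- s) f y <= \prod_(y <- s) (1 + f y).
Proof.
elim: s => [|a s IH] h; first by rewrite !big_nil addr0.
rewrite !big_cons; have a0 := h a (mem_head _ _).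
have hs : {in s, forall y, 0 <= f y} by move=> y ys'; apply: h; rewrite inE ys' orbT.
have := IH hs; have : 0 <= \sum_(y <- s) f y by rewrite big_seq sumr_ge0.
set S := \sum_(_ <- _) _; set p := \prod_(_ <- _) _; nra.
Qed.

Lemma prod1D_le_expR (s : seq R) (P : pred R) (f : R -> R) :
  {in s, forall y, 0 <= f y} ->
  \prod_(y <- s | P y) (1 + f y) <= expR (\sum_(y <- s | P y) f y).
Proof.
move=> h; rewrite big_seq_cond [X in expR X]big_seq_cond.
elim/big_rec2: _ => [|y p q /andP[/h f0 _] qp]; first by rewrite expR0.
rewrite expRD; apply: le_trans (_ : (1 + f y) * expR p <= _).
  by apply: ler_wpM2l => //; rewrite addr_ge0.
by apply: ler_wpM2r; rewrite ?expR_ge0 // expR_ge1Dx.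
Qed.

Lemma expr_count_le_prod (s : seq R) (P : pred R) (f : R -> R) (q : R) :
  {in s, forall y, 0 <= f y} -> 1 <= q ->
  {in s, forall y, P y -> q <= 1 + f y} -> q ^+ count P s <= \prod_(y <- s) (1 + f y).
Proof.
elim: s => [|a s IH] h q1 hq; first by rewrite big_nil.
rewrite big_cons /=; have a0 := h a (mem_head _ _).
have hs : {in s, forall y, 0 <= f y} by move=> y ys'; apply: h; rewrite inE ys' orbT.
have hqs : {in s, forall y, P y -> q <= 1 + f y}.
  by move=> y ys'; apply: hq; rewrite inE ys' orbT.
have {IH} := IH hs q1 hqs => IH.
have q0 : 0 <= q ^+ count P s by rewrite exprn_ge0 // (le_trans ler01).
case: (boolP (P a)) => Pa; last first.
  by rewrite add0n -[leLHS]mul1r; apply: ler_pM => //; rewrite lerDl.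
rewrite exprD expr1; apply: ler_pM => //; first by rewrite (le_trans ler01).
by apply: hq; rewrite ?mem_head.
Qed.

Lemma bernoulli_sub (a : R) n : 0 <= a <= 1 -> 1 - n%:R * a <= (1 - a) ^+ n.
Proof.
move=> /andP[a0 a1]; elim: n => [|n IH]; first by rewrite mul0r subr0 expr0.
rewrite exprS; apply: le_trans (_ : (1 - a) * (1 - n%:R * a) <= _).
  have : 0 <= n%:R * a * a by rewrite !mulr_ge0.
  by rewrite -natr1; lra.
by apply: ler_wpM2l => //; rewrite subr_ge0.
Qed.

Lemma x01 i s : (0 < N i)%N -> 0 < s -> 0 < x i s < 1.
Proof.
move=> Ni s0; rewrite /x expR_gt0 expR_lt1 oppr_lt0 divr_gt0 // ltr0n.
by [].
Qed.

Lemma gn_ge0 i s g y : (0 < N i)%N -> 0 < s -> 0 <= gn i s g y.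
Proof. by move=> Ni s0; apply: gain_ge0; [exact: x01|exact: cos_le1]. Qed.

Lemma G_i_gt0 i s g : (0 < N i)%N -> 0 < s -> 0 < G_ i s g.
Proof.
move=> Ni s0; rewrite G_E mulr_gt0 // prodr_gt0 // => y _.
by apply: dist2_gt0; [exact: x01|exact: cos_le1].
Qed.

(** Each use of [dist2_sqr] leaves a factor [x i s]; the exponential collects them, one per zero. *)
Lemma prod_gain i s g : (0 < N i)%N -> 0 < s ->
  A i s g = expR (s * ((size (ys i))%:R / (N i)%:R)) * (G_ i (2 * s) g / G_ i s g).
Proof.
move=> Ni s0; have Gi := G_i_gt0 g Ni s0.
apply: (mulIf (lt0r_neq0 Gi)); rewrite -mulrA divfK ?gt_eqF //.
rewrite !G_E mulrCA [RHS]mulrCA; congr (_ * _).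
have -> : expR (- (2 * s / (N i)%:R)) = x i s ^+ 2.
  by rewrite /x expr2 -expRD; congr expR; ring.
have -> : expR (s * ((size (ys i))%:R / (N i)%:R)) = (x i s)^-1 ^+ size (ys i).
  rewrite /x -expRN opprK -expRM_natl; congr expR; ring.
rewrite -/(x i s) /A; have := x01 Ni s0; set X := x i s => X01.
have X0 : X != 0 by case/andP: X01 => /gt_eqF ->.
elim: (ys i) => [|y r IH]; first by rewrite !big_nil expr0.
rewrite !big_cons /= (dist2_sqr X01 (cos_le1 _)) exprS.
rewrite mulrACA IH -/(gn i s g y).
by field.
Qed.

Lemma A_cvg s g : 0 < s -> A i s g @[i --> Fl] --> AA s g.
Proof.
move=> s0; apply: (@cvg_trans _
    (expR (s * ((size (ys i))%:R / (N i)%:R)) * (G_ i (2 * s) g / G_ i s g) @[i --> Fl])).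
  apply: near_eq_cvg; near=> i.
  by rewrite prod_gain //; near: i; exact: (N_ge 1).
apply: cvgM.
  apply: continuous_cvg; first exact: continuous_expR.
  by apply: cvgM; [exact: cvg_cst|exact: size_cvg].
apply: cvgM; first by apply: G_cvg; rewrite mulr_gt0.
by apply: cvgV; [rewrite gt_eqF // G_gt0|exact: G_cvg].
Unshelve. all: end_near. Qed.

Lemma AA_cvg g : AA s g @[s --> 0^'+] --> (4 : R) ^+ mult g.
Proof.
have -> : (4 : R) ^+ mult g = expR (0 * Lam) * 4 ^+ mult g.
  by rewrite mul0r expR0 mul1r.
apply: cvgM => //; apply: continuous_cvg; first exact: continuous_expR.
apply: cvgM; last exact: cvg_cst.
by apply: cvg_at_right_filter; exact: cvg_id.
Qed.

(** With one zero too many near [g], the product would be at least [q ^+ m.+1] with [q] close to 4.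
    This exceeds [5 / 2 * 4 ^+ m], whereas convergence keeps the product below. *)
Lemma count_upper (g : R) : exists2 e : R, 0 < e & forall d, d <= e ->
  \forall i \near Fl, (cnt i g d <= mult g)%N.
Proof.
have [s [s0 s1 As]] : exists s, [/\ 0 < s, s <= 1 & AA s g < 2 * 4 ^+ mult g].
  near (0 : R)^'+ => s; exists s; split.
  - by [].
  - by near: s; exact: nbhs_right_le.
  - near: s; apply: (@cvgr_lt _ _ _ _ _ _ (@AA_cvg g)).
    by rewrite ltr_pMl ?exprn_gt0 // ltr1n.
set m := mult g in As *; pose M : R := m.+1%:R.
have M1 : 1 <= M by rewrite ler1n.
have M0 : 0 < M by rewrite ltr0n.
(* Zeros within [s / (4 M)] of [g] have gain at least [12 M^2 / (4 M^2 + 1)]. The loss against 3 is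
   small enough for [M = m + 1] factors: by Bernoulli's inequality at least [17 / 20] of [4 ^+ m.+1]
   is kept. *)
pose e := s / (4 * M); have e0 : 0 < e by rewrite divr_gt0 // mulr_gt0.
exists e => // d de; near=> i.
have Ni : (0 < N i)%N by near: i; exact: (N_ge 1).
have Ai : A i s g < 5 / 2 * 4 ^+ m.
  near: i; apply: (@cvgr_lt _ _ _ _ _ _ (@A_cvg s g s0)); apply: lt_le_trans As _.
  by rewrite ler_wpM2r ?exprn_ge0 //; lra.
rewrite leqNgt; apply/negP => cm.
pose q := 1 + 12 * M ^+ 2 / (4 * M ^+ 2 + 1).
have q4 : q = 4 * (1 - 3 / 4 / (4 * M ^+ 2 + 1)).
  by rewrite /q; field; rewrite gt_eqF // addr_gt0 // mulr_gt0 // exprn_gt0.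
have q1 : 1 <= q by rewrite lerDl divr_ge0 // ?addr_ge0 // mulr_ge0 // exprn_ge0 // ltW.
have : q ^+ m.+1 <= A i s g.
  apply: le_trans (ler_weXn2l q1 cm) _; apply: expr_count_le_prod => //.
    by move=> y _; apply: gn_ge0.
  move=> y _ yd; rewrite lerD2l.
  have Nr : 0 < (N i)%:R :> R by rewrite ltr0n.
  have sN : 0 < s / (N i)%:R by rewrite divr_gt0.
  have N1 : 1 <= (N i)%:R :> R by rewrite ler1n.
  apply: le_trans (@gain_ge _ (x i s) (cos ((y - g) / (N i)%:R)) (e / (N i)%:R) (s / (N i)%:R / 2) _ _ _ _).
  - rewrite le_eqVlt; apply/orP; left; apply/eqP; rewrite /e; field.
    rewrite !gt_eqF //= addr_gt0 // ?mulr_gt0 // ?exprn_gt0 // ?mulr_gt0 //.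
  - exact: x01.
  - exact: cos_le1.
  - apply: (@le_trans _ _ (((y - g) / (N i)%:R) ^+ 2)).
      by have := one_sub_cos_le ((y - g) / (N i)%:R); lra.
    have eN : 0 <= e / (N i)%:R by rewrite divr_ge0 // ltW.
    rewrite -[leLHS]real_normK ?num_real // ler_sqr ?nnegrE //.
    rewrite normrM (ger0_norm (_ : 0 <= (N i)%:R^-1)) ?invr_ge0 //.
    by rewrite ler_pM2r ?invr_gt0 // (le_trans yd).
  - rewrite divr_gt0 //=; apply: one_sub_expRN_ge; rewrite ltW //=.
    by rewrite ler_pdivrMr // mul1r (le_trans s1).
apply/negP; rewrite -ltNge; apply: lt_le_trans Ai _.
rewrite q4; set a := 3 / 4 / _; rewrite exprMn exprS.
have a0 : 0 <= a by rewrite divr_ge0 // addr_ge0 // mulr_ge0 // exprn_ge0 // ltW.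
have aM : M * a <= 3 / 20.
  rewrite /a mulrA ler_pdivrMr ?addr_gt0 ?mulr_gt0 ?exprn_gt0 //; nra.
have a1 : a <= 1 by nra.
have : 1 - M * a <= (1 - a) ^+ m.+1 by apply: bernoulli_sub; rewrite a0 a1.
have p4 : 0 < (4 : R) ^+ m by rewrite exprn_gt0.
set w := (1 - a) ^+ _; set z := 4 ^+ m in p4 *; nra.
Unshelve. all: end_near. Qed.

Lemma invN_cvg : ((N i)%:R : R)^-1 @[i --> Fl] --> (0 : R).
Proof.
apply/cvgrPdist_le => e e0; near=> i.
have Ni : (Num.truncn e^-1 < N i)%N by near: i; exact: N_ge.
have N0 : (0 < N i)%N by apply: leq_ltn_trans Ni.
rewrite sub0r normrN ger0_norm ?invr_ge0 //.
rewrite -[leRHS]invrK lef_pV2 ?posrE ?invr_gt0 ?ltr0n //.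
apply: ltW; apply: lt_le_trans (truncnS_gt _) _; rewrite ler_nat //.
Unshelve. all: end_near. Qed.

Lemma x_cvg s : x i s @[i --> Fl] --> (1 : R).
Proof.
rewrite -expR0 -oppr0 -(mulr0 s); apply: continuous_cvg; first exact: continuous_expR.
by apply: cvgN; apply: cvgM; [exact: cvg_cst|exact: invN_cvg].
Qed.

(** If [mult g = m.+1] and at most [m] zeros are near [g], the near factors give about [4 ^+ m] and
    the far ones at most [exp (K s^2 B)], where [B] bounds the product at scale 1. For small [s]
    this stays below [3 / 2 * 4 ^+ m], whereas the product must be near [4 ^+ m.+1]. *)
Lemma count_lower (g d : R) : 0 < d ->
  \forall i \near Fl, (mult g <= cnt i g d)%N.
Proof.
move=> d0; case E : (mult g) => [|m]; first exact: filterE.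
have [k k0 kP] := one_sub_cos_ge R.
pose ka := 2 * k * d ^+ 2; have ka0 : 0 < ka by rewrite !mulr_gt0 // exprn_gt0.
pose B := AA 1 g + 1; have B1 : 1 <= B.
  by rewrite lerDr mulr_ge0 ?expR_ge0 // divr_ge0 // ltW // G_gt0.
pose K := 16 * (1 + ka^-1); have K0 : 0 < K by rewrite mulr_gt0 // addr_gt0 // invr_gt0.
have KB : 0 < K * B by rewrite mulr_gt0 // (lt_le_trans ltr01).
(* The value [1 / 11] serves because [exp (1 / 11) <= 1 / (1 - 1 / 11) = 11 / 10], and
   [(11 / 10)^2 < 3 / 2]. *)
have [s [s0 s1 sKB As]] : exists s, [/\ 0 < s, s <= 1 / 2, K * B * s <= 1 / 11
     & 2 * 4 ^+ m - 1 / 2 * 4 ^+ m < AA s g].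
  near (0 : R)^'+ => s; exists s; split.
  - by [].
  - by near: s; apply: nbhs_right_le; rewrite divr_gt0.
  - rewrite mulrC -ler_pdivlMr //; near: s; apply: nbhs_right_le.
    by rewrite !divr_gt0.
  - near: s; apply: (@cvgr_gt _ _ _ _ _ _ (@AA_cvg g)); rewrite E exprS.
    have p4 : 0 < (4 : R) ^+ m by rewrite exprn_gt0.
    lra.
near=> i.
have Ni : (2 <= N i)%N by near: i; exact: (N_ge 2).
have Ni0 : (0 < N i)%N by apply: leq_trans Ni.
have Ng : `|g| <= 1 / 2 * pi * (N i)%:R.
  have p0 := pi_gt0 R.
  rewrite mulrC -ler_pdivrMr ?mulr_gt0 //.
  have : (Num.truncn (`|g| / (1 / 2 * pi)) < N i)%N by near: i; exact: N_ge.
  by rewrite -(ler_nat R); apply: le_trans; exact: ltW (truncnS_gt _).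
have Ai : 2 * 4 ^+ m - 1 / 2 * 4 ^+ m < A i s g.
  by near: i; exact: (@cvgr_gt _ _ _ _ _ _ (@A_cvg s g s0)).
have A1 : A i 1 g <= B.
  by near: i; apply: (@cvgr_le _ _ _ _ _ _ (@A_cvg 1 g ltr01)); rewrite ltrDl.
have xi : (1 + 3 / x i s) ^+ m <= 11 / 10 * 4 ^+ m.
  near: i; apply: (@cvgr_le _ _ _ _ _ ((1 + 3 / 1) ^+ m)).
    have c1 : (1 + 3 / x i s) @[i --> Fl] --> (1 + 3 / 1 : R).
      apply: cvgD; first exact: cvg_cst.
      apply: cvgM; first exact: cvg_cst.
      by apply: cvgV; [exact: oner_neq0|exact: x_cvg].
    exact: (cvg_comp _ _ c1 (@exprn_continuous _ m _)).
  have -> : 1 + 3 / 1 = 4 :> R by rewrite divr1; lra.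
  have p4 : 0 < (4 : R) ^+ m by rewrite exprn_gt0.
    lra.
rewrite ltnNge; apply/negP => cm; move: Ai; apply/negP; rewrite -leNgt.
have Nr : 0 < (N i)%:R :> R by rewrite ltr0n.
have xs := x01 Ni0 s0; have xs1 := x01 Ni0 ltr01.
rewrite /A (bigID (fun y => `|y - g| <= d)) /=.
have near_le : \prod_(y <- ys i | `|y - g| <= d) (1 + gn i s g y) <= 11 / 10 * 4 ^+ m.
  apply: le_trans xi; apply: (@le_trans _ _ ((1 + 3 / x i s) ^+ count (fun y => `|y - g| <= d) (ys i))).
    have -> : (1 + 3 / x i s) ^+ count (fun y => `|y - g| <= d) (ys i) =
        \prod_(y <- ys i | `|y - g| <= d) (1 + 3 / x i s).
      by rewrite big_const_seq iter_mulr_1.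
    apply: ler_prod => y _; rewrite addr_ge0 ?gn_ge0 //= lerD2l.
    by apply: gain_le => //; exact: cos_le1.
  apply: ler_weXn2l => //; rewrite lerDl divr_ge0 //; by case/andP: xs => /ltW.
have far_le : \prod_(y <- ys i | ~~ (`|y - g| <= d)) (1 + gn i s g y) <= 11 / 10.
  apply: le_trans (prod1D_le_expR _ _) _; first by move=> y _; exact: gn_ge0.
  have S : \sum_(y <- ys i | ~~ (`|y - g| <= d)) gn i s g y <= 1 / 11.
    apply: (@le_trans _ _ (\sum_(y <- ys i) K * s ^+ 2 * gn i 1 g y)).
      rewrite [leRHS](bigID (fun y => `|y - g| <= d)) /=.
      rewrite -[leLHS]add0r; apply: lerD.
        apply: sumr_ge0 => y _; rewrite mulr_ge0 ?gn_ge0 // mulr_ge0 ?sqr_ge0 //; exact: ltW.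
      rewrite big_seq_cond [leRHS]big_seq_cond; apply: ler_sum => y /andP[yi].
      rewrite -ltNge => dy; apply: gain_far_scaled; rewrite ?s0 ?cos_le1 //.
      by apply: cos_far => //; exact: ys_le.
    rewrite -big_distrr /=; have h := @sum_le_prod1D (ys i) (gn i 1 g) (fun y _ => gn_ge0 _ _ Ni0 ltr01).
    have S1 : \sum_(y <- ys i) gn i 1 g y <= B.
      by apply: le_trans A1; rewrite -/(A i 1 g) in h; lra.
    apply: (@le_trans _ _ (K * s ^+ 2 * B)).
      by apply: ler_wpM2l => //; rewrite mulr_ge0 ?sqr_ge0 // ltW.
    have KBs : 0 <= K * B * s by rewrite mulr_ge0 // ltW.
    have : K * B * s * s <= 1 / 11 * (1 / 2) by apply: ler_pM => //; exact: ltW.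
    by lra.
  have h1 := expR_ge1Dx (- (1 / 11) : R).
  have h2 := expR_gt0 (1 / 11 : R).
  have h3 : expR (1 / 11) * expR (- (1 / 11)) = 1 :> R by rewrite -expRD subrr expR0.
  have h4 : expR (1 / 11) <= 11 / 10 :> R by nra.
  by apply: le_trans h4; rewrite ler_expR.
have n0 : 0 <= \prod_(y <- ys i | `|y - g| <= d) (1 + gn i s g y).
  by apply: prodr_ge0 => y _; rewrite addr_ge0 // gn_ge0.
have f0 : 0 <= \prod_(y <- ys i | ~~ (`|y - g| <= d)) (1 + gn i s g y).
  by apply: prodr_ge0 => y _; rewrite addr_ge0 // gn_ge0.
apply: le_trans (ler_pM n0 f0 near_le far_le) _.
have : 0 < (4 : R) ^+ m by rewrite exprn_gt0.
lra.
Unshelve. all: end_near. Qed.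

(** At distance 1 from the axis the gain of a zero [y] is at least [3 / (1 + 4 y^2)], comparable to
    [1 / (1 + y^2)], and the sum of the gains is at most the product, which converges. *)
Lemma density : exists2 B : R, 0 < B &
  \forall i \near Fl, \sum_(y <- ys i) (1 + y ^+ 2)^-1 <= B.
Proof.
exists (2 * (AA 1 0 + 1)).
  by rewrite mulr_gt0 // addr_gt0 // mulr_gt0 ?expR_gt0 // divr_gt0 // G_gt0.
near=> i.
have Ni : (0 < N i)%N by near: i; exact: (N_ge 1).
have Nr : 0 < (N i)%:R :> R by rewrite ltr0n.
have A1 : A i 1 0 <= AA 1 0 + 1.
  by near: i; apply: (@cvgr_le _ _ _ _ _ _ (@A_cvg 1 0 ltr01)); rewrite ltrDl.
have h := @sum_le_prod1D (ys i) (gn i 1 0) (fun y _ => gn_ge0 _ _ Ni ltr01).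
rewrite -/(A i 1 0) in h.
apply: (@le_trans _ _ (2 * \sum_(y <- ys i) gn i 1 0 y)); last by rewrite ler_pM2l //; lra.
rewrite big_distrr /=; apply: ler_sum => y _.
have y0 : 0 < 1 + y ^+ 2 by rewrite ltr_pwDl // sqr_ge0.
have N1 : 0 < 1 / (N i)%:R :> R by rewrite divr_gt0.
have g1 := @gain_ge _ (x i 1) (cos ((y - 0) / (N i)%:R)) (y / (N i)%:R) (1 / (N i)%:R / 2)
   (x01 Ni ltr01) (cos_le1 _).
apply: (@le_trans _ _ (2 * (3 / (1 + 4 * y ^+ 2)))).
  have y4 : 0 < 1 + 4 * y ^+ 2 by have := sqr_ge0 y; lra.
  rewrite mulrA ler_pdivlMr // mulrC ler_pdivrMr //; have := sqr_ge0 y; lra.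
rewrite ler_pM2l //; apply: le_trans (g1 _ _); last 2 first.
- by have := one_sub_cos_le ((y - 0) / (N i)%:R); rewrite subr0; lra.
- rewrite divr_gt0 //=; apply: one_sub_expRN_ge; rewrite ltW //=.
  by rewrite ler_pdivrMr // mul1r ler1n.
rewrite le_eqVlt; apply/orP; left; apply/eqP; field.
have := sqr_ge0 y; move=> yy; rewrite !gt_eqF //; try lra.
Unshelve. all: end_near. Qed.

Lemma near_seq (s : seq R) (P : R -> R -> I -> Prop) :
  {in s, forall g, exists2 e : R, 0 < e & forall d, 0 < d -> d <= e ->
     \forall i \near Fl, P g d i} ->
  exists2 e : R, 0 < e & forall d, 0 < d -> d <= e ->
     \forall i \near Fl, {in s, forall g, P g d i}.
Proof.
elim: s => [|a s IH] h; first by exists 1 => // d _ _; apply: filterE.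
have [|e e0 he] := IH; first by move=> g gs; apply: h; rewrite inE gs orbT.
have [c c0 hc] := h a (mem_head _ _).
exists (Num.min e c); first by rewrite lt_min e0 c0.
move=> d d0; rewrite le_min => /andP[/(he _ d0) h1 /(hc _ d0) h2].
apply: filterS2 h1 h2 => i h1 h2 g; rewrite inE => /orP[/eqP -> //|]; exact: h1.
Qed.

Lemma exchange_near (s : seq R) (i : I) (d : R) (F : R -> R) : uniq s ->
  {in s &, forall a b, a != b -> 2 * d < `|a - b|} ->
  \sum_(g <- s) \sum_(y <- ys i | `|y - g| <= d) F y =
  \sum_(y <- ys i | has (fun g => `|y - g| <= d) s) F y.
Proof.
move=> us sep; under eq_bigr do rewrite big_mkcond.
rewrite exchange_big /= [RHS]big_mkcond; apply: eq_bigr => y _.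
rewrite -big_mkcond sum_const_seq_cond has_count.
by case: (count _ s) (count_near_le1 y us sep) => [|[|//]] _; rewrite ?mul0r ?mul1r.
Qed.

(** Each [g] is replaced by at least [mult g] zeros [y] of one approximant in disjoint
    neighbourhoods, to which [density] applies. The 3 comes from [1 + y^2 <= 3 (1 + g^2)] for
    [|y - g| <= 1]. *)
Lemma mass_bound : exists2 B : R, 0 < B & forall s : seq R, uniq s ->
  \sum_(g <- s) (mult g)%:R * (1 + g ^+ 2)^-1 <= B.
Proof.
have [B B0 hB] := density; exists (3 * B); first by rewrite mulr_gt0.
move=> s us; have [d d0 sep] := seq_separated s.
pose e := Num.min d 1; have e0 : 0 < e by rewrite lt_min d0 ltr01.
have ed : e <= d by rewrite ge_min lexx.
have e1 : e <= 1 by rewrite ge_min lexx orbT.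
have sepe : {in s &, forall a b, a != b -> 2 * e < `|a - b|}.
  by move=> a b ha hb ab; apply: le_lt_trans (sep a b ha hb ab); rewrite ler_pM2l.
have [c c0 hc] : exists2 c : R, 0 < c & forall d, 0 < d -> d <= c ->
     \forall i \near Fl, {in s, forall g, (mult g <= cnt i g d)%N}.
  by apply: near_seq => g _; exists 1 => // d' d'0 _; exact: count_lower.
have [||i [Bi ci]] := @filter_ex _ Fl _ _ (filterI hB (hc (Num.min e c) _ _)).
- by rewrite lt_min e0 c0.
- by rewrite ge_min lexx orbT.
set e' := Num.min e c in ci; have e'e : e' <= e by rewrite ge_min lexx.
have sepe' : {in s &, forall a b, a != b -> 2 * e' < `|a - b|}.
  by move=> a b ha hb ab; apply: le_lt_trans (sepe a b ha hb ab); rewrite ler_pM2l.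
apply: (@le_trans _ _ (\sum_(g <- s) \sum_(y <- ys i | `|y - g| <= e') 3 * (1 + y ^+ 2)^-1)).
  rewrite big_seq [leRHS]big_seq; apply: ler_sum => g gs.
  have p0 (z : R) : 0 < 1 + z ^+ 2 by rewrite ltr_pwDl // sqr_ge0.
  apply: (@le_trans _ _ ((cnt i g e')%:R * (1 + g ^+ 2)^-1)).
    apply: ler_wpM2r; first by rewrite invr_ge0 ltW.
    by rewrite ler_nat ci.
  rewrite -sum_const_seq_cond; apply: ler_sum => y yg.
  rewrite ler_pdivlMr // mulrC ler_pdivrMr //.
  have : `|y - g| <= 1 by apply: le_trans yg (le_trans e'e e1).
  rewrite ler_norml => /andP[h1 h2]; have := sqr_ge0 (2 * g - y).
  have : (y - g) ^+ 2 <= 1 by nra.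
  rewrite !expr2; nra.
rewrite exchange_near //; apply: le_trans (_ : \sum_(y <- ys i) 3 * (1 + y ^+ 2)^-1 <= _).
  rewrite big_mkcond; apply: ler_sum => y _; case: ifP => // _.
  by rewrite mulr_ge0 // invr_ge0 addr_ge0 // sqr_ge0.
by rewrite -big_distrr /= ler_pM2l.
Qed.

(** Each such [g] contributes at least [1 / (1 + M^2)] to the sum in [mass_bound]. *)
Lemma zeros_finite (M : R) : finite_set [set g | mult g != 0%N /\ `|g| <= M].
Proof.
apply: contrapT => inf; have [B B0 hB] := mass_bound.
have [X XA Xn] := @infinite_set_fset _ _ (Num.truncn (B * (1 + M ^+ 2))).+1 inf.
pose s : seq R := finmap.enum_fset X.
have us : uniq s by exact: finmap.fset_uniq.
have p0 (z : R) : 0 < 1 + z ^+ 2 by rewrite ltr_pwDl // sqr_ge0.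
have : (size s)%:R * (1 + M ^+ 2)^-1 <= B.
  apply: le_trans (hB s us); rewrite -[size s]count_predT -sum_const_seq_cond.
  rewrite big_seq [leRHS]big_seq; apply: ler_sum => g gs.
  have [g0 gM] := XA g gs.
  rewrite -[leLHS]mul1r; apply: ler_pM => //; first by rewrite invr_ge0 ltW.
    by rewrite ler1n lt0n.
  rewrite lef_pV2 ?posrE // lerD2l -[leLHS]real_normK ?num_real //.
  by rewrite ler_sqr ?nnegrE // (le_trans _ gM).
rewrite ler_pdivrMr //; apply/negP; rewrite -ltNge.
apply: lt_le_trans (truncnS_gt _) _; rewrite ler_nat; exact: Xn.
Qed.

Lemma nbhs_normr_le (z d : R) : 0 < d -> nbhs z [set z' | `|z' - z| <= d].
Proof.
move=> d0; apply/nbhs_ballP; exists d => // z'.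
by rewrite /ball /= distrC => /ltW.
Qed.

(** The zeros [y] are of three kinds: near some [g] in [s], where the counts agree exactly and
    [f_ i] is close to [f g]; in [[- M, M]] but near no [g], eventually absent; beyond [M] and near
    no [g], where one factor [1 / (1 + y^2)] is small and the other is summed by [density]. *)
Lemma sum_limit (f : R -> R) (f_ : I -> R -> R) (Bf : R) :
  (\forall i \near Fl, {in ys i, forall y, `|f_ i y| <= Bf * (1 + y ^+ 2)^-1 ^+ 2}) ->
  (forall g e : R, 0 < e -> exists2 d : R, 0 < d & \forall i \near Fl,
     forall y, `|y - g| <= d -> `|f_ i y - f g| <= e) ->
  forall e : R, 0 < e -> exists M0 : R, forall M, M0 <= M -> forall s : seq R, uniq s ->
    (forall g, reflect (mult g != 0%N /\ `|g| <= M) (g \in s)) ->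
    \forall i \near Fl,
      `|\sum_(y <- ys i) f_ i y - \sum_(g <- s) (mult g)%:R * f g| <= e.
Proof.
move=> hf1 hf2 e e0; have [B B0 hB] := density.
have p0 (z : R) : 0 < 1 + z ^+ 2 by rewrite ltr_pwDl // sqr_ge0.
pose Bg := Num.max Bf 0; have Bg0 : 0 <= Bg by rewrite le_max lexx orbT.
exists (1 + 2 * Bg * B / e) => M hM s us hs.
have M0 : 0 <= M.
  by apply: le_trans hM; rewrite addr_ge0 // divr_ge0 ?(ltW e0) // !mulr_ge0 // ltW.
have tail : Bg * B * (1 + M ^+ 2)^-1 <= e / 2.
  rewrite ler_pdivrMr //.
  have : 2 * Bg * B / e <= M - 1 by lra.
  rewrite ler_pdivrMr // => h.
  have : (M - 1) * e <= (1 + M ^+ 2) * e.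
    by apply: ler_wpM2r; [exact: ltW|have := sqr_ge0 (M - 1); nra].
  by lra.
pose S := \sum_(g <- s) (mult g)%:R : R.
have S0 : 0 <= S by rewrite sumr_ge0.
pose E1 := e / (2 * (1 + S)).
have E10 : 0 < E1 by rewrite divr_gt0 // mulr_gt0 // ltr_pwDl.
have [d1 d10 sep] := seq_separated s.
have [d2 d20 hd2] : exists2 d : R, 0 < d & forall d', 0 < d' -> d' <= d ->
   \forall i \near Fl, {in s, forall g, cnt i g d' = mult g /\
      forall y, `|y - g| <= d' -> `|f_ i y - f g| <= E1}.
  apply: near_seq => g _; have [c c0 hc] := count_upper g.
  have [c' c'0 hc'] := hf2 g E1 E10.
  exists (Num.min c c'); first by rewrite lt_min c0 c'0.
  move=> d d0; rewrite le_min => /andP[dc dc'].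
  have h1 := hc d dc; have h2 := @count_lower g d d0.
  apply: filterS3 h1 h2 hc' => i h1 h2 h3; split.
    by apply/eqP; rewrite eqn_leq h1 h2.
  by move=> y yd; apply: h3; apply: le_trans dc'.
pose d := Num.min d1 d2.
have d0 : 0 < d by rewrite lt_min d10 d20.
have dd1 : d <= d1 by rewrite ge_min lexx.
have dd2 : d <= d2 by rewrite ge_min lexx orbT.
have {}hd2 := hd2 d d0 dd2.
have sepd : {in s &, forall a b, a != b -> 2 * d < `|a - b|}.
  by move=> a b ha hb ab; apply: le_lt_trans (sep a b ha hb ab); rewrite ler_pM2l.
(* A point of [[- M, M]] outside [s] has multiplicity 0, so by [count_upper] a whole neighbourhood
   of it is eventually free of zeros; compactness makes this uniform. *)
have cover : \forall i \near Fl, forall y, `|y| <= M -> y \in ys i ->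
    has (fun g => `|y - g| <= d) s.
  have := (compact_near_coveringP _).1 (@segment_compact R (- M) M).
  move=> /(_ I Fl (fun i y => y \in ys i -> has (fun g => `|y - g| <= d) s) _).
  move=> cov; apply: (filterS _ (cov _)).
    move=> i hi y yM; apply: (hi y); first by rewrite /= in_itv /= -ler_norml.
  move=> z; rewrite /= in_itv /= => zM.
  have [zs|zs] := boolP (z \in s).
    exists ([set z' | `|z' - z| <= d], setT); first split => /=.
    - exact: nbhs_normr_le.
    - exact: filterT.
    by move=> [z' i] [/= zz _] _; apply/hasP; exists z.
  have mz : mult z = 0%N.
    apply/eqP; apply: contraNT zs => mz; apply/hs; split => //.
    by rewrite ler_norml.
  have [c c0 hc] := count_upper z.
  exists ([set z' | `|z' - z| <= c], [set i | (cnt i z c <= 0)%N]); first split => /=.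
  - exact: nbhs_normr_le.
  - by rewrite -mz; exact: hc.
  move=> [z' i] [/= zz]; rewrite leqNgt -has_count => /hasPn h z'i; exfalso.
  by have /negP := h z' z'i.
near=> i.
have h1 : {in ys i, forall y, `|f_ i y| <= Bf * (1 + y ^+ 2)^-1 ^+ 2} by near: i.
have h2 : {in s, forall g, cnt i g d = mult g /\
      forall y, `|y - g| <= d -> `|f_ i y - f g| <= E1} by near: i.
have h3 : forall y, `|y| <= M -> y \in ys i -> has (fun g => `|y - g| <= d) s.
  by near: i.
have h4 : \sum_(y <- ys i) (1 + y ^+ 2)^-1 <= B by near: i.
rewrite (bigID (fun y => has (fun g => `|y - g| <= d) s)) /= -exchange_near //.
rewrite addrAC -sumrB; apply: le_trans (ler_normD _ _) _.
have -> : e = e / 2 + e / 2 by lra.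
apply: lerD.
  apply: le_trans (ler_norm_sum _ _ _) _.
  apply: (@le_trans _ _ (\sum_(g <- s) (mult g)%:R * E1)); last first.
    rewrite -big_distrl /= -/S /E1 mulrA ler_pdivrMr ?mulr_gt0 // ?ltr_pwDl //.
    by nra.
  rewrite big_seq [leRHS]big_seq; apply: ler_sum => g gs.
  have [hg hf] := h2 g gs.
  rewrite -{1}hg -sum_const_seq_cond -sumrB -hg -sum_const_seq_cond.
  apply: le_trans (ler_norm_sum _ _ _) _; apply: ler_sum => y; exact: hf.
apply: le_trans (ler_norm_sum _ _ _) _; apply: le_trans tail.
apply: (@le_trans _ _ (\sum_(y <- ys i) Bg * (1 + M ^+ 2)^-1 * (1 + y ^+ 2)^-1)).
  rewrite big_seq_cond [leRHS]big_seq [X in X <= _]big_mkcond [leRHS]big_mkcond /=.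
  apply: ler_sum => y _; case: (boolP (y \in ys i)) => //= yi.
  have A0 : 0 <= Bg * (1 + M ^+ 2)^-1 * (1 + y ^+ 2)^-1.
    by rewrite !mulr_ge0 // invr_ge0 ltW.
  case: ifP => // /negP hn.
  have yM : M < `|y| by rewrite ltNge; apply/negP => yM; apply: hn; exact: h3.
  apply: le_trans (h1 y yi) _; rewrite expr2 mulrA.
  apply: ler_wpM2r; first by rewrite invr_ge0 ltW.
  apply: (@le_trans _ _ (Bg * (1 + y ^+ 2)^-1)).
    by apply: ler_wpM2r; [rewrite invr_ge0 ltW|rewrite le_max lexx].
  apply: ler_wpM2l => //; rewrite lef_pV2 ?posrE // lerD2l.
  by rewrite -[leRHS]real_normK ?num_real // ler_sqr ?nnegrE // ltW.
rewrite -big_distrr /= [leRHS]mulrAC.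
by apply: ler_wpM2l => //; rewrite mulr_ge0 // invr_ge0 ltW.
Unshelve. all: end_near. Qed.

End Hurwitz.

(** * Exponential polynomials *)

Section ComplexBasics.
Variable R : realType.
Implicit Types (x y s g t : R) (z w : R[i]).

Lemma cReD z w : complex.Re (z + w) = complex.Re z + complex.Re w.
Proof. by case: z; case: w. Qed.

Lemma cImD z w : complex.Im (z + w) = complex.Im z + complex.Im w.
Proof. by case: z; case: w. Qed.

Lemma cReM z w :
  complex.Re (z * w) = complex.Re z * complex.Re w - complex.Im z * complex.Im w.
Proof. by case: z; case: w. Qed.

Lemma cImM z w :
  complex.Im (z * w) = complex.Re z * complex.Im w + complex.Im z * complex.Re w.
Proof. by case: z; case: w. Qed.

Lemma cRe_sum (T : Type) (r : seq T) (p : pred T) (F : T -> R[i]) :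
  complex.Re (\sum_(i <- r | p i) F i) = \sum_(i <- r | p i) complex.Re (F i).
Proof. by apply: big_morph => // z w; exact: cReD. Qed.

Lemma cIm_sum (T : Type) (r : seq T) (p : pred T) (F : T -> R[i]) :
  complex.Im (\sum_(i <- r | p i) F i) = \sum_(i <- r | p i) complex.Im (F i).
Proof. by apply: big_morph => // z w; exact: cImD. Qed.

Lemma real_complexD x y : (x + y)%:C = x%:C + y%:C :> R[i].
Proof. by apply/eqP; rewrite eq_complex /= addr0 !eqxx. Qed.

Lemma real_complexM x y : (x * y)%:C = x%:C * y%:C :> R[i].
Proof. by apply/eqP; rewrite eq_complex /= !mulr0 mul0r subr0 addr0 !eqxx. Qed.

Lemma real_complexX x k : (x ^+ k)%:C = x%:C ^+ k :> R[i].
Proof. by elim: k => // k IH; rewrite !exprS real_complexM IH. Qed.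

(** A real-valued squared modulus, since [|z|] has type [R[i]]. *)
Definition nsq z : R := complex.Re z ^+ 2 + complex.Im z ^+ 2.

Lemma nsqM z w : nsq (z * w) = nsq z * nsq w.
Proof. by rewrite /nsq cReM cImM; ring. Qed.

Lemma nsq_ge0 z : 0 <= nsq z. Proof. by rewrite addr_ge0 ?sqr_ge0. Qed.

Lemma nsq_eq0 z : (nsq z == 0) = (z == 0).
Proof. by rewrite paddr_eq0 ?sqr_ge0 // !sqrf_eq0 eq_complex. Qed.

Lemma nsq_gt0 z : z != 0 -> 0 < nsq z.
Proof. by move=> z0; rewrite lt_neqAle nsq_ge0 eq_sym nsq_eq0 z0. Qed.

Lemma nsq_prod (T : Type) (r : seq T) (F : T -> R[i]) :
  nsq (\prod_(i <- r) F i) = \prod_(i <- r) nsq (F i).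
Proof.
apply: (big_morph nsq nsqM).
by rewrite /nsq /= expr1n expr0n addr0.
Qed.

Lemma normc_nsq z : `|z| = (Num.sqrt (nsq z))%:C. Proof. exact: normc_def. Qed.

Lemma normc_eq1 z : `|z| = 1 -> nsq z = 1.
Proof.
rewrite normc_nsq => /(congr1 (@complex.Re R)) /= h.
by rewrite -(sqr_sqrtr (nsq_ge0 z)) h expr1n.
Qed.

Lemma normc_lt1 z : nsq z < 1 -> `|z| < 1.
Proof.
move=> h; rewrite normc_nsq ltcR -sqrtr1 ltr_sqrt //.
Qed.

Definition cis x : R[i] := cos x +i* sin x.

Lemma cis0 : cis 0 = 1. Proof. by rewrite /cis cos0 sin0. Qed.

Lemma cisD x y : cis (x + y) = cis x * cis y.
Proof.
apply/eqP; rewrite eq_complex /= cosD sinD eqxx /=; apply/eqP; ring.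
Qed.

Lemma cis_natr x k : cis (k%:R * x) = cis x ^+ k.
Proof.
elim: k => [|k IH]; first by rewrite mul0r cis0.
by rewrite -natr1 mulrDl mul1r cisD IH exprSr.
Qed.

Lemma cis_sum (T : Type) (r : seq T) (F : T -> R) :
  cis (\sum_(i <- r) F i) = \prod_(i <- r) cis (F i).
Proof. by apply: big_morph; [exact: cisD|exact: cis0]. Qed.

Lemma nsq_cis x : nsq (cis x) = 1. Proof. exact: cos2Dsin2. Qed.

Lemma cis_neq0 x : cis x != 0.
Proof. by rewrite -nsq_eq0 nsq_cis oner_neq0. Qed.

Lemma normr_cis x : `|cis x| = 1.
Proof. by rewrite normc_nsq nsq_cis sqrtr1. Qed.

Lemma nsq_real x : nsq x%:C = x ^+ 2.
Proof. by rewrite /nsq /= expr0n addr0. Qed.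

Lemma cis_surj z : nsq z = 1 -> exists2 x, `|x| <= pi & z = cis x.
Proof.
case: z => a b; rewrite /nsq /= => ab.
have a1 : -1 <= a <= 1.
  rewrite -ler_norml -(ler_sqr (normr_ge0 a)) ?nnegrE // expr1n.
  by rewrite real_normK ?num_real // -ab lerDl sqr_ge0.
have sa : sin (acos a) = `|b|.
  by rewrite sin_acos // -ab addrAC subrr add0r sqrtr_sqr.
have ca : cos (acos a) = a by rewrite acosK // in_itv.
have a0 : 0 <= acos a by rewrite acos_ge0.
have api : acos a <= pi by rewrite acos_lepi.
case: (leP 0 b) => b0; [exists (acos a)|exists (- acos a)].
- by rewrite ger0_norm.
- by rewrite /cis ca sa ger0_norm.
- by rewrite normrN ger0_norm.
- by rewrite /cis cosN sinN ca sa ltr0_norm // opprK.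
Qed.

Lemma nsq_one_sub_cis x s g : nsq (1 - cis s * (x%:C * cis (- g))) = dist2 x (cos (s - g)).
Proof.
rewrite mulrCA -cisD /nsq /dist2.
have -> : complex.Re (1 - x%:C * cis (s - g)) = 1 - x * cos (s - g).
  by rewrite /= mul0r subr0.
have -> : complex.Im (1 - x%:C * cis (s - g)) = - (x * sin (s - g)).
  by rewrite /= mul0r addr0 sub0r.
have := cos2Dsin2 (s - g); set c := cos _; set d := sin _ => h.
have -> : (1 - x * c) ^+ 2 + (- (x * d)) ^+ 2 =
  1 - 2 * x * c + x ^+ 2 * (c ^+ 2 + d ^+ 2) by ring.
by rewrite h; ring.
Qed.

End ComplexBasics.

(** * Exponential polynomials with phases *)

Section Twisted.
Variables (R : realType) (n : nat).
Implicit Types (P Q : mpoly.mpoly n R[i]) (xi th : 'I_n -> R) (s g : R).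
Implicit Types (m : mpoly.multinom n) (a : 'I_n -> nat).

Definition wtR xi m : R := \sum_j (m j)%:R * xi j.

Definition term xi th s g m : R[i] :=
  (expR (- (wtR xi m * s)))%:C * cis (wtR th m - wtR xi m * g).

(* [P(e^{i th_1 - xi_1 z}, ..., e^{i th_n - xi_n z})] at [z = s + i g] *)
Definition twisted P xi th s g : R[i] :=
  \sum_(m <- mpoly.msupp P) mpoly.mcoeff m P * term xi th s g m.

Lemma twistedE P xi th s g : twisted P xi th s g =
  mpoly.meval (fun j => (expR (- (xi j * s)))%:C * cis (th j - xi j * g)) P.
Proof.
rewrite mpoly.mevalE; apply: eq_bigr => m _; congr (_ * _).
rewrite (eq_bigr (fun j => (expR (- ((m j)%:R * xi j * s)))%:C *
   cis ((m j)%:R * th j - (m j)%:R * xi j * g))); last first.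
  move=> j _; rewrite exprMn -cis_natr -real_complexX -expRM_natl.
  by congr ((expR _)%:C * cis _); ring.
rewrite big_split /= -cis_sum /term; congr (_ * cis _).
  rewrite (_ : - (wtR xi m * s) = \sum_j - ((m j)%:R * xi j * s)); last first.
    by rewrite sumrN /wtR big_distrl.
  elim/big_rec2: _ => [|j x y _ IH]; first by rewrite expR0.
  by rewrite expRD real_complexM IH.
by rewrite sumrB /wtR big_distrl.
Qed.

Lemma twisted_upoly P a (N : nat) th s g : (0 < N)%N ->
  twisted P (fun j => (a j)%:R / N%:R) th s g =
  (upoly (fun j => cis (th j)) a P).[(expR (- (s / N%:R)))%:C * cis (- (g / N%:R))].
Proof.
move=> N0; rewrite twistedE horner_upoly; apply: mpoly.meval_eq => j.
rewrite exprMn -cis_natr -real_complexX -expRM_natl mulrCA -cisD.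
by congr ((expR _)%:C * cis _); ring.
Qed.

(* These restate [D_stable] and [reciprocal_pair] over [R[i]], which is convertible to
   [CC R] but carries other canonical structures. *)
Definition stable P := forall z : 'I_n -> R[i], (forall j, `|z j| < 1) -> mpoly.meval z P != 0.

Definition reciprocal P Q (ell : 'I_n -> nat) (eta : R[i]) :=
  forall z : 'I_n -> R[i], (forall j, z j != 0) -> mpoly.meval z Q =
     eta * (\prod_(j < n) z j ^+ ell j) * mpoly.meval (fun j => (z j)^-1) P.

Lemma approx_zeros P Q ell eta th a (N : nat) :
  stable P -> stable Q -> reciprocal P Q ell eta -> (forall j, 0 < a j)%N -> (0 < N)%N ->
  exists ys : seq R, [/\ {in ys, forall y, `|y| <= pi * N%:R},
    size ys = (\sum_j ell j * a j)%N &
    upoly (fun j => cis (th j)) a P =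
      const_coef P *: \prod_(y <- ys) (1 - cis (y / N%:R) *: 'X)].
Proof.
move=> Ps Qs PQ a0 N0; have Nr : 0 < N%:R :> R by rewrite ltr0n.
have [zs [z1 szs pE]] := @stable_factor _ n P Q ell eta (fun j => cis (th j)) a Ps Qs PQ
  (fun j => normr_cis (th j)) a0.
have [f fP] : exists f : R[i] -> R, forall z, z \in zs -> `|f z| <= pi /\ z = cis (f z).
  have h z : exists x, z \in zs -> `|x| <= pi /\ z = cis x.
    case: (boolP (z \in zs)) => [/z1 /normc_eq1 /cis_surj [x x1 x2]|_]; last by exists 0.
    by exists x.
  by have [f hf] := boolp.choice h; exists f.
exists (map (fun z => f z * N%:R) zs); split.
- move=> _ /mapP [z /fP [fz _] ->].
  by rewrite normrM normr_nat ler_pM2r.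
- by rewrite size_map.
rewrite pE big_map; congr (_ *: _); apply: eq_big_seq => z /fP [_ ez].
by rewrite mulfK ?gt_eqF // -ez.
Qed.

Lemma nsq_twisted P a (N : nat) th ys s g : (0 < N)%N ->
  upoly (fun j => cis (th j)) a P =
      const_coef P *: \prod_(y <- ys) (1 - cis (y / N%:R) *: 'X) ->
  nsq (twisted P (fun j => (a j)%:R / N%:R) th s g) =
  nsq (const_coef P) *
    \prod_(y <- ys) dist2 (expR (- (s / N%:R))) (cos ((y - g) / N%:R)).
Proof.
move=> N0 pE; rewrite twisted_upoly // pE hornerZ horner_prod nsqM nsq_prod.
congr (_ * _); apply: eq_bigr => y _.
by rewrite hornerD hornerN hornerC hornerZ hornerX nsq_one_sub_cis mulrBl.
Qed.

Lemma twisted_neq0 P xi th s g : stable P -> (forall j, 0 < xi j) -> 0 < s ->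
  twisted P xi th s g != 0.
Proof.
move=> Ps xi0 s0; rewrite twistedE; apply: Ps => j; apply: normc_lt1.
rewrite nsqM nsq_cis mulr1 nsq_real expr_lt1 ?expR_ge0 // expR_lt1.
by rewrite oppr_lt0 mulr_gt0.
Qed.

Lemma cvg_sqr (T : Type) (Fl : set_system T) {FF : Filter Fl} (f : T -> R) (l : R) :
  f x @[x --> Fl] --> l -> f x ^+ 2 @[x --> Fl] --> l ^+ 2.
Proof. by move=> h; under eq_fun do rewrite expr2; rewrite expr2; apply: cvgM. Qed.

Lemma cvg_wtR (T : Type) (Fl : set_system T) {FF : Filter Fl} (xi_ : T -> 'I_n -> R) xi m :
  (forall j, xi_ i j @[i --> Fl] --> xi j) -> wtR (xi_ i) m @[i --> Fl] --> wtR xi m.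
Proof.
move=> h; rewrite /wtR; apply: (@cvg_big _ _ +%R 0); first exact: add_continuous.
by move=> j _; apply: cvgM; [exact: cvg_cst|exact: h].
Qed.

Lemma cvg_nsq_twisted (T : Type) (Fl : set_system T) {FF : Filter Fl} P
    (xi_ th_ : T -> 'I_n -> R) xi th s g :
  (forall j, xi_ i j @[i --> Fl] --> xi j) ->
  (forall j, th_ i j @[i --> Fl] --> th j) ->
  nsq (twisted P (xi_ i) (th_ i) s g) @[i --> Fl] --> nsq (twisted P xi th s g).
Proof.
move=> hx ht; rewrite /nsq /twisted.
have he m : expR (- (wtR (xi_ i) m * s)) @[i --> Fl] --> expR (- (wtR xi m * s)).
  apply: continuous_cvg; first exact: continuous_expR.
  by apply: cvgN; apply: cvgM; [exact: cvg_wtR|exact: cvg_cst].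
have ha m : wtR (th_ i) m - wtR (xi_ i) m * g @[i --> Fl] --> wtR th m - wtR xi m * g.
  by apply: cvgB; [exact: cvg_wtR|apply: cvgM; [exact: cvg_wtR|exact: cvg_cst]].
have hc m : cos (wtR (th_ i) m - wtR (xi_ i) m * g) @[i --> Fl] -->
            cos (wtR th m - wtR xi m * g).
  by apply: continuous_cvg; [exact: continuous_cos|exact: ha].
have hs m : sin (wtR (th_ i) m - wtR (xi_ i) m * g) @[i --> Fl] -->
            sin (wtR th m - wtR xi m * g).
  by apply: continuous_cvg; [exact: continuous_sin|exact: ha].
apply: cvgD; apply: cvg_sqr.
  under eq_fun do rewrite cRe_sum; rewrite cRe_sum.
  apply: (@cvg_big _ _ +%R 0); first exact: add_continuous.
  move=> m _; under eq_fun do rewrite cReM; rewrite cReM.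
  apply: cvgB; apply: cvgM; try exact: cvg_cst; rewrite /term /=.
    by under eq_fun do rewrite mul0r subr0; rewrite mul0r subr0; apply: cvgM.
  by under eq_fun do rewrite mul0r addr0; rewrite mul0r addr0; apply: cvgM.
under eq_fun do rewrite cIm_sum; rewrite cIm_sum.
apply: (@cvg_big _ _ +%R 0); first exact: add_continuous.
move=> m _; under eq_fun do rewrite cImM; rewrite cImM.
apply: cvgD; apply: cvgM; try exact: cvg_cst; rewrite /term /=.
  by under eq_fun do rewrite mul0r addr0; rewrite mul0r addr0; apply: cvgM.
by under eq_fun do rewrite mul0r subr0; rewrite mul0r subr0; apply: cvgM.
Qed.

End Twisted.

(** * Leading terms of exponential sums at 0 *)

Section ExpTaylor.
Variable R : realType.
Implicit Types (x w s c : R).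

Definition exp_part K x : R := \sum_(k < K) x ^+ k / k`!%:R.

Lemma exp_partE K x : exp_part K x = series (exp_coeff x) K.
Proof. by rewrite /exp_part /series /= big_mkord. Qed.

Lemma exp_part_le K x : 0 <= x -> exp_part K x <= expR x.
Proof.
move=> x0; rewrite exp_partE; apply: nondecreasing_cvgn_le.
  by apply: nondecreasing_series => k _ _; exact: exp_coeff_ge0.
exact: is_cvg_series_exp_coeff.
Qed.

Lemma exp_taylor K x : `|expR x - exp_part K x| <= `|x| ^+ K * expR `|x|.
Proof.
have cv : exp_part k x @[k --> \oo] --> expR x.
  under eq_fun do rewrite exp_partE.
  exact: is_cvg_series_exp_coeff.
have cv2 : `|exp_part k x - exp_part K x| @[k --> \oo] --> `|expR x - exp_part K x|.
  by apply: cvg_norm; apply: cvgB => //; exact: cvg_cst.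
rewrite -(cvg_lim (@Rhausdorff R) cv2).
apply: limr_le; first by apply/cvg_ex; eexists; exact: cv2.
near=> k; have Kk : (K <= k)%N by near: k; exact: nbhs_infty_ge.
rewrite /exp_part -(subnKC Kk) big_split_ord /= addrAC subrr add0r.
apply: le_trans (ler_norm_sum _ _ _) _.
apply: (@le_trans _ _ (`|x| ^+ K * exp_part (k - K) `|x|)); last first.
  by apply: ler_wpM2l; [rewrite exprn_ge0|exact: exp_part_le].
rewrite /exp_part big_distrr /=; apply: ler_sum => j _.
rewrite normrM normrX normfV normr_nat exprD -mulrA.
apply: ler_wpM2l; first by rewrite exprn_ge0.
apply: ler_wpM2l; first by rewrite exprn_ge0.
by rewrite lef_pV2 ?posrE ?ltr0n ?fact_gt0 // ler_nat leq_fact ?leq_addl.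
Unshelve. all: end_near. Qed.

(** The sums in the hypothesis are the derivatives in [s] at 0, so the Taylor expansion starts at
    order [K]; [exp_taylor] bounds the remainder of each exponential. *)
Lemma exp_sum_cvg (T : Type) (r : seq T) (c w : T -> R) K :
  (forall k, (k < K)%N -> \sum_(i <- r) c i * (- w i) ^+ k = 0) ->
  (\sum_(i <- r) c i * expR (- (w i * s))) / s ^+ K @[s --> 0^'+] -->
  (\sum_(i <- r) c i * (- w i) ^+ K) / K`!%:R.
Proof.
move=> h; pose f i s := (expR (- (w i * s)) - exp_part K (- (w i * s))) / s ^+ K.
apply: (@cvg_trans _ (\sum_(i <- r) c i * f i s @[s --> 0^'+])).
  apply: near_eq_cvg; near=> s.
  have s0 : 0 < s by [].
  rewrite /f; under eq_bigr do rewrite mulrBl mulrBr.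
  rewrite sumrB big_distrl /=; under [in RHS]eq_bigr do rewrite -mulrA.
  rewrite (_ : \sum_(i <- r) c i * (exp_part K (- (w i * s)) / s ^+ K) = 0) ?subr0 //.
  under eq_bigr do rewrite /exp_part mulrA.
  rewrite -big_distrl /= (_ : \sum_(i <- r) _ = 0) ?mul0r //.
  under eq_bigr do rewrite big_distrr /=.
  rewrite exchange_big /= big1 // => k _.
  transitivity ((\sum_(i <- r) c i * (- w i) ^+ k) * (s ^+ k / k`!%:R)).
    rewrite big_distrl /=; apply: eq_bigr => i _.
    by rewrite -mulNr exprMn; ring.
  by rewrite h // mul0r.
have -> : (\sum_(i <- r) c i * (- w i) ^+ K) / K`!%:R =
          \sum_(i <- r) c i * ((- w i) ^+ K / K`!%:R).
  by rewrite big_distrl /=; apply: eq_bigr => i _; rewrite mulrA.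
apply: (@cvg_big _ _ +%R 0); first exact: add_continuous.
move=> i _; apply: cvgM; first exact: cvg_cst.
apply/cvgrPdist_le => e e0.
pose D := `|w i| ^+ K.+1 * expR `|w i| + 1.
have D0 : 0 < D by rewrite ltr_wpDl // mulr_ge0 ?expR_ge0 // exprn_ge0.
near=> s.
have s0 : 0 < s by [].
have s1 : s <= 1 by near: s; exact: nbhs_right_le.
have sK : 0 < s ^+ K by rewrite exprn_gt0.
rewrite /f distrC.
have -> : (expR (- (w i * s)) - exp_part K (- (w i * s))) / s ^+ K - (- w i) ^+ K / K`!%:R
    = (expR (- (w i * s)) - exp_part K.+1 (- (w i * s))) / s ^+ K.
  rewrite [exp_part K.+1 _]big_ord_recr /= -/(exp_part K _) opprD addrA [RHS]mulrBl.
  congr (_ - _); rewrite -mulNr exprMn mulrAC mulfK //; exact: lt0r_neq0.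
rewrite normrM normfV (gtr0_norm sK) ler_pdivrMr //.
apply: le_trans (exp_taylor _ _) _.
rewrite normrN normrM (gtr0_norm s0) exprMn exprS.
have -> : `|w i| * `|w i| ^+ K * (s ^+ K.+1) * expR (`|w i| * s) =
          (`|w i| ^+ K.+1 * expR (`|w i| * s)) * s * s ^+ K by rewrite !exprS; ring.
rewrite ler_pM2r //; apply: (@le_trans _ _ (D * s)).
  apply: ler_wpM2r; first exact: ltW.
  apply: (@le_trans _ _ (`|w i| ^+ K.+1 * expR `|w i|)); last by rewrite lerDl.
  apply: ler_wpM2l; first by rewrite exprn_ge0.
  by rewrite ler_expR ler_piMr.
rewrite mulrC -ler_pdivlMr //; near: s; apply: nbhs_right_le.
by rewrite divr_gt0.
Unshelve. all: end_near. Qed.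

Lemma cvg_right_double (f : R -> R) (l : R) :
  f s @[s --> 0^'+] --> l -> f (2 * s) @[s --> 0^'+] --> l.
Proof.
move=> fl; apply: (cvg_comp (fun s => 2 * s) f _ fl).
move=> A [d /= d0 hA]; exists (d / 2) => /=; first by rewrite divr_gt0.
move=> s /= sd s0; apply: hA => /=; last by rewrite mulr_gt0.
move: sd; rewrite /ball /= !sub0r !normrN normrM (ger0_norm (_ : 0 <= 2)) //.
by lra.
Qed.

End ExpTaylor.

(** * Multiplicity of a zero and growth near it *)

Section Multiplicity.
Variables (R : realType) (n : nat).
Implicit Types (P Q : mpoly.mpoly n R[i]) (xi th : 'I_n -> R) (s g : R).
Implicit Types (m : mpoly.multinom n).

(* The [k]-th derivative of [z |-> twisted P xi th (Re z) (Im z)] at [i g]. *)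
Definition tderiv P xi th g k : R[i] :=
  \sum_(m <- mpoly.msupp P) mpoly.mcoeff m P *
     (((- wtR xi m) ^+ k)%:C * cis (wtR th m - wtR xi m * g)).

(** Shaped like [zero_mult], so that equal derivatives give equal multiplicities. *)
Definition tmult P xi th g : nat := xget 0%N
  [set k | tderiv P xi th g k != 0 /\ forall j, (j < k)%N -> tderiv P xi th g j = 0].

Lemma wtR_gt0 xi m : (forall j, 0 < xi j) -> m != mpoly.mnm0 -> 0 < wtR xi m.
Proof.
move=> x0; rewrite -mpoly.mdeg_eq0 mpoly.mdegE sum_nat_eq0 negb_forall.
case/existsP=> i; rewrite implyTb => mi; rewrite /wtR (bigD1 i) //=.
apply: ltr_pwDl; first by rewrite mulr_gt0 // ltr0n lt0n.
by apply: sumr_ge0 => j _; rewrite mulr_ge0 // ltW.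
Qed.

Lemma wtR0 xi : wtR xi mpoly.mnm0 = 0.
Proof. by rewrite /wtR big1 // => j _; rewrite mpoly.mnm0E mul0r. Qed.

(** If all derivatives vanished, so would the combination with any real polynomial [q] taken at the
    points [- wtR xi m]. A [q] vanishing at all these points except 0 leaves [P(0) q(0)], because
    only the constant monomial has weight 0. *)
Lemma tderiv_neq0 P xi th g : (forall j, 0 < xi j) -> const_coef P != 0 ->
  exists k, tderiv P xi th g k != 0.
Proof.
move=> x0 P0; apply: contrapT => /forallNP h.
have {}h k : tderiv P xi th g k = 0 by apply/eqP; rewrite -[_ == _]negbK; apply/negP; exact: h.
have S0 : mpoly.mnm0 \in mpoly.msupp P by rewrite mpoly.mcoeff_msupp.
have hq (q : {poly R}) : \sum_(m <- mpoly.msupp P) mpoly.mcoeff m P *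
     ((q.[- wtR xi m])%:C * cis (wtR th m - wtR xi m * g)) = 0.
  transitivity (\sum_(k < size q) (q`_k)%:C * tderiv P xi th g k); last first.
    by rewrite big1 // => k _; rewrite h mulr0.
  rewrite /tderiv; under [RHS]eq_bigr do rewrite big_distrr /=.
  rewrite exchange_big /=; apply: eq_bigr => m _.
  rewrite horner_coef (big_morph _ (@real_complexD R) (erefl _)).
  rewrite big_distrl big_distrr /=; apply: eq_bigr => k _.
  by rewrite real_complexM; ring.
pose s := [seq m <- mpoly.msupp P | m != mpoly.mnm0].
have := hq (\prod_(m <- s) ('X + (wtR xi m)%:P)).
rewrite (bigD1_seq (@mpoly.mnm0 n)) ?mpoly.msupp_uniq //= [X in _ + X]big_seq_cond.
rewrite [X in _ + X]big1 ?addr0; last first.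
  move=> m /andP[mP m0]; rewrite horner_prod (big_rem m) /= ?mem_filter ?m0 //.
  rewrite hornerD hornerX hornerC addNr mul0r (_ : 0%:C = 0 :> R[i]) //.
  by rewrite mul0r mulr0.
rewrite !wtR0 mul0r subrr cis0 mulr1 oppr0 => /eqP; rewrite mulf_eq0.
rewrite (negbTE P0) /= eq_complex /= eqxx andbT horner_prod prodf_seq_eq0.
case/hasP => m; rewrite mem_filter => /andP[m0 _] /=.
by rewrite hornerD hornerX hornerC add0r gt_eqF ?wtR_gt0.
Qed.

Lemma tmultP P xi th g : (forall j, 0 < xi j) -> const_coef P != 0 ->
  tderiv P xi th g (tmult P xi th g) != 0 /\
  forall j, (j < tmult P xi th g)%N -> tderiv P xi th g j = 0.
Proof.
move=> x0 P0; have ex := tderiv_neq0 th g x0 P0.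
have [k kP kmin] := ex_minnP ex.
apply: (@xgetPex _ 0%N [set k | tderiv P xi th g k != 0 /\
   forall j, (j < k)%N -> tderiv P xi th g j = 0]).
exists k; split=> // j jk; apply/eqP; apply: contraTT jk => /kmin; rewrite -leqNgt //.
Qed.

Lemma tmult_neq0 P xi th g : (forall j, 0 < xi j) -> const_coef P != 0 ->
  (tmult P xi th g != 0%N) = (twisted P xi th 0 g == 0).
Proof.
move=> x0 P0; have [h1 h2] := tmultP th g x0 P0.
have -> : twisted P xi th 0 g = tderiv P xi th g 0.
  by apply: eq_bigr => m _; rewrite /term mulr0 oppr0 expR0 expr0.
case E : (tmult P xi th g) h1 h2 => [|k] h1 h2.
  by rewrite eqxx (negbTE h1).
by rewrite h2 // eqxx.
Qed.

Lemma nsq_twisted_cvg P xi th g K :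
  (forall j, (j < K)%N -> tderiv P xi th g j = 0) ->
  nsq (twisted P xi th s g) / (s ^+ K) ^+ 2 @[s --> 0^'+] -->
  nsq (tderiv P xi th g K) / K`!%:R ^+ 2.
Proof.
move=> h.
pose cR m := complex.Re (mpoly.mcoeff m P * cis (wtR th m - wtR xi m * g)).
pose cI m := complex.Im (mpoly.mcoeff m P * cis (wtR th m - wtR xi m * g)).
have tR s : complex.Re (twisted P xi th s g) =
    \sum_(m <- mpoly.msupp P) cR m * expR (- (wtR xi m * s)).
  rewrite cRe_sum; apply: eq_bigr => m _.
  by rewrite /term mulrCA cReM mul0r subr0 mulrC.
have tI s : complex.Im (twisted P xi th s g) =
    \sum_(m <- mpoly.msupp P) cI m * expR (- (wtR xi m * s)).
  rewrite cIm_sum; apply: eq_bigr => m _.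
  by rewrite /term mulrCA cImM mul0r addr0 mulrC.
have dR k : complex.Re (tderiv P xi th g k) =
    \sum_(m <- mpoly.msupp P) cR m * (- wtR xi m) ^+ k.
  rewrite cRe_sum; apply: eq_bigr => m _.
  by rewrite mulrCA cReM mul0r subr0 mulrC.
have dI k : complex.Im (tderiv P xi th g k) =
    \sum_(m <- mpoly.msupp P) cI m * (- wtR xi m) ^+ k.
  rewrite cIm_sum; apply: eq_bigr => m _.
  by rewrite mulrCA cImM mul0r addr0 mulrC.
rewrite /nsq; under eq_fun do rewrite mulrDl -!expr_div_n tR tI.
rewrite mulrDl -!expr_div_n dR dI; apply: cvgD; apply: cvg_sqr.
  by apply: exp_sum_cvg => k kK; rewrite -dR h.
by apply: exp_sum_cvg => k kK; rewrite -dI h.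
Qed.

(** Near 0, [|F(s + ig)|^2] behaves like [L s^(2K)] with [L != 0], and doubling [s] multiplies this
    by [4^K]. *)
Lemma twisted_ratio P xi th g : (forall j, 0 < xi j) -> const_coef P != 0 ->
  nsq (twisted P xi th (2 * s) g) / nsq (twisted P xi th s g) @[s --> 0^'+] -->
  (4 : R) ^+ tmult P xi th g.
Proof.
move=> x0 P0; have [h1 h2] := tmultP th g x0 P0; set K := tmult _ _ _ _ in h1 h2 *.
have c1 := nsq_twisted_cvg h2; set L := _ / _ in c1.
have L0 : L != 0.
  by rewrite mulf_neq0 ?invr_neq0 ?expf_neq0 // ?nsq_eq0 // pnatr_eq0 -lt0n fact_gt0.
have c2 := cvg_right_double c1.
apply: (@cvg_trans _ ((4 ^+ K * (nsq (twisted P xi th (2 * s) g) / ((2 * s) ^+ K) ^+ 2)) *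
   (nsq (twisted P xi th s g) / (s ^+ K) ^+ 2)^-1 @[s --> 0^'+])).
  apply: near_eq_cvg; near=> s.
  have s0 : 0 < s by [].
  have -> : ((2 * s) ^+ K) ^+ 2 = 4 ^+ K * (s ^+ K) ^+ 2.
    by rewrite exprMn exprMn -exprM mulnC exprM; congr (_ ^+ K * _); ring.
  have sK : s ^+ K != 0 by rewrite expf_neq0 // gt_eqF.
  have fK : (4 : R) ^+ K != 0 by rewrite expf_neq0.
  rewrite invf_div; set B := (nsq (twisted P xi th s g))^-1.
  move: (4 ^+ K) (s ^+ K) (nsq (twisted P xi th (2 * s) g)) B fK sK.
  by move=> a b u v a0 b0; field; rewrite a0 b0.
rewrite -[X in _ `=>` nbhs X](mulfK L0); apply: cvgM; last exact: cvgV.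
by apply: cvgM; [exact: cvg_cst|].
Unshelve. all: end_near. Qed.

End Multiplicity.

(** * Tempered sums of point masses *)

Section TemperedSums.
Variables (R : realType) (A : set R) (w : R -> R) (p : nat) (B : R).
Hypothesis A_lf : locally_finite A.
Hypothesis w_ge0 : forall x, 0 <= w x.
Hypothesis w_bd : forall s : seq R, uniq s -> {in s, forall x, A x} ->
  \sum_(x <- s) w x * (1 + x ^+ 2)^-1 ^+ p <= B.
Implicit Types (f g : R -> R) (K M x : R).

Definition decays f := exists K, forall x, `|f x| <= K * (1 + x ^+ 2)^-1 ^+ p.

Definition psum f (k : nat) : R :=
  \sum_(x \in A `&` `[- k%:R, k%:R]) w x * f x.

(** The limit of truncations gives the pairing a meaning on decaying functions, where the finitely
    supported sum of [point_masses] need not have one. *)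
Definition mass_pairing f : R := limn (psum f).

Let cut (k : nat) := fset_set (A `&` `[- k%:R, k%:R]).

Lemma mem_cut k x : (x \in cut k) = (x \in A) && (`|x| <= k%:R).
Proof.
rewrite in_fset_set; last exact: A_lf.
apply/idP/idP => [/set_mem [Ax /=]|/andP[/set_mem Ax xk]].
  by rewrite in_itv /= -ler_norml => ->; rewrite andbT; exact: mem_set.
by apply: mem_set; split => //=; rewrite in_itv /= -ler_norml.
Qed.

Lemma psumE f k : psum f k = \sum_(x <- cut k) w x * f x.
Proof. by rewrite /psum fsbig_finite //; exact: A_lf. Qed.

Let wt x : R := (1 + x ^+ 2)^-1 ^+ p.

Lemma wt_ge0 x : 0 <= wt x.
Proof. by rewrite exprn_ge0 // invr_ge0 addr_ge0 // sqr_ge0. Qed.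

Lemma B_ge0 : 0 <= B.
Proof. by have := w_bd (s := [::]) isT; rewrite big_nil; apply. Qed.

Lemma psum_bound f K k : 0 <= K -> (forall x, `|f x| <= K * wt x) -> `|psum f k| <= K * B.
Proof.
move=> K0 fK; rewrite psumE; apply: le_trans (ler_norm_sum _ _ _) _.
apply: (@le_trans _ _ (K * \sum_(x <- cut k) w x * wt x)); last first.
  apply: ler_wpM2l => //; apply: w_bd; first exact: finmap.fset_uniq.
  by move=> x; rewrite mem_cut => /andP[/set_mem].
rewrite big_distrr /=; apply: ler_sum => x _; rewrite normrM ger0_norm //.
by rewrite mulrCA; apply: ler_wpM2l.
Qed.

Lemma psum_cvg_ge0 f K : 0 <= K -> (forall x, 0 <= f x <= K * wt x) -> cvgn (psum f).
Proof.
move=> K0 fK; apply: nondecreasing_is_cvgn; last first.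
  exists (K * B) => _ [k _ <-]; apply: le_trans (ler_norm _) _.
  by apply: psum_bound => // x; have /andP[f0 f1] := fK x; rewrite ger0_norm.
move=> k l kl; rewrite !psumE [leRHS](bigID (mem (cut k))) /=.
have -> : \sum_(x <- cut l | x \in cut k) w x * f x = \sum_(x <- cut k) w x * f x.
  rewrite -big_filter; apply: perm_big; apply: uniq_perm.
  - by rewrite filter_uniq // finmap.fset_uniq.
  - exact: finmap.fset_uniq.
  move=> x; rewrite mem_filter /= !mem_cut; case: (x \in A) => //=.
  by case: (leP `|x| k%:R) => //= xk; rewrite (le_trans xk) // ler_nat.
rewrite lerDl; apply: sumr_ge0 => x _; rewrite mulr_ge0 //.
by case/andP: (fK x).
Qed.

Lemma psum_linear c f g k : psum (fun x => c * f x + g x) k = c * psum f k + psum g k.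
Proof.
rewrite !psumE big_distrr -big_split /=; apply: eq_bigr => x _; ring.
Qed.

Lemma decays_bound f : decays f -> exists2 K, 0 <= K & forall x, `|f x| <= K * wt x.
Proof.
move=> [K hK]; exists `|K| => // x; apply: le_trans (hK x) _.
by apply: ler_wpM2r; [exact: wt_ge0|exact: ler_norm].
Qed.

Lemma psum_cvg f : decays f -> psum f k @[k --> \oo] --> mass_pairing f.
Proof.
move=> /decays_bound [K K0 fK].
(* Monotone convergence needs nonnegative terms, so [f] is written as the difference of [f + K wt]
   and [K wt]. *)
have h1 : cvgn (psum (fun x => 1 * f x + K * wt x)).
  apply: (@psum_cvg_ge0 _ (2 * K)); first by rewrite mulr_ge0.
  move=> x; have := fK x; rewrite ler_norml mul1r -mulrA [2 * _]mulr_natl mulr2n.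
  by move=> /andP[h1 h2]; apply/andP; split; lra.
have h2 : cvgn (psum (fun x => K * wt x)).
  apply: (@psum_cvg_ge0 _ K) => // x; rewrite lexx andbT mulr_ge0 //; exact: wt_ge0.
suff : cvgn (psum f) by [].
have -> : psum f = (fun k => (-1) * psum (fun x => K * wt x) k +
    psum (fun x => 1 * f x + K * wt x) k).
  apply/funext => k; rewrite -psum_linear; congr psum; apply/funext => x; ring.
by apply/cvg_ex; eexists; apply: cvgD h1; apply: cvgM h2; exact: cvg_cst.
Qed.

Lemma mass_pairing_bound f K : 0 <= K -> (forall x, `|f x| <= K * wt x) ->
  `|mass_pairing f| <= K * B.
Proof.
move=> K0 fK; have df : decays f by exists K.
have h : `|psum f k| @[k --> \oo] --> `|mass_pairing f|.
  by apply: cvg_norm; exact: psum_cvg.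
rewrite -(cvg_lim (@Rhausdorff R) h); apply: limr_le; first by apply/cvg_ex; eexists; exact: h.
by apply: nearW => k; exact: psum_bound.
Qed.

Lemma mass_pairing_linear c f g : decays f -> decays g ->
  mass_pairing (fun x => c * f x + g x) = c * mass_pairing f + mass_pairing g.
Proof.
move=> /psum_cvg df /psum_cvg dg; apply: (cvg_lim (@Rhausdorff R)).
have -> : psum (fun x => c * f x + g x) = (fun k => c * psum f k + psum g k).
  by apply/funext => k; exact: psum_linear.
by apply: cvgD dg; apply: cvgM df; exact: cvg_cst.
Qed.

Lemma decays_linear c f g : decays f -> decays g -> decays (fun x => c * f x + g x).
Proof.
move=> [K hK] [L hL]; exists (`|c| * K + L) => x.
apply: le_trans (ler_normD _ _) _; rewrite mulrDl; apply: lerD => //.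
by rewrite normrM -mulrA; apply: ler_wpM2l.
Qed.

Lemma mass_pairing_compact f M : (forall x, M < `|x| -> f x = 0) ->
  mass_pairing f = \sum_(x \in A) w x * f x.
Proof.
move=> fM; apply: (cvg_lim (@Rhausdorff R)); apply: cvg_near_cst.
near=> k; have Mk : M <= k%:R by near: k; exact: nbhs_infty_ger.
apply: fsbig_widen; first by move=> x [].
move=> x [xA] /= /not_andP [//|]; rewrite in_itv /= -ler_norml => /negP.
by rewrite -ltNge => kx; rewrite fM ?mulr0 // (le_lt_trans Mk).
Unshelve. all: end_near. Qed.

Definition mass_functional (f : R -> CC R) : CC R :=
  mass_pairing (fun x => complex.Re (f x)) +i* mass_pairing (fun x => complex.Im (f x)).

Lemma Re_le_normc (z : R[i]) : `|complex.Re z| <= Normc.normc z.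
Proof.
case: z => a b /=; rewrite -sqrtr_sqr ler_sqrt ?lerDl ?sqr_ge0 //.
by rewrite addr_ge0 ?sqr_ge0.
Qed.

Lemma Im_le_normc (z : R[i]) : `|complex.Im z| <= Normc.normc z.
Proof.
case: z => a b /=; rewrite -sqrtr_sqr ler_sqrt ?lerDr ?sqr_ge0 //.
by rewrite addr_ge0 ?sqr_ge0.
Qed.

Lemma normc_le_ReIm (z : R[i]) :
  Normc.normc z <= `|complex.Re z| + `|complex.Im z|.
Proof.
case: z => a b /=; rewrite -(ger0_norm (_ : 0 <= `|a| + `|b|)) ?addr_ge0 //.
rewrite -sqrtr_sqr ler_sqrt ?sqr_ge0 // sqrrD.
rewrite !real_normK ?num_real //.
have : 0 <= `|a| * `|b| by rewrite mulr_ge0.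
rewrite -mulr_natr; lra.
Qed.

Lemma schwartz_bound (f : R -> CC R) : schwartz f ->
  let K := 2 ^+ p * (schwartz_seminorm 0 0 f + schwartz_seminorm (2 * p) 0 f) in
  0 <= K /\ forall x, Normc.normc (f x) <= K * wt x.
Proof.
move=> [_ hf] K.
have h k x : `|x| ^+ k * Normc.normc (f x) <= schwartz_seminorm k 0 f.
  have e : f x = cderivn 0 f x by rewrite /cderivn /=; case: (f x).
  rewrite e; apply: ub_le_sup; first exact: hf.
  by exists x.
have n0 x : 0 <= Normc.normc (f x) by case: (f x) => a b; exact: sqrtr_ge0.
have s0 k : 0 <= schwartz_seminorm k 0 f.
  by apply: le_trans (h k 0); rewrite mulr_ge0 ?exprn_ge0.
split; first by rewrite mulr_ge0 ?addr_ge0 ?exprn_ge0.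
move=> x; rewrite /wt exprVn ler_pdivlMr; last first.
  by rewrite exprn_gt0 // ltr_pwDl // sqr_ge0.
have h1 : (1 + x ^+ 2) ^+ p <= 2 ^+ p * (1 + `|x| ^+ (2 * p)).
  have y0 : 0 <= x ^+ 2 by rewrite sqr_ge0.
  rewrite exprM real_normK ?num_real //; set y := x ^+ 2 in y0 *.
  have [y1|y1] := leP y 1.
    apply: (@le_trans _ _ (2 ^+ p)).
      by apply: lerXn2r; rewrite ?nnegrE; lra.
    by rewrite ler_peMr ?exprn_ge0 // lerDl exprn_ge0.
  apply: (@le_trans _ _ ((2 * y) ^+ p)).
    by apply: lerXn2r; rewrite ?nnegrE; lra.
  by rewrite exprMn; apply: ler_wpM2l; rewrite ?exprn_ge0 // lerDr.
apply: le_trans (ler_wpM2l (n0 x) h1) _; rewrite mulrCA /K.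
apply: ler_wpM2l; first by rewrite exprn_ge0.
rewrite mulrDr mulr1; apply: lerD; last by rewrite mulrC; exact: h.
by have := h 0%N x; rewrite expr0 mul1r.
Qed.

Lemma schwartz_decays (f : R -> CC R) : schwartz f ->
  decays (fun x => complex.Re (f x)) /\ decays (fun x => complex.Im (f x)).
Proof.
move=> /schwartz_bound [K0 hK]; split; eexists => x; apply: le_trans (hK x).
  exact: Re_le_normc.
exact: Im_le_normc.
Qed.

Lemma mass_functional_tempered : tempered_distribution mass_functional.
Proof.
split.
  move=> c f g /schwartz_decays [fR fI] /schwartz_decays [gR gI].
  have e1 : (fun t => complex.Re (c * f t + g t)) =
     (fun t => complex.Re c * complex.Re (f t) +
       (- complex.Im c * complex.Im (f t) + complex.Re (g t))).
    by apply/funext => t; rewrite cReD cReM; ring.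
  have e2 : (fun t => complex.Im (c * f t + g t)) =
     (fun t => complex.Re c * complex.Im (f t) +
       (complex.Im c * complex.Re (f t) + complex.Im (g t))).
    by apply/funext => t; rewrite cImD cImM; ring.
  rewrite /mass_functional e1 e2 !mass_pairing_linear //; try exact: decays_linear.
  by apply/eqP; rewrite eq_complex cReD cImD cReM cImM /=; apply/andP; split; apply/eqP; ring.
(* The highest power of [|t|] used is [2 p]. The outer factor 2 stands for real and imaginary parts,
   the inner one for the two seminorms of [schwartz_bound]. *)
exists (2 * p)%N, (2 * (2 ^+ p * B * 2)) => f fS.
have [K0 hK] := schwartz_bound fS; set K := _ * _ in K0 hK.
have s0 k m : 0 <= schwartz_seminorm k m f.
  have [_ hf] := fS; apply: (@le_trans _ _ (schwartz_weight k m f 0)).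
    by rewrite mulr_ge0 ?exprn_ge0 //; case: (cderivn m f 0) => a b; exact: sqrtr_ge0.
  by apply: ub_le_sup; [exact: hf|exists 0].
apply: (@le_trans _ _ (2 * (K * B))).
  apply: le_trans (normc_le_ReIm _) _; rewrite mulr_natl mulr2n /=.
  apply: lerD; apply: mass_pairing_bound => // x; apply: le_trans (hK x).
    exact: Re_le_normc.
  exact: Im_le_normc.
have h k : (k <= 2 * p)%N -> schwartz_seminorm k 0 f <=
   \sum_(k < (2 * p).+1) \sum_(m < (2 * p).+1) schwartz_seminorm k m f.
  move=> kp; rewrite (bigD1 (inord k)) //= (bigD1 ord0) //= inordK ?ltnS //.
  rewrite -addrA lerDl addr_ge0 //; apply: sumr_ge0 => i _ //.
  by apply: sumr_ge0.
have q0 : 0 <= 2 * (2 ^+ p * B) by rewrite !mulr_ge0 ?exprn_ge0 // B_ge0.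
have aS := h 0%N isT; have bS := h (2 * p)%N (leqnn _).
set S := \sum_(k < _) _ in aS bS *.
have -> : 2 * (K * B) = 2 * (2 ^+ p * B) *
    (schwartz_seminorm 0 0 f + schwartz_seminorm (2 * p) 0 f) by rewrite /K; ring.
have -> : 2 * (2 ^+ p * B * 2) * S = 2 * (2 ^+ p * B) * (S + S) by ring.
by apply: ler_wpM2l => //; exact: lerD.
Qed.

Lemma mass_functional_compact (f : R -> CC R) : compactly_supported f ->
  mass_functional f = point_masses A (fun x => (w x)%:C) f.
Proof.
move=> [M fM]; rewrite /mass_functional /point_masses.
have cpt g : (forall x, M < `|x| -> g x = 0) ->
    mass_pairing g = \sum_(x \in A) w x * g x by exact: mass_pairing_compact.
have fin : finite_set (A `&` [set x | `|x| <= M]).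
  apply: (sub_finite_set _ (A_lf (- M) M)) => x [Ax xM]; split=> //=.
  by rewrite in_itv /= -ler_norml.
have wid (V : nmodType) (h : R -> V) : (forall x, M < `|x| -> h x = 0) ->
    \sum_(x \in A) h x = \sum_(x \in A `&` [set x | `|x| <= M]) h x.
  move=> h0; apply/esym; apply: fsbig_widen; first by move=> x [].
  move=> x [Ax] /= /not_andP[//|/negP]; rewrite -ltNge => /h0 //.
rewrite !cpt; last 2 first.
- by move=> x /fM ->.
- by move=> x /fM ->.
rewrite !wid; last 3 first.
- by move=> x /fM ->; rewrite mulr0.
- by move=> x /fM ->; rewrite mulr0.
- by move=> x /fM ->; rewrite mulr0.
rewrite !fsbig_finite //.
apply/eqP; rewrite eq_complex cRe_sum cIm_sum /=; apply/andP; split; apply/eqP;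
  apply: eq_bigr => x _; case: (f x) => a b /=.
  by rewrite mul0r subr0.
by rewrite mul0r addr0.
Qed.

Lemma mass_functional_represents :
  represents mass_functional A (fun x => (w x)%:C : CC R).
Proof. by move=> f [_ /mass_functional_compact]. Qed.

End TemperedSums.

(** * Zeros of rational approximants *)

Section ApproximateZeros.
Variables (R : realType) (n : nat) (P Q : mpoly.mpoly n R[i]) (ell : 'I_n -> nat) (eta : R[i]).
Hypotheses (Ps : stable P) (Qs : stable Q) (PQ : reciprocal P Q ell eta).
Variable xi : 'I_n -> R.
Hypothesis xi_gt0 : forall j, 0 < xi j.

Lemma const_coef_neq0 : const_coef P != 0.
Proof. by rewrite -meval0; apply: Ps => j; rewrite normr0. Qed.

(* Rounding up makes [wt (apx N) m <= K * N] imply [wtR xi m <= K]. *)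
Definition apx (N : nat) (j : 'I_n) : nat := (Num.truncn (xi j * N%:R)).+1.

Lemma apx_dist N j : (0 < N)%N -> `|xi j - (apx N j)%:R / N%:R| <= N%:R^-1.
Proof.
move=> N0; have Nr : 0 < N%:R :> R by rewrite ltr0n.
have xN : 0 <= xi j * N%:R by rewrite mulr_ge0 // ltW.
have [h1 h2] := andP (truncn_itv xN).
have -> : xi j = xi j * N%:R / N%:R by rewrite mulfK // gt_eqF.
rewrite -mulrBl normrM (ger0_norm (_ : 0 <= N%:R^-1)) ?invr_ge0 // -[leRHS]mul1r.
apply: ler_wpM2r; first by rewrite invr_ge0.
rewrite /apx -natr1 ler_norml; move: h2; rewrite -natr1 => h2.
by apply/andP; split; lra.
Qed.

Definition good_zeros k th (ys : seq R) :=
  [/\ {in ys, forall y, `|y| <= pi * k.+1%:R},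
      size ys = (\sum_j ell j * apx k.+1 j)%N &
      upoly (fun j => cis (th j)) (apx k.+1) P =
      const_coef P *: \prod_(y <- ys) (1 - cis (y / k.+1%:R) *: 'X)].

(* The frequencies [xi j] are replaced by the multiples [apx k.+1 j / k.+1] of
   [1 / k.+1]. *)
Definition azeros k th : seq R := xget [::] [set ys | good_zeros k th ys].

Lemma azerosP k th : good_zeros k th (azeros k th).
Proof.
apply: (@xgetPex _ [::] [set ys | good_zeros k th ys]).
exact: approx_zeros Ps Qs PQ _ _.
Qed.

Let w th g : R := (tmult P xi th g)%:R.
Definition zero_set th : set R := [set g | tmult P xi th g != 0%N].

Section Family.
Variables (I : Type) (Fl : set_system I).
Context {FF : ProperFilter Fl}.
Variables (K_ : I -> nat) (th_ : I -> 'I_n -> R) (th : 'I_n -> R).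
Hypothesis K_inf : forall K, \forall i \near Fl, (K <= K_ i)%N.
Hypothesis th_cvg : forall j, th_ i j @[i --> Fl] --> th j.

Let G_ i s g := nsq (twisted P (fun j => (apx (K_ i).+1 j)%:R / (K_ i).+1%:R) (th_ i) s g).

Lemma K_inf1 K : \forall i \near Fl, (K <= (K_ i).+1)%N.
Proof. by apply: filterS (K_inf K) => i; exact: leqW. Qed.

Lemma apx_cvg j : (apx (K_ i).+1 j)%:R / (K_ i).+1%:R @[i --> Fl] --> xi j.
Proof.
apply/cvgrPdist_le => e e0; near=> i.
apply: le_trans (apx_dist _ _) _ => //.
rewrite -[leRHS]invrK lef_pV2 ?posrE ?invr_gt0 ?ltr0n //.
apply: ltW; apply: lt_le_trans (truncnS_gt _) _; rewrite ler_nat ltnS.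
by near: i; exact: K_inf.
Unshelve. all: end_near. Qed.

Lemma azeros_size_cvg :
  (size (azeros (K_ i) (th_ i)))%:R / (K_ i).+1%:R @[i --> Fl] --> \sum_j (ell j)%:R * xi j.
Proof.
under eq_fun => i.
  have [_ -> _] := azerosP (K_ i) (th_ i).
  rewrite natr_sum big_distrl /=; under eq_bigr do rewrite natrM -mulrA.
  over.
apply: (@cvg_big _ _ +%R 0); first exact: add_continuous.
by move=> j _; apply: cvgM; [exact: cvg_cst|exact: apx_cvg].
Qed.

Let ys_le i y : y \in azeros (K_ i) (th_ i) -> `|y| <= pi * (K_ i).+1%:R.
Proof. by have [h _ _] := azerosP (K_ i) (th_ i); exact: h. Qed.

Let G_E i s g : G_ i s g = nsq (const_coef P) *
  \prod_(y <- azeros (K_ i) (th_ i))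
    dist2 (expR (- (s / (K_ i).+1%:R))) (cos ((y - g) / (K_ i).+1%:R)).
Proof.
by have [_ _ h] := azerosP (K_ i) (th_ i); exact: nsq_twisted.
Qed.

Let kap_gt0 : 0 < nsq (const_coef P). Proof. exact/nsq_gt0/const_coef_neq0. Qed.

Let G_cvg s g : 0 < s -> G_ i s g @[i --> Fl] --> nsq (twisted P xi th s g).
Proof. by move=> _; apply: cvg_nsq_twisted => // j; exact: apx_cvg. Qed.

Let G_gt0 s g : 0 < s -> 0 < nsq (twisted P xi th s g).
Proof. by move=> s0; apply/nsq_gt0/twisted_neq0. Qed.

Let ratio (g : R) := @twisted_ratio R n P xi th g xi_gt0 const_coef_neq0.

Lemma tmult_mass_bound : exists2 B : R, 0 < B & forall s : seq R, uniq s ->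
  \sum_(g <- s) w th g * (1 + g ^+ 2)^-1 <= B.
Proof.
exact: (mass_bound K_inf1 ys_le kap_gt0 G_E azeros_size_cvg G_cvg G_gt0 ratio).
Qed.

Lemma tmult_finite M : finite_set [set g | tmult P xi th g != 0%N /\ `|g| <= M].
Proof.
exact: (zeros_finite K_inf1 ys_le kap_gt0 G_E azeros_size_cvg G_cvg G_gt0 ratio).
Qed.

Lemma azeros_limit (f : R -> R) (f_ : I -> R -> R) (Bf : R) :
  (\forall i \near Fl, {in azeros (K_ i) (th_ i), forall y,
     `|f_ i y| <= Bf * (1 + y ^+ 2)^-1 ^+ 2}) ->
  (forall g e : R, 0 < e -> exists2 d : R, 0 < d & \forall i \near Fl,
     forall y, `|y - g| <= d -> `|f_ i y - f g| <= e) ->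
  forall e : R, 0 < e -> exists M0 : R, forall M, M0 <= M -> forall s : seq R, uniq s ->
    (forall g, reflect (tmult P xi th g != 0%N /\ `|g| <= M) (g \in s)) ->
    \forall i \near Fl,
      `|\sum_(y <- azeros (K_ i) (th_ i)) f_ i y - \sum_(g <- s) w th g * f g| <= e.
Proof.
exact: (sum_limit K_inf1 ys_le kap_gt0 G_E azeros_size_cvg G_cvg G_gt0 ratio).
Qed.

End Family.

Lemma zero_set_lf th : locally_finite (zero_set th).
Proof.
move=> x y.
have h : finite_set [set g | tmult P xi th g != 0%N /\ `|g| <= `|x| + `|y|].
  apply: (@tmult_finite nat \oo _ id (fun=> th) th).
  - by move=> K; exact: nbhs_infty_ge.
  - by move=> j; exact: cvg_cst.
apply: (sub_finite_set _ h) => g [/= g0]; rewrite in_itv /= => /andP[xg gy].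
split => //; rewrite ler_norml; have := ler_norm (- x); rewrite normrN.
have := ler_norm y; have := normr_ge0 x; have := normr_ge0 y => h1 h2 h3 h4.
by apply/andP; split; lra.
Qed.

Lemma zero_mass_bound th : exists2 B : R, 0 < B & forall s : seq R, uniq s ->
  \sum_(g <- s) w th g * (1 + g ^+ 2)^-1 <= B.
Proof.
apply: (@tmult_mass_bound nat \oo _ id (fun=> th) th).
- by move=> K; exact: nbhs_infty_ge.
- by move=> j; exact: cvg_cst.
Qed.

(** The exponent 2 matches the decay that [sum_limit] asks of the functions it sums. *)
Lemma zero_mass_bound2 th : exists B : R, forall s : seq R, uniq s ->
  {in s, forall x, zero_set th x} -> \sum_(g <- s) w th g * (1 + g ^+ 2)^-1 ^+ 2 <= B.
Proof.
have [B B0 h] := zero_mass_bound th; exists B => s us _.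
apply: le_trans (h s us); apply: ler_sum => g _.
apply: ler_wpM2l; first by rewrite ler0n.
have g0 : 1 <= 1 + g ^+ 2 by rewrite lerDl sqr_ge0.
have : (1 + g ^+ 2)^-1 <= 1 by rewrite invf_le1 // (lt_le_trans ltr01).
have : 0 <= (1 + g ^+ 2)^-1 by rewrite invr_ge0 (le_trans ler01).
by rewrite expr2; nra.
Qed.

Definition zero_pairing th (f : R -> R) : R := mass_pairing (zero_set th) (w th) f.

(** The filter and the phases [th_ i] are arbitrary: this is applied along [\oo] with fixed phases
    and along an ultrafilter with moving ones. The sum is compared with the truncation of the zero
    measure to a large interval. *)
Lemma azeros_cvg (I : Type) (Fl : set_system I) {FF : ProperFilter Fl}
    (K_ : I -> nat) (th_ : I -> 'I_n -> R) (th : 'I_n -> R)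
    (f : R -> R) (f_ : I -> R -> R) (Bf : R) :
  (forall K, \forall i \near Fl, (K <= K_ i)%N) ->
  (forall j, th_ i j @[i --> Fl] --> th j) ->
  decays 2 f ->
  (\forall i \near Fl, {in azeros (K_ i) (th_ i), forall y,
     `|f_ i y| <= Bf * (1 + y ^+ 2)^-1 ^+ 2}) ->
  (forall g e : R, 0 < e -> exists2 d : R, 0 < d & \forall i \near Fl,
     forall y, `|y - g| <= d -> `|f_ i y - f g| <= e) ->
  \sum_(y <- azeros (K_ i) (th_ i)) f_ i y @[i --> Fl] --> zero_pairing th f.
Proof.
move=> hK hth df hb hl; apply/cvgrPdist_le => e e0.
have e20 : 0 < e / 2 by rewrite divr_gt0.
have [M0 hM0] := azeros_limit hK hth hb hl e20.
have [B hB] := zero_mass_bound2 th.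
have w0 x : 0 <= w th x by rewrite ler0n.
have hp := @psum_cvg R (zero_set th) (w th) 2 B (zero_set_lf th) w0 hB f df.
have /cvgrPdist_le/(_ _ e20) hp' := hp.
have [k [kM kp]] : exists k, M0 <= k%:R /\
    `|zero_pairing th f - psum (zero_set th) (w th) f k| <= e / 2.
  near \oo => k; exists k; split; first by near: k; exact: nbhs_infty_ger.
  by near: k; exact: hp'.
have := hM0 _ kM (fset_set (zero_set th `&` `[- k%:R, k%:R])) (finmap.fset_uniq _).
move=> /(_ _)/filterS; apply.
  move=> i hi; rewrite -(subrKA (psum (zero_set th) (w th) f k)).
  apply: le_trans (ler_normD _ _) _; rewrite (splitr e); apply: lerD => //.
  by rewrite distrC psumE //; exact: zero_set_lf.
move=> g; rewrite mem_cut; last exact: zero_set_lf.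
apply: (iffP andP) => [[/set_mem]|[]] h1 h2; split=> //; exact: mem_set.
Unshelve. all: end_near. Qed.

End ApproximateZeros.

(** * Riemann sums of a Fourier transform *)

Section SmoothReal.
Variable R : realType.
Implicit Types (u g : R -> R) (d t x y C M : R).

Definition rsmooth u := forall m t, derivable (derive1n m u) t 1.

Definition bdiff (V : zmodType) d (u : R -> V) t : V := u t - u (t - d).

Lemma rsmooth_is_derive u m t : rsmooth u -> is_derive t 1 (derive1n m u) (derive1n m.+1 u t).
Proof. by move=> us; apply: DeriveDef; [exact: us|rewrite derive1nS derive1E]. Qed.

Lemma rsmooth_continuous u m : rsmooth u -> continuous (derive1n m u).
Proof. by move=> us t; apply/differentiable_continuous/derivable1_diffP; exact: us. Qed.

Lemma derive1n_outside u M m t : (forall t, M < `|t| -> u t = 0) -> M < `|t| ->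
  derive1n m u t = 0.
Proof.
move=> h; elim: m t => [|m IH] t Mt; first exact: h.
rewrite derive1nS derive1E (@near_eq_derive _ _ _ _ (cst 0)) ?derive_cst //.
near=> z; rewrite /cst IH //; near: z.
by apply: (cvgr_gt _ _ _ Mt); apply: cvg_norm; exact: cvg_id.
Unshelve. all: end_near. Qed.

Lemma derive1n_bounded u M m : rsmooth u -> (forall t, M < `|t| -> u t = 0) ->
  exists2 C, 0 <= C & forall t, `|derive1n m u t| <= C.
Proof.
move=> us h; pose M' := `|M|; have MM : - M' <= M' by have := normr_ge0 M; rewrite /M'; lra.
have [|c _ hc] := @EVT_max R (fun t => `|derive1n m u t|) _ _ MM.
  apply: continuous_subspaceT => t; apply: continuous_comp; last exact: norm_continuous.
  exact: rsmooth_continuous.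
exists (`|derive1n m u c|) => // t; have [tM|tM] := leP `|t| M'.
  by apply: hc; rewrite in_itv /= -ler_norml.
by rewrite (derive1n_outside _ h) ?normr0 // (le_lt_trans (ler_norm M)).
Qed.

Lemma rsmooth_lipschitz u m C : rsmooth u -> (forall t, `|derive1n m.+1 u t| <= C) ->
  forall x y, `|derive1n m u x - derive1n m u y| <= C * `|x - y|.
Proof.
move=> us hC x y; wlog xy : x y / y < x => [H|].
  have [xy|yx|->] := ltgtP x y; last by rewrite !subrr !normr0 mulr0.
    by rewrite distrC (distrC x); exact: H.
  exact: H.
have [|c _ ->] := @MVT R (derive1n m u) (derive1n m.+1 u) y x xy
   (fun t _ => rsmooth_is_derive m t us).
  by apply: continuous_subspaceT => t; exact: rsmooth_continuous.
by rewrite normrM; apply: ler_wpM2r.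
Qed.

Lemma derive1n_bdiff u d m : rsmooth u -> derive1n m (bdiff d u) = bdiff d (derive1n m u).
Proof.
move=> us; elim: m => [//|m IH]; apply/funext => t.
rewrite derive1nS IH derive1E.
have h1 := rsmooth_is_derive m t us.
have h2 : is_derive t 1 (derive1n m u \o (fun t => t - d)) (derive1n m.+1 u (t - d) * 1).
  apply: is_derive1_comp; first exact: rsmooth_is_derive.
  rewrite -[X in is_derive _ _ _ X]subr0; apply: is_deriveB.
have h3 : is_derive t 1 (bdiff d (derive1n m u))
    (derive1n m.+1 u t - derive1n m.+1 u (t - d) * 1) by exact: is_deriveB.
by rewrite derive_val /bdiff mulr1.
Qed.

Lemma rsmooth_bdiff u d : rsmooth u -> rsmooth (bdiff d u).
Proof.
move=> us m t; rewrite derive1n_bdiff //.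
have h1 := rsmooth_is_derive m t us.
have h2 : is_derive t 1 (derive1n m u \o (fun t => t - d)) (derive1n m.+1 u (t - d) * 1).
  apply: is_derive1_comp; first exact: rsmooth_is_derive.
  rewrite -[X in is_derive _ _ _ X]subr0; apply: is_deriveB.
by apply: derivableB; [exact: us|exact: ex_derive].
Qed.

(** Differences commute with derivatives, and by the mean value theorem each one trades a derivative
    for a factor [d]. *)
Lemma iter_bdiff_bound m u d C : rsmooth u -> 0 <= d ->
  (forall t, `|derive1n m u t| <= C) -> forall t, `|iter m (bdiff d) u t| <= d ^+ m * C.
Proof.
elim: m u C => [|m IH] u C us d0 hC t; first by rewrite expr0 mul1r; exact: hC.
rewrite iterSr exprS -mulrA mulrCA; apply: IH; [exact: rsmooth_bdiff|exact: d0|].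
move=> x; rewrite derive1n_bdiff // /bdiff.
apply: le_trans (rsmooth_lipschitz us hC _ _) _.
by rewrite subKr (ger0_norm d0) mulrC.
Qed.

End SmoothReal.

(** * Riemann sums of Lipschitz functions *)

Section RiemannSum.
Variable R : realType.
Local Notation mu := (@lebesgue_measure R).

Lemma riemann_sum (g : R -> R) (L : R) (K N : nat) :
  continuous g -> (forall x y, `|g x - g y| <= L * `|x - y|) ->
  (forall t, K%:R <= `|t| -> g t = 0) -> (0 < N)%N ->
  `|Rintegral mu setT g - N%:R^-1 * \sum_(j < 2 * K * N) g (j%:R / N%:R - K%:R)|
     <= 2 * K%:R * L / N%:R.
Proof.
move=> gc gL gK N0; have Nr : 0 < N%:R :> R by rewrite ltr0n.
(* The margin 1 puts all nodes, [- K] and [K] included, inside the open interval where the primitive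
   [F] is differentiable. *)
pose a : R := - (K%:R + 1); pose b : R := K%:R + 1.
have K0 : 0 <= K%:R :> R by [].
pose F x := Rintegral mu `[a, x] g.
have gi u : mu.-integrable `[a, u] (EFin \o g).
  apply: continuous_compact_integrable; first exact: segment_compact.
  exact: continuous_subspaceT.
have Fd x : a < x -> x < b -> is_derive x 1 F (g x).
  move=> ax xb; have [d1 d2] := @continuous_FTC1_closed R g a x b xb (gi b) ax (gc x).
  by apply: DeriveDef; [exact: d1|rewrite -derive1E; exact: d2].
pose t (j : nat) : R := j%:R / N%:R - K%:R.
have tS j : t j.+1 = t j + N%:R^-1 by rewrite /t -natr1 mulrDl mul1r addrAC.
have Ni : 0 < N%:R^-1 :> R by rewrite invr_gt0.
have t0 : t 0%N = - K%:R by rewrite /t mul0r sub0r.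
have te : t (2 * K * N)%N = K%:R.
  by rewrite /t natrM mulfK ?gt_eqF // natrM; ring.
have tge j : - K%:R <= t j by rewrite /t lerBrDl subrr divr_ge0.
have tle j : (j <= 2 * K * N)%N -> t j <= K%:R.
  move=> jK; rewrite -te /t lerD2r; apply: ler_wpM2r; first exact: ltW.
  by rewrite ler_nat.
have step (j : nat) : (j < 2 * K * N)%N ->
    `|F (t j.+1) - F (t j) - N%:R^-1 * g (t j)| <= L / N%:R * N%:R^-1.
  move=> jK; have tt : t j < t j.+1 by rewrite tS ltrDl.
  have inn x : t j <= x -> x <= t j.+1 -> is_derive x 1 F (g x).
    move=> h1 h2; apply: Fd; rewrite /a /b; first by have := tge j; lra.
    by have := tle j.+1 jK; lra.
  have [||c] := @MVT R F g _ _ tt.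
  - by move=> x; rewrite in_itv /= => /andP[h1 h2]; apply: inn; exact: ltW.
  - apply: derivable_within_continuous => x; rewrite in_itv /= => /andP[h1 h2].
    by have [] := inn x h1 h2.
  rewrite in_itv /= => /andP[h1 h2] ->.
  have -> : t j.+1 - t j = N%:R^-1 by rewrite tS addrAC subrr add0r.
  rewrite mulrC -mulrBr normrM (gtr0_norm Ni) mulrC; apply: ler_wpM2r; first exact: ltW.
  apply: le_trans (gL _ _) _.
  have L0 : 0 <= L by have := gL 1 0; rewrite subr0 normr1 mulr1; apply: le_trans.
  apply: ler_wpM2l => //; rewrite ger0_norm; last lra.
  by rewrite tS in h2; lra.
have Fe : Rintegral mu setT g = F K%:R.
  rewrite /F [RHS]Rintegral_mkcond; congr Rintegral; apply/funext => x; rewrite patchE.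
  case: ifPn => // /negP xn; apply: gK; rewrite leNgt; apply/negP => xK.
  apply: xn; apply: mem_set; rewrite /= in_itv /=; move: xK; rewrite ltr_norml.
  by move=> /andP[h1 h2]; apply/andP; split; rewrite /a; lra.
have F0 : F (- K%:R) = 0.
  rewrite /F /Rintegral integral0_eq // => x; rewrite /= in_itv /= => /andP[h1 h2].
  by rewrite gK // ler0_norm; lra.
have tel : Rintegral mu setT g = \sum_(j < 2 * K * N) (F (t j.+1) - F (t j)).
  by rewrite -(big_mkord xpredT (fun j => F (t j.+1) - F (t j))) telescope_sumr // te t0 F0 subr0.
rewrite tel big_distrr -sumrB; apply: le_trans (ler_norm_sum _ _ _) _.
apply: (@le_trans _ _ (\sum_(j < 2 * K * N) (L / N%:R * N%:R^-1))).
  by apply: ler_sum => j _; exact: step.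
rewrite sumr_const card_ord -[_ *+ (2 * K * N)%N]mulr_natl natrM natrM.
by rewrite le_eqVlt; apply/orP; left; apply/eqP; field; rewrite gt_eqF.
Qed.

End RiemannSum.

(** * Convergence and uniform decay of Riemann sums *)

Section FourierApprox.
Variable R : realType.
Implicit Types (h : R -> R[i]) (t x y g : R).
Local Notation mu := (@lebesgue_measure R).
Local Notation nrm := (@Normc.normc R).

Lemma nrmE (z : R[i]) : nrm z = Num.sqrt (nsq z).
Proof. by case: z. Qed.

Lemma nrm_ge0 (z : R[i]) : 0 <= nrm z.
Proof. by rewrite nrmE sqrtr_ge0. Qed.

Lemma nrm_sqr (z : R[i]) : nrm z ^+ 2 = nsq z.
Proof. by rewrite nrmE sqr_sqrtr // nsq_ge0. Qed.

Lemma nrm_cis x : nrm (cis x) = 1.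
Proof. by rewrite nrmE nsq_cis sqrtr1. Qed.

Lemma nrm_sum (T : Type) (r : seq T) (p : pred T) (F : T -> R[i]) :
  nrm (\sum_(i <- r | p i) F i) <= \sum_(i <- r | p i) nrm (F i).
Proof.
elim/big_ind2: _ => [|u a v b h1 h2|//]; first by rewrite Normc.normc0.
by apply: le_trans (le_normcD _ _) _; exact: lerD.
Qed.

Lemma sin_lipschitz x y : `|sin x - sin y| <= `|x - y|.
Proof.
wlog xy : x y / y < x => [H|].
  have [xy|yx|->] := ltgtP x y; last by rewrite !subrr.
    by rewrite distrC (distrC x); exact: H.
  exact: H.
have [|c _ ->] := @MVT R sin cos y x xy (fun t _ => is_derive_sin t).
  by apply: continuous_subspaceT => t; exact: continuous_sin.
by rewrite normrM; apply: ler_piMl => //; exact: cos_max.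
Qed.

Lemma cos_lipschitz x y : `|cos x - cos y| <= `|x - y|.
Proof.
rewrite -!sinDpihalf; apply: le_trans (sin_lipschitz _ _) _.
by rewrite opprD addrACA subrr addr0.
Qed.

Definition node (K N j : nat) : R := j%:R / N%:R - K%:R.

(** A Riemann sum for [fourier h y] on [[- K, K]]. With step [1 / k.+1], each
    [cis (y * node K k.+1 j)] is an integer power of [cis (y / k.+1)], so summing over the zeros [y]
    gives power sums. *)
Definition rsum h (K k : nat) y : R[i] :=
  (k.+1%:R^-1)%:C *
  \sum_(j < 2 * K * k.+1) h (node K k.+1 j) * cis (y * node K k.+1 j).

Lemma cexp_im x : cexp (0 +i* x : CC R) = cis x.
Proof. by rewrite /cexp /= expR0 !mul1r. Qed.

Lemma fourier_cis h y : fourier h y =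
  Rintegral mu setT (fun t => complex.Re (h t * cis (y * t))) +i*
  Rintegral mu setT (fun t => complex.Im (h t * cis (y * t))).
Proof.
transitivity (cintegral (fun t => h t * cis (y * t) : CC R)); last by [].
by congr cintegral; apply/funext => t; rewrite cexp_im.
Qed.

Lemma rsum_Re h K k y : complex.Re (rsum h K k y) =
  k.+1%:R^-1 * \sum_(j < 2 * K * k.+1) complex.Re (h (node K k.+1 j) * cis (y * node K k.+1 j)).
Proof. by rewrite /rsum cReM cRe_sum /= mul0r subr0. Qed.

Lemma node_bound K N j : (0 < N)%N -> (j < 2 * K * N)%N -> `|node K N j| <= K%:R.
Proof.
move=> N0 jK; have Nr : 0 < N%:R :> R by rewrite ltr0n.
rewrite /node ler_norml; have : 0 <= j%:R / N%:R :> R by rewrite divr_ge0.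
have : j%:R / N%:R <= 2 * K%:R :> R.
  by rewrite ler_pdivrMr // -!natrM ler_nat ltnW.
by move=> h1 h2; apply/andP; split; lra.
Qed.

(* Summation by parts: each factor [1 - cis (y / N)] turns [v] into its backward
   difference, which yields the decay of [rsum] in [y]. *)
Lemma diff_shift (v : R -> R[i]) (K N : nat) y : (0 < N)%N ->
  (forall t, K%:R - 1 <= `|t| -> v t = 0) ->
  (1 - cis (y / N%:R)) * \sum_(j < 2 * K * N) v (node K N j) * cis (y / N%:R) ^+ j =
  \sum_(j < 2 * K * N) bdiff N%:R^-1 v (node K N j) * cis (y / N%:R) ^+ j.
Proof.
move=> N0 hv; set w := cis _; have Nr : 0 < N%:R :> R by rewrite ltr0n.
have Ni : 0 < N%:R^-1 :> R by rewrite invr_gt0.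
rewrite mulrBl mul1r; under [RHS]eq_bigr do rewrite /bdiff mulrBl.
rewrite sumrB; congr (_ - _).
case E : (2 * K * N)%N => [|J]; first by rewrite !big_ord0 mulr0.
rewrite big_ord_recr [RHS]big_ord_recl /=.
have K0 : 0 <= K%:R :> R by [].
have Ni1 : N%:R^-1 <= 1 :> R by rewrite invf_le1 // ler1n.
rewrite (hv (node K N J)) ?mul0r ?addr0; last first.
  have -> : node K N J = K%:R - N%:R^-1.
    have : J.+1%:R = 2 * K%:R * N%:R :> R by rewrite -E !natrM.
    rewrite /node -natr1 => /(canRL (addrK _)) ->; field; rewrite gt_eqF //.
  by apply: le_trans (ler_norm _); rewrite lerD2l lerN2.
rewrite (hv (node K N 0 - _)) ?mul0r ?add0r; last first.
  by rewrite /node mul0r sub0r -opprD normrN ger0_norm ?addr_ge0 ?(ltW Ni) //; lra.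
rewrite big_distrr /=; apply: eq_bigr => j _.
have -> : node K N (lift ord0 j) - N%:R^-1 = node K N j.
  by rewrite /node lift0 -natr1 mulrDl mul1r; ring.
by rewrite /bump add1n exprS mulrCA.
Qed.

Section Fixed.
Variables (h : R -> R[i]) (K : nat).
Hypothesis hs : smooth h.
(** The margin 5 leaves room for four backward differences of step at most 1, which enlarge the
    support, and for the margin 1 in [diff_shift]. *)
Hypothesis hK : forall t, K%:R - 5 <= `|t| -> h t = 0.

Let hR t : R := complex.Re (h t).
Let hI t : R := complex.Im (h t).

Lemma smooth_Re : rsmooth hR. Proof. move=> m t; have [d _] := hs m t; exact: d. Qed.
Lemma smooth_Im : rsmooth hI.
Proof. move=> m t; have [_ d] := hs m t; exact: d. Qed.

Lemma derive_bounds m : exists2 C, 0 <= C & forall t,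
  `|derive1n m hR t| <= C /\ `|derive1n m hI t| <= C.
Proof.
have sR t : K%:R - 5 < `|t| -> hR t = 0 by move=> /ltW /hK e; rewrite /hR e.
have sI t : K%:R - 5 < `|t| -> hI t = 0 by move=> /ltW /hK e; rewrite /hI e.
have [C C0 hC] := derive1n_bounded m smooth_Re sR.
have [D D0 hD] := derive1n_bounded m smooth_Im sI.
exists (C + D); first exact: addr_ge0.
by move=> t; split; [apply: le_trans (hC t) _|apply: le_trans (hD t) _]; rewrite ?lerDl ?lerDr.
Qed.

Let hK0 t : K%:R <= `|t| -> h t = 0.
Proof. by move=> tK; apply: hK; apply: le_trans tK; rewrite lerBlDr lerDl. Qed.

Let ReE y t : complex.Re (h t * cis (y * t)) = hR t * cos (y * t) - hI t * sin (y * t).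
Proof. by rewrite cReM. Qed.

(** The error grows with [|y|], so this serves for bounded [y]; far away [rsum_decay] takes over. *)
Lemma rsum_dist : exists2 C, 0 <= C & forall k y,
  `|complex.Re (fourier h y) - complex.Re (rsum h K k y)| <= C * (1 + `|y|) / k.+1%:R.
Proof.
have [C0 C00 hC0] := derive_bounds 0; have [C1 C10 hC1] := derive_bounds 1.
have K0 : 0 <= K%:R :> R by [].
exists (2 * K%:R * (2 * (C0 + C1))); first by rewrite !mulr_ge0 // addr_ge0.
move=> k y; rewrite fourier_cis rsum_Re /=.
apply: le_trans (@riemann_sum R _ (2 * (C1 + C0 * `|y|)) K k.+1 _ _ _ _) _ => //.
- move=> t; under eq_fun do rewrite ReE.
  have cR : continuous hR := @rsmooth_continuous R hR 0 smooth_Re.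
  have cI : continuous hI := @rsmooth_continuous R hI 0 smooth_Im.
  have ct : continuous (fun t : R => y * t) by move=> z; exact: mulrl_continuous.
  apply: cvgB; apply: cvgM.
  + exact: cR.
  + by apply: continuous_comp; [exact: ct|exact: continuous_cos].
  + exact: cI.
  + by apply: continuous_comp; [exact: ct|exact: continuous_sin].
- move=> s t; rewrite !ReE.
  have -> : hR s * cos (y * s) - hI s * sin (y * s) - (hR t * cos (y * t) - hI t * sin (y * t)) =
    ((hR s - hR t) * cos (y * s) + hR t * (cos (y * s) - cos (y * t))) -
    ((hI s - hI t) * sin (y * s) + hI t * (sin (y * s) - sin (y * t))) by ring.
  have lR := rsmooth_lipschitz (m := 0) smooth_Re (fun t => (hC1 t).1) s t.
  have lI := rsmooth_lipschitz (m := 0) smooth_Im (fun t => (hC1 t).2) s t.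
  have e : `|y * s - y * t| = `|y| * `|s - t| by rewrite -mulrBr normrM.
  have lc := cos_lipschitz (y * s) (y * t); have ls := sin_lipschitz (y * s) (y * t).
  rewrite e in lc ls.
  have half (a b c d : R) : `|a| <= C1 * `|s - t| -> `|b| <= 1 -> `|c| <= C0 ->
      `|d| <= `|y| * `|s - t| -> `|a * b + c * d| <= (C1 + C0 * `|y|) * `|s - t|.
    move=> ha hb hc hd; apply: le_trans (ler_normD _ _) _; rewrite !normrM mulrDl -mulrA.
    by apply: lerD; [rewrite -[leRHS]mulr1|]; apply: ler_pM.
  apply: le_trans (ler_normB _ _) _; rewrite -mulrA [2 * _]mulr_natl mulr2n.
  apply: lerD; apply: half => //; [exact: cos_max|exact: (hC0 t).1|exact: sin_max|exact: (hC0 t).2].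
- by move=> t /hK0 ->; rewrite mul0r.
rewrite -!mulrA; apply: ler_wpM2l => //; apply: ler_wpM2l => //; apply: ler_wpM2l => //.
rewrite !mulrA; apply: ler_wpM2r; first by rewrite invr_ge0.
by have := normr_ge0 y; nra.
Qed.

Lemma rsum_lipschitz : exists2 C, 0 <= C & forall k y g,
  `|complex.Re (rsum h K k y) - complex.Re (rsum h K k g)| <= C * `|y - g|.
Proof.
have [C0 C00 hC0] := derive_bounds 0.
have K0 : 0 <= K%:R :> R by [].
exists (2 * K%:R * (2 * C0 * K%:R)); first by rewrite !mulr_ge0.
move=> k y g; rewrite !rsum_Re -mulrBr -sumrB normrM ger0_norm ?invr_ge0 //.
apply: (@le_trans _ _ (k.+1%:R^-1 * \sum_(j < 2 * K * k.+1) (2 * C0 * K%:R * `|y - g|))).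
  apply: ler_wpM2l; first by rewrite invr_ge0.
  apply: le_trans (ler_norm_sum _ _ _) _; apply: ler_sum => j _.
  set t := node K k.+1 j; rewrite !ReE.
  have tK : `|t| <= K%:R by apply: node_bound.
  have -> : hR t * cos (y * t) - hI t * sin (y * t) - (hR t * cos (g * t) - hI t * sin (g * t)) =
    hR t * (cos (y * t) - cos (g * t)) - hI t * (sin (y * t) - sin (g * t)) by ring.
  have e : `|y * t - g * t| <= K%:R * `|y - g| by rewrite -mulrBl normrM mulrC ler_wpM2r.
  have lc := le_trans (cos_lipschitz (y * t) (g * t)) e.
  have ls := le_trans (sin_lipschitz (y * t) (g * t)) e.
  apply: le_trans (ler_normB _ _) _; rewrite !normrM -!mulrA [2 * _]mulr_natl mulr2n.
  by apply: lerD; apply: ler_pM => //; [exact: (hC0 t).1|exact: (hC0 t).2].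
rewrite sumr_const card_ord -[_ *+ (2 * K * k.+1)%N]mulr_natl !natrM.
have N0 : k.+1%:R != 0 :> R by rewrite pnatr_eq0.
by rewrite le_eqVlt; apply/orP; left; apply/eqP; move: (k.+1%:R) N0 => z z0; field.
Qed.

Lemma rsum_limit g e : 0 < e -> exists2 d : R, 0 < d & \forall k \near \oo,
  forall y, `|y - g| <= d -> `|complex.Re (rsum h K k y) - complex.Re (fourier h g)| <= e.
Proof.
move=> e0; have [C C0 hC] := rsum_dist; have [L L0 hL] := rsum_lipschitz.
have L1 : 0 < 2 * (L + 1) by rewrite mulr_gt0 // ltr_wpDl.
exists (e / (2 * (L + 1))); first exact: divr_gt0.
near=> k => y yd.
rewrite -(subrKA (complex.Re (rsum h K k g))).
apply: le_trans (ler_normD _ _) _; rewrite (splitr e); apply: lerD.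
  apply: le_trans (hL _ _ _) _.
  apply: (@le_trans _ _ ((L + 1) * (e / (2 * (L + 1))))).
    by apply: ler_pM => //; rewrite lerDl.
  rewrite le_eqVlt; apply/orP; left; apply/eqP; field.
  by rewrite gt_eqF // ltr_wpDl.
rewrite distrC; apply: le_trans (hC _ _) _.
have : C * (1 + `|g|) / (e / 2) <= k%:R by near: k; exact: nbhs_infty_ger.
rewrite ler_pdivrMr ?divr_gt0 // => h1; rewrite ler_pdivrMr ?ltr0n //.
apply: le_trans h1 _; rewrite mulrC; apply: ler_wpM2l; first by rewrite divr_ge0 // ltW.
by rewrite ler_nat.
Unshelve. all: end_near. Qed.

Lemma iter_bdiff_support (d : R) i t : 0 <= d <= 1 -> K%:R - 5 + i%:R <= `|t| ->
  iter i (bdiff d) h t = 0.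
Proof.
move=> /andP[d0 d1]; elim: i t => [|i IH] t ti; first by apply: hK; rewrite addr0 in ti.
rewrite iterS /bdiff IH ?sub0r; last by apply: le_trans ti; rewrite lerD2l ler_nat.
rewrite IH ?oppr0 //; have := lerB_dist t d; rewrite (ger0_norm d0) => h1.
by apply: le_trans h1; move: ti; rewrite -natr1; lra.
Qed.

Lemma iter_bdiff_ReIm (d : R) i t :
  iter i (bdiff d) h t = iter i (bdiff d) hR t +i* iter i (bdiff d) hI t.
Proof.
elim: i t => [|i IH] t; first by rewrite /= /hR /hI; case: (h t).
by rewrite !iterS /bdiff !IH.
Qed.

(** Four summations by parts multiply the sum by [(1 - w)^4] and replace [h] by its fourth
    difference, of size [N^-4]. For [|y| <= pi N], [|1 - w|] is at least a multiple of [|y| / N], so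
    the powers of [N] cancel and a bound for [y^4 r] remains. *)
Lemma rsum_decay : exists2 Bf, 0 <= Bf & forall k y, `|y| <= pi * k.+1%:R ->
  `|complex.Re (rsum h K k y)| <= Bf * (1 + y ^+ 2)^-1 ^+ 2.
Proof.
have [C0 C00 hC0] := derive_bounds 0; have [C4 C40 hC4] := derive_bounds 4.
have [kk kk0 kkP] := one_sub_cos_ge R.
have K0 : 0 <= K%:R :> R by [].
have A0 : 0 <= 4 * K%:R * C0 by rewrite !mulr_ge0.
have A4 : 0 <= K%:R * C4 / kk ^+ 2 by rewrite divr_ge0 ?exprn_ge0 ?mulr_ge0 // ltW.
exists (2 * (4 * K%:R * C0 + K%:R * C4 / kk ^+ 2)); first by rewrite mulr_ge0 // addr_ge0.
move=> k y yk; set N := k.+1; have N0 : (0 < N)%N by [].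
have Nr : 0 < N%:R :> R by rewrite ltr0n.
have Ni : 0 < N%:R^-1 :> R by rewrite invr_gt0.
pose w := cis (y / N%:R).
pose S i := \sum_(j < 2 * K * N) iter i (bdiff N%:R^-1) h (node K N j) * w ^+ j.
have Sstep i : (i < 4)%N -> (1 - w) * S i = S i.+1.
  move=> i4; apply: diff_shift => // t tK; apply: iter_bdiff_support.
    by rewrite ltW //= invf_le1 // ler1n.
  apply: le_trans tK; rewrite -lerBrDl; apply: (@le_trans _ _ 4); last lra.
  by rewrite ler_nat ltnW.
have S4 : (1 - w) ^+ 4 * S 0%N = S 4%N.
  by rewrite -(Sstep 3%N) // -(Sstep 2%N) // -(Sstep 1%N) // -(Sstep 0%N) //; ring.
have nS i C : (forall t, `|derive1n i hR t| <= C /\ `|derive1n i hI t| <= C) ->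
    nrm (S i) <= (2 * K%:R * N%:R) * (2 * (N%:R^-1 ^+ i * C)).
  move=> hC; apply: le_trans (nrm_sum _ _ _) _.
  apply: (@le_trans _ _ (\sum_(j < 2 * K * N) 2 * (N%:R^-1 ^+ i * C))).
    apply: ler_sum => j _; rewrite Normc.normcM.
    have -> : nrm (w ^+ j) = 1 by rewrite -cis_natr nrm_cis.
    rewrite mulr1 iter_bdiff_ReIm; apply: le_trans (normc_le_ReIm _) _ => /=.
    rewrite mulr_natl mulr2n; apply: lerD; apply: iter_bdiff_bound.
    - exact: smooth_Re. - exact: ltW. - by move=> t; case: (hC t).
    - exact: smooth_Im. - exact: ltW. - by move=> t; case: (hC t).
  by rewrite sumr_const card_ord -[_ *+ (2 * K * N)%N]mulr_natl !natrM.
have rS : nrm (rsum h K k y) = N%:R^-1 * nrm (S 0%N).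
  rewrite /rsum Normc.normcM; congr (_ * _).
    by rewrite nrmE nsq_real sqrtr_sqr ger0_norm // ltW.
  have -> : \sum_(j < 2 * K * k.+1) h (node K k.+1 j) * cis (y * node K k.+1 j) =
      cis (- (y * K%:R)) * S 0%N.
    rewrite /S big_distrr /=; apply: eq_bigr => j _.
    rewrite mulrCA -cis_natr -cisD; congr (_ * cis _); rewrite /node -/N; ring.
  by rewrite Normc.normcM nrm_cis mul1r.
set r := nrm (rsum h K k y) in rS.
have r1 : r <= 4 * K%:R * C0.
  rewrite rS; have := nS 0%N C0 hC0; rewrite expr0 mul1r => h0.
  apply: le_trans (ler_wpM2l (ltW Ni) h0) _.
  by rewrite le_eqVlt; apply/orP; left; apply/eqP; field; rewrite gt_eqF.
have w2 : 2 * kk * (y / N%:R) ^+ 2 <= nrm (1 - w) ^+ 2.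
  rewrite nrm_sqr; have := kkP (y / N%:R).
  have -> : nsq (1 - w) = 2 * (1 - cos (y / N%:R)).
    by have := cos2Dsin2 (y / N%:R); rewrite /nsq /= !sub0r sqrrN sqrrB expr1n; lra.
  have p0 := pi_gt0 R => /(_ _) h1; rewrite -mulrA; apply: ler_wpM2l => //; apply: h1.
  rewrite normrM (ger0_norm (ltW Ni)) ler_pdivrMr //; apply: le_trans yk _.
  by rewrite -/N; apply: ler_wpM2r => //; lra.
have r4 : y ^+ 4 * r <= K%:R * C4 / kk ^+ 2.
  have h4 := nS 4%N C4 hC4; rewrite -S4 Normc.normcM in h4.
  have e4 : nrm ((1 - w) ^+ 4) = (nrm (1 - w) ^+ 2) ^+ 2.
    by rewrite -exprM !exprS expr0 !mulr1 !Normc.normcM.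
  rewrite e4 in h4.
  have q0 : 0 <= 2 * kk * (y / N%:R) ^+ 2 by rewrite mulr_ge0 ?sqr_ge0 // mulr_ge0 // ltW.
  have w4 : (2 * kk * (y / N%:R) ^+ 2) ^+ 2 <= (nrm (1 - w) ^+ 2) ^+ 2.
    by rewrite ler_sqr ?nnegrE ?sqr_ge0.
  have := le_trans (ler_wpM2r (nrm_ge0 (S 0%N)) w4) h4.
  have -> : (2 * kk * (y / N%:R) ^+ 2) ^+ 2 * nrm (S 0%N) =
     4 * kk ^+ 2 / N%:R ^+ 3 * (y ^+ 4 * r).
    by rewrite rS; field; rewrite gt_eqF.
  have -> : 2 * K%:R * N%:R * (2 * (N%:R^-1 ^+ 4 * C4)) = 4 * kk ^+ 2 / N%:R ^+ 3 * (K%:R * C4 / kk ^+ 2).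
    by field; rewrite !gt_eqF.
  by rewrite ler_pM2l // divr_gt0 ?exprn_gt0 // mulr_gt0 // exprn_gt0.
have hRe : `|complex.Re (rsum h K k y)| <= r by exact: Re_le_normc.
apply: (le_trans hRe).
have y0 : 0 < 1 + y ^+ 2 by rewrite ltr_pwDl // sqr_ge0.
rewrite exprVn ler_pdivlMr ?exprn_gt0 //.
have r0 : 0 <= r by exact: nrm_ge0.
have yy : (1 + y ^+ 2) ^+ 2 <= 2 * (1 + y ^+ 4).
  by have := sqr_ge0 (1 - y ^+ 2); nra.
apply: le_trans (ler_wpM2l r0 yy) _.
have -> : r * (2 * (1 + y ^+ 4)) = 2 * (r + y ^+ 4 * r) by ring.
by apply: ler_wpM2l => //; exact: lerD.
Qed.

(** The bound for the Riemann sums has a constant free of [k] and covers any given [y] once [k] is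
    large, so it passes to the limit. *)
Lemma fourier_decays : decays 2 (fun y => complex.Re (fourier h y)).
Proof.
have [Bf Bf0 hB] := rsum_decay; exists Bf => y.
apply/ler_addgt0Pr => e e0; have [d d0 hd] := rsum_limit y e0.
near \oo => k.
have h1 : forall y', `|y' - y| <= d ->
   `|complex.Re (rsum h K k y') - complex.Re (fourier h y)| <= e by near: k.
have yk : `|y| <= pi * k.+1%:R.
  apply: (@le_trans _ _ k%:R); first by near: k; exact: nbhs_infty_ger.
  rewrite -[leLHS]mul1r; apply: ler_pM => //; last by rewrite ler_nat.
  by apply: le_trans (pi_ge2 R); rewrite ler1n.
have := h1 y; rewrite subrr normr0 => /(_ (ltW d0)); rewrite distrC => h2.
rewrite -[X in `|X|](subrK (complex.Re (rsum h K k y))) addrC.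
apply: le_trans (ler_normD _ _) _; apply: lerD; [exact: hB|exact: h2].
Unshelve. all: end_near. Qed.

End Fixed.
End FourierApprox.

(** * The Fourier transform of the zero measure *)

Section PowerSums.
Variables (R : realType) (n : nat).
Implicit Types (h : R -> R[i]) (y t : R) (m : mpoly.multinom n) (a : 'I_n -> nat).
Local Arguments conjc : simpl never.

Definition mbox (B : nat) : seq (mpoly.multinom n) :=
  [seq mpoly.Multinom [tuple (f i : nat) | i < n] | f : {ffun 'I_n -> 'I_B}].

Lemma mbox_uniq B : uniq (mbox B).
Proof.
rewrite /mbox /image_mem map_inj_uniq ?enum_uniq // => f g /mpoly.mnmP fg.
by apply/ffunP => i; apply: val_inj; have := fg i; rewrite !mpoly.mnmE.
Qed.

Lemma mem_mbox B m : (m \in mbox B) = [forall j, m j < B]%N.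
Proof.
apply/idP/forallP => [/mapP[f _ ->] j|mB]; first by rewrite mpoly.mnmE.
apply/mapP; exists [ffun j => Ordinal (mB j)]; first by rewrite mem_enum.
by apply/mpoly.mnmP => j; rewrite mpoly.mnmE ffunE.
Qed.

Lemma cisN x : cis (- x) = conjc (cis x) :> R[i].
Proof. by rewrite /cis cosN sinN. Qed.

Lemma sum_by_weight a (c : mpoly.multinom n -> R[i]) (v : nat -> R[i]) J
    (s : seq (mpoly.multinom n)) :
  (forall i, (J < i)%N -> v i = 0) ->
  \sum_(i < J) v i.+1 * (i.+1%:R * \sum_(m <- s | wt a m == i.+1) c m) =
  \sum_(m <- s) (wt a m)%:R * (v (wt a m) * c m).
Proof.
move=> vJ; under eq_bigr do rewrite !big_distrr /=.
rewrite (exchange_big_dep predT) //=; apply: eq_bigr => m _.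
case E : (wt a m) => [|w]; first by rewrite mul0r big1.
have [wJ|Jw] := ltnP w J.
  rewrite (big_pred1 (Ordinal wJ)); first by rewrite mulrCA.
  by move=> i; rewrite /= eqSS -val_eqE eq_sym.
rewrite vJ // mul0r mulr0 big1 // => i /eqP [wi].
by have := ltn_ord i; rewrite -wi ltnNge Jw.
Qed.

Lemma rsum_split h K k y : (forall t, K%:R <= `|t| -> h t = 0) ->
  rsum h K k y = (k.+1%:R^-1)%:C * (h 0 + \sum_(i < K * k.+1)
    (h (i.+1%:R / k.+1%:R) * cis (y / k.+1%:R) ^+ i.+1 +
     h (- (i.+1%:R / k.+1%:R)) * conjc (cis (y / k.+1%:R)) ^+ i.+1)).
Proof.
move=> hK; congr (_ * _); set N := k.+1; set J := (K * N)%N.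
have Nr : N%:R != 0 :> R by rewrite pnatr_eq0.
have node_add i : node R K N (J + i) = i%:R / N%:R.
  by rewrite /node natrD /J natrM; field.
have node_sub i : (i <= J)%N -> node R K N (J - i) = - (i%:R / N%:R).
  by move=> iJ; rewrite /node natrB // /J natrM; field.
pose G j := h (node R K N j) * cis (y * node R K N j).
rewrite -(big_mkord xpredT G) (_ : 2 * K * N = J + J)%N; last by rewrite -mulnA mul2n -addnn.
rewrite (big_cat_nat (n := J)) ?leq_addr //= addrC big_split /= addrA; congr (_ + _).
  rewrite -{1}[J]add0n big_addn addnK; under eq_bigr do rewrite addnC.
  (* The node [K] is missing from the right half, but [h] vanishes there; adding it makes the halves
     symmetric around the node 0. *)
  have e : \sum_(0 <= i < J.+1) G (J + i)%N = \sum_(0 <= i < J) G (J + i)%N.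
    rewrite big_nat_recr //= [G (J + J)%N](_ : _ = 0) ?addr0 //.
    rewrite /G hK ?mul0r // node_add /J natrM mulfK // ger0_norm //.
  rewrite -e big_nat_recl //; congr (_ + _).
    by rewrite /G node_add mul0r mulr0 cis0 mulr1.
  rewrite big_mkord; apply: eq_bigr => i _; rewrite /G node_add -cis_natr.
  by congr (_ * cis _); rewrite mulrCA.
rewrite big_nat_rev /= big_mkord; apply: eq_bigr => i _.
rewrite add0n /G node_sub // -cisN -cis_natr.
congr (_ * cis _).
by rewrite !mulrN mulrCA.
Qed.

Section Identity.
Variables (P Q : mpoly.mpoly n R[i]) (ell : 'I_n -> nat) (eta : R[i]).
Hypotheses (Ps : stable P) (Qs : stable Q) (PQ : reciprocal P Q ell eta).
Variable xi : 'I_n -> R.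
Hypothesis xi_gt0 : forall j, 0 < xi j.

Definition box_bound (x : R) : nat := (\sum_j (Num.truncn (x / xi j)).+1)%N.

Lemma mem_mbox_bound x B m : (box_bound x <= B)%N -> wtR xi m <= x -> m \in mbox B.
Proof.
move=> xB mx; rewrite mem_mbox; apply/forallP => j; apply: leq_trans xB.
apply: (@leq_trans (Num.truncn (x / xi j)).+1); last by rewrite /box_bound (bigD1 j) //= leq_addr.
rewrite -(ltr_nat R); apply: le_lt_trans (truncnS_gt _); rewrite ler_pdivlMr //.
apply: le_trans mx; rewrite /wtR (bigD1 j) //= lerDl sumr_ge0 // => i _.
by rewrite mulr_ge0 // ltW.
Qed.

Lemma wtR_ge0 m : 0 <= wtR xi m.
Proof. by apply: sumr_ge0 => j _; rewrite mulr_ge0 // ltW. Qed.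

Lemma wtR_apx_le N m : (0 < N)%N -> wtR xi m * N%:R <= (wt (apx xi N) m)%:R.
Proof.
move=> N0; rewrite /wtR /wt natr_sum big_distrl /=; apply: ler_sum => j _.
by rewrite natrM -mulrA; apply: ler_wpM2l => //; apply/ltW/truncnS_gt.
Qed.

(** Positive nodes give power sums, which are sums of [logc] by weight; negative nodes give their
    conjugates, since each [cis (y / N)] is unimodular. Monomials of the box with weight above
    [K * N] contribute 0, because [h] vanishes there. *)
Lemma azeros_rsum h K k B : (forall t, K%:R <= `|t| -> h t = 0) ->
  (box_bound K%:R <= B)%N ->
  \sum_(y <- azeros P ell xi k (fun=> 0)) rsum h K k y =
  (k.+1%:R^-1)%:C * ((size (azeros P ell xi k (fun=> 0)))%:R * h 0 -
    \sum_(m <- mbox B) (wt (apx xi k.+1) m)%:R *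
      (h ((wt (apx xi k.+1) m)%:R / k.+1%:R) * logc P m +
       h (- ((wt (apx xi k.+1) m)%:R / k.+1%:R)) * conjc (logc P m))).
Proof.
move=> hK KB; have [_ _] := azerosP Ps Qs PQ xi k (fun=> 0).
set ys := azeros _ _ _ _ _; set N := k.+1; set a := apx xi N => e.
have Nr : 0 < N%:R :> R by rewrite ltr0n.
have {}e : upoly (fun=> 1) a P =
    const_coef P *: \prod_(z <- [seq cis (y / N%:R) | y <- ys]) (1 - z *: 'X).
  by rewrite big_map -e; congr upoly; apply/funext => j; rewrite cis0.
have ps i : (0 < i <= K * N)%N -> \sum_(y <- ys) cis (y / N%:R) ^+ i =
    - (i%:R * \sum_(m <- mbox B | wt a m == i) logc P m).
  move=> /andP[i0 iK]; rewrite -(power_sum_logc _ _ e) ?big_map ?mbox_uniq //.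
    exact: (const_coef_neq0 Ps).
  move=> m mi; apply: (mem_mbox_bound KB); rewrite -(ler_pM2r Nr) -natrM.
  by apply: le_trans (wtR_apx_le _ _) _ => //; rewrite -/a mi ler_nat.
under eq_bigr do rewrite rsum_split //.
rewrite -big_distrr /=; congr (_ * _); rewrite big_split /= big_const_seq count_predT iter_addr addr0.
congr (_ + _); first by rewrite mulr_natl.
rewrite exchange_big /=.
under eq_bigr => i _.
  rewrite big_split /= -!big_distrr /=.
  under [X in _ + _ * X]eq_bigr do rewrite -rmorphXn.
  rewrite -rmorph_sum /= ps ?ltn_ord // rmorphN rmorphM rmorph_nat rmorph_sum /= !mulrN -opprD.
  over.
rewrite sumrN big_split /=; congr (- _).
rewrite (@sum_by_weight _ _ (fun i => h (i%:R / N%:R))); last first.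
  move=> i iJ; apply: hK; rewrite ger0_norm ?divr_ge0 // ler_pdivlMr // -natrM ler_nat.
  exact: ltnW.
rewrite (@sum_by_weight _ (fun m => conjc (logc P m)) (fun i => h (- (i%:R / N%:R)))); last first.
  move=> i iJ; apply: hK; rewrite normrN ger0_norm ?divr_ge0 // ler_pdivlMr // -natrM ler_nat.
  exact: ltnW.
by rewrite -big_split /=; apply: eq_bigr => m _; rewrite mulrDr.
Qed.

Lemma cRe_natl (k : nat) (z : R[i]) : complex.Re (k%:R * z) = k%:R * complex.Re z.
Proof. by rewrite -(rmorph_nat (real_complex R)) cReM /= mul0r subr0. Qed.

Lemma cRe_continuous h (c : R[i]) : smooth h -> continuous (fun x => complex.Re (h x * c)).
Proof.
move=> hs x; under eq_fun do rewrite cReM.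
have cR := @rsmooth_continuous R _ 0 (smooth_Re hs).
have cI := @rsmooth_continuous R _ 0 (smooth_Im hs).
by apply: cvgB; apply: cvgM; [exact: cR|exact: cvg_cst|exact: cI|exact: cvg_cst].
Qed.

(** This is [2 pi] times the mean density of the zeros: an approximant has [\sum_j ell j * a j]
    zeros in an interval of length [2 pi N], and [a j / N] tends to [xi j]. *)
Definition mean_weight : R := \sum_j (ell j)%:R * xi j.

(** One box [B] serves all [k], so the right-hand side of [azeros_rsum] is a sum over a fixed list
    and converges term by term, while the left-hand side converges by [azeros_cvg]. *)
Lemma zero_pairing_Re h K B : smooth h -> (forall t, K%:R - 5 <= `|t| -> h t = 0) ->
  (box_bound K%:R <= B)%N ->
  zero_pairing P xi (fun=> 0) (fun y => complex.Re (fourier h y)) =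
  mean_weight * complex.Re (h 0) - \sum_(m <- mbox B) wtR xi m *
    (complex.Re (h (wtR xi m) * logc P m) + complex.Re (h (- wtR xi m) * conjc (logc P m))).
Proof.
move=> hs hK KB.
have [Bf Bf0 hB] := rsum_decay hs hK.
have hK0 t : K%:R <= `|t| -> h t = 0.
  by move=> tK; apply: hK; apply: le_trans tK; rewrite lerBlDr lerDl.
have Kinf (M : nat) : \forall k \near \oo, (M <= (k : nat))%N by exact: nbhs_infty_ge.
have c1 := @azeros_cvg _ _ _ _ _ _ Ps Qs PQ _ xi_gt0 nat \oo _ id (fun _ _ => 0) (fun=> 0)
  (fun y => complex.Re (fourier h y)) (fun k y => complex.Re (rsum h K k y)) Bf Kinf
  (fun j => cvg_cst _) (fourier_decays hs hK).
have nb : \forall k \near \oo, {in azeros P ell xi k (fun=> 0), forall y,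
    `|complex.Re (rsum h K k y)| <= Bf * (1 + y ^+ 2)^-1 ^+ 2}.
  apply: nearW => k y; have [h1 _ _] := azerosP Ps Qs PQ xi k (fun=> 0).
  by move=> /h1 yk; apply: hB.
have {}c1 := c1 _ _ nb (rsum_limit hs hK).
have wcvg m : (wt (apx xi k.+1) m)%:R / k.+1%:R @[k --> \oo] --> wtR xi m.
  rewrite [X in X k @[k --> _]](_ : _ = fun k => wtR (fun j => (apx xi k.+1 j)%:R / k.+1%:R) m).
    by apply: cvg_wtR => j; exact: (apx_cvg xi_gt0 Kinf).
  apply/funext => k; rewrite /wtR /wt natr_sum big_distrl /=.
  by apply: eq_bigr => j _; rewrite natrM mulrA.
have szc := azeros_size_cvg Ps Qs PQ xi_gt0 (fun (_ : nat) (_ : 'I_n) => 0) Kinf.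
rewrite -(cvg_lim (@Rhausdorff R) (c1 _ _)); apply: (cvg_lim (@Rhausdorff R)).
rewrite [X in X k @[k --> _]](_ : _ = fun k =>
  (size (azeros P ell xi k (fun=> 0)))%:R / k.+1%:R * complex.Re (h 0) -
  \sum_(m <- mbox B) (wt (apx xi k.+1) m)%:R / k.+1%:R *
   (complex.Re (h ((wt (apx xi k.+1) m)%:R / k.+1%:R) * logc P m) +
    complex.Re (h (- ((wt (apx xi k.+1) m)%:R / k.+1%:R)) * conjc (logc P m)))).
  apply: cvgB; first by apply: cvgM; [exact: szc|exact: cvg_cst].
  apply: (@cvg_big _ _ +%R 0); first exact: add_continuous.
  move=> m _; apply: cvgM; first exact: wcvg.
  apply: cvgD.
    apply: (cvg_comp _ (fun x => complex.Re (h x * logc P m)) (wcvg m)).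
    exact: cRe_continuous.
  apply: (cvg_comp _ (fun x => complex.Re (h (- x) * conjc (logc P m))) (wcvg m)).
  apply: (@continuous_comp _ _ _ -%R (fun x => complex.Re (h x * conjc (logc P m)))).
    exact: opp_continuous.
  exact: cRe_continuous.
apply/funext => k; rewrite -cRe_sum (azeros_rsum k hK0 KB) cReM /= mul0r subr0.
rewrite cReD raddfN /= cRe_natl cRe_sum mulrBr mulrA; congr (_ * _ - _).
  by rewrite mulrC.
rewrite big_distrr /=; apply: eq_bigr => m _.
by rewrite cRe_natl cReD mulrCA mulrA.
Qed.

Lemma box_bound_le (x y : R) : x <= y -> (box_bound x <= box_bound y)%N.
Proof.
move=> xy; apply: leq_sum => j _; rewrite ltnS; apply: le_truncn.
by apply: ler_wpM2r => //; rewrite invr_ge0 ltW.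
Qed.

Lemma level_sum (F : mpoly.multinom n -> R[i]) (x : R) B : (box_bound x <= B)%N ->
  \sum_(m <- mbox (box_bound x) | wtR xi m == x) F m = \sum_(m <- mbox B | wtR xi m == x) F m.
Proof.
move=> xB; rewrite -big_filter -[RHS]big_filter; apply: perm_big; apply: uniq_perm.
- by rewrite filter_uniq // mbox_uniq.
- by rewrite filter_uniq // mbox_uniq.
move=> m; rewrite !mem_filter; case: eqP => //= e.
by rewrite !(@mem_mbox_bound x) ?e.
Qed.

Definition spectrum : set R := [set t | exists m, `|t| = wtR xi m].

(** Monomials of equal frequency, possible when the [xi j] are rationally dependent, are added up;
    the box contains all those of weight [|t|]. The factor [|t|] is the limit of the index of the
    power sum divided by [N]. *)
Definition spec_coef (t : R) : R[i] :=
  (if t == 0 then mean_weight%:C else 0) - `|t|%:C *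
  \sum_(m <- mbox (box_bound `|t|) | wtR xi m == `|t|)
    (if 0 <= t then logc P m else conjc (logc P m)).

Lemma spectrum_lf : locally_finite spectrum.
Proof.
move=> x y; pose B := box_bound (`|x| + `|y|).
apply: (sub_finite_set (B := [set` ([seq wtR xi m | m <- mbox B] ++ [seq - wtR xi m | m <- mbox B])])); last first.
  exact: finite_seq.
move=> t [[m tm]] /=; rewrite in_itv /= => /andP[xt ty].
have mB : m \in mbox B.
  apply: (mem_mbox_bound (x := `|x| + `|y|)) => //; rewrite -tm ler_norml.
  have := ler_norm y; have := ler_norm (- x); rewrite normrN => h1 h2.
  by have := normr_ge0 x; have := normr_ge0 y => h3 h4; apply/andP; split; lra.
rewrite mem_cat; have [t0|t0] := leP 0 t.
  by apply/orP; left; apply/mapP; exists m => //; rewrite -tm ger0_norm.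
by apply/orP; right; apply/mapP; exists m => //; rewrite -tm ltr0_norm // opprK.
Qed.

(** [V] holds the frequencies of the box with both signs; it contains the whole spectrum in
    [[- K, K]], and [h] removes the rest. Each nonconstant monomial of the box then meets exactly
    two points of [V]. *)
Lemma point_masses_spectrum h K B : (forall t, K%:R <= `|t| -> h t = 0) ->
  (box_bound K%:R <= B)%N ->
  \sum_(t \in spectrum) (spec_coef t * h t) = mean_weight%:C * h 0 -
    \sum_(m <- mbox B) (wtR xi m)%:C *
      (h (wtR xi m) * logc P m + h (- wtR xi m) * conjc (logc P m)).
Proof.
move=> hK KB.
pose V := undup ([seq wtR xi m | m <- mbox B] ++ [seq - wtR xi m | m <- mbox B]).
have VP t : (t \in V) = [exists s : bool, has (fun m => t == (-1) ^+ s * wtR xi m) (mbox B)].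
  rewrite mem_undup mem_cat; apply/orP/existsP => [[]/mapP[m mB ->]|[[] /hasP[m mB /eqP ->]]].
  - by exists false; apply/hasP; exists m => //; rewrite mul1r.
  - by exists true; apply/hasP; exists m => //; rewrite mulN1r.
  - by right; apply/mapP; exists m => //; rewrite mulN1r.
  - by left; apply/mapP; exists m => //; rewrite mul1r.
have mV m : m \in mbox B -> (wtR xi m \in V) * (- wtR xi m \in V).
  move=> mB; split; rewrite mem_undup mem_cat; apply/orP; [left|right];
  by apply/mapP; exists m.
have VS t : t \in V -> spectrum t.
  rewrite VP => /existsP[s /hasP[m _ /eqP ->]]; exists m.
  by rewrite normrM normrX normrN1 expr1n mul1r ger0_norm // wtR_ge0.
have big t m : `|t| = wtR xi m -> t \notin V -> K%:R < `|t|.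
  move=> tm tV; rewrite ltNge; apply/negP => tK.
  have mB : m \in mbox B by apply: (mem_mbox_bound KB); rewrite -tm.
  have [h1 h2] := mV m mB; move: tV h1 h2; rewrite -tm.
  by have [t0|t0] := leP 0 t; rewrite ?(ger0_norm t0) ?(ltr0_norm t0) ?opprK => /negPf ->.
rewrite -(@fsbig_widen _ _ _ _ [set` V]); first last.
- move=> t [[m tm] /= /negP tV]; rewrite hK ?mulr0 //.
  exact/ltW/(big t m).
- by move=> t /VS.
rewrite -fsbig_seq ?undup_uniq //.
have V0 : 0 \in V.
  rewrite -(@wtR0 _ _ xi); apply: (mV mpoly.mnm0 _).1.
  by apply: (mem_mbox_bound KB); rewrite wtR0.
have e t : spec_coef t * h t = (if t == 0 then mean_weight%:C * h 0 else 0) -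
   \sum_(m <- mbox B | wtR xi m == `|t|)
      `|t|%:C * ((if 0 <= t then logc P m else conjc (logc P m)) * h t).
  have [tK|Kt] := ltP `|t| K%:R; last first.
    rewrite hK // mulr0 big1 ?subr0; last by move=> m _; rewrite mulr0 mulr0.
    by case: eqP => // t0; rewrite -t0 hK ?mulr0.
  rewrite /spec_coef mulrBl; congr (_ - _); first by case: eqP => [->//|_]; rewrite mul0r.
  rewrite (level_sum _ (B := B)); last first.
    by apply: leq_trans KB; apply: box_bound_le; exact: ltW.
  by rewrite -mulrA big_distrl big_distrr.
rewrite (eq_bigr _ (fun t _ => e t)) sumrB; congr (_ - _).
  rewrite (bigD1_seq 0) ?undup_uniq //= eqxx big1 ?addr0 // => t /negPf -> //.
rewrite (exchange_big_dep predT) //=; apply: eq_big_seq => m mB.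
have [w0|w0] := eqVneq (wtR xi m) 0.
  by rewrite w0 mul0r big1 // => t /eqP <-; rewrite mul0r.
have wp : 0 < wtR xi m by rewrite lt_neqAle eq_sym w0 wtR_ge0.
rewrite -big_filter (perm_big [:: wtR xi m; - wtR xi m]) /=; last first.
  apply: uniq_perm.
  - by rewrite filter_uniq // undup_uniq.
  - by rewrite /= inE andbT -subr_eq0 opprK gt_eqF // addr_gt0.
  move=> t; rewrite mem_filter !inE; apply/andP/orP => [[/eqP wt _]|].
    by have [t0|t0] := leP 0 t; rewrite wt ?(ger0_norm t0) ?(ltr0_norm t0) ?opprK eqxx; [left|right].
  have [h1 h2] := mV m mB.
  by case=> /eqP ->; rewrite ?normrN gtr0_norm.
rewrite !big_cons big_nil addr0 normrN gtr0_norm // (ltW wp) oppr_ge0 leNgt wp /= -mulrDr.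
by congr (_ * (_ + _)); rewrite mulrC.
Qed.

Lemma sum_inv_sqr_le (x : R) B : 0 < x ->
  \sum_(i < B) (1 + x ^+ 2 * i%:R ^+ 2)^-1 <= 1 + 2 / x ^+ 2.
Proof.
move=> x0; have X0 : 0 < x ^+ 2 by rewrite exprn_gt0.
have pos i : 0 < 1 + x ^+ 2 * i%:R ^+ 2 by rewrite ltr_pwDl // mulr_ge0 // sqr_ge0.
(* The term [- B.+1%:R^-1] makes the induction work: its increment [1 / (b (b + 1))], divided by
   [x^2], dominates the next summand. *)
suff h : \sum_(i < B.+2) (1 + x ^+ 2 * i%:R ^+ 2)^-1 <= 1 + (2 - B.+1%:R^-1) / x ^+ 2.
  apply: (@le_trans _ _ (\sum_(i < B.+2) (1 + x ^+ 2 * i%:R ^+ 2)^-1)).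
    by rewrite !big_ord_recr /= -addrA lerDl addr_ge0 // invr_ge0 ltW.
  apply: le_trans h _; rewrite lerD2l; apply: ler_wpM2r; first by rewrite invr_ge0 ltW.
  by rewrite gerBl invr_ge0.
elim: B => [|B IH].
  rewrite !big_ord_recl big_ord0 addr0 expr0n mulr0 addr0 !invr1 lerD2l.
  have -> : 2 - 1 = 1 :> R by ring.
  by rewrite mul1r expr1n mulr1 lef_pV2 ?posrE ?lerDr // addr_gt0.
rewrite big_ord_recr /=; apply: le_trans (lerD IH (lexx _)) _.
rewrite -addrA lerD2l -lerBrDl -mulrBl.
have b0 : 0 < B.+1%:R :> R by rewrite ltr0n.
have := pos B.+2; rewrite -[B.+2%:R]natr1; move: (B.+1%:R) b0 => b b0 p2.
have b1 : 0 < b + 1 by rewrite addr_gt0.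
have -> : 2 - (b + 1)^-1 - (2 - b^-1) = (b * (b + 1))^-1 by field; rewrite !gt_eqF.
have p1 : 0 < b * (b + 1) * x ^+ 2 by rewrite !mulr_gt0.
rewrite -invfM lef_pV2 ?posrE // mulrC -subr_ge0.
have -> : 1 + x ^+ 2 * (b + 1) ^+ 2 - x ^+ 2 * (b * (b + 1)) = 1 + x ^+ 2 * (b + 1) by ring.
by rewrite addr_ge0 // mulr_ge0 // ltW.
Qed.

(** Since [wtR xi m] is at least each [m j * xi j], one of the [n] equal factors is given to each
    variable, and the sum over the box becomes a product of one-variable sums. *)
Lemma sum_mbox_le B : \sum_(m <- mbox B) (1 + wtR xi m ^+ 2)^-1 ^+ n <=
  \prod_j (1 + 2 / xi j ^+ 2).
Proof.
rewrite /mbox big_image /=.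
apply: (@le_trans _ _ (\prod_j \sum_(i < B) (1 + xi j ^+ 2 * i%:R ^+ 2)^-1)); last first.
  apply: ler_prod => j _; rewrite sum_inv_sqr_le // andbT; apply: sumr_ge0 => i _.
  by rewrite invr_ge0 addr_ge0 // mulr_ge0 // sqr_ge0.
rewrite bigA_distr_bigA /=; apply: ler_sum => f _.
rewrite -[X in _ ^+ X]card_ord -prodr_const; apply: ler_prod => j _.
have w1 : 0 < 1 + wtR xi (mpoly.Multinom [tuple (f i : nat) | i < n]) ^+ 2.
  by rewrite ltr_pwDl // sqr_ge0.
rewrite invr_ge0 (ltW w1) /= lef_pV2 ?posrE //; last first.
  by rewrite ltr_pwDl // mulr_ge0 // sqr_ge0.
rewrite lerD2l -exprMn ler_sqr ?nnegrE ?wtR_ge0 ?mulr_ge0 ?(ltW (xi_gt0 j)) //.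
rewrite /wtR (bigD1 j) //= mpoly.mnmE mulrC lerDl sumr_ge0 // => i _.
by rewrite mulr_ge0 // ltW.
Qed.

(** Of the exponent [n.+1], one factor absorbs [|t|] and [n] are used by [sum_mbox_le]. The outer 2
    counts the two points [t] of a monomial; the rest of the constant is [logc_bound]. *)
Lemma spec_coef_bound (s : seq R) : uniq s ->
  \sum_(t <- s) Normc.normc (spec_coef t) * (1 + t ^+ 2)^-1 ^+ n.+1 <=
  `|mean_weight| + 2 * (2 * \sum_j ell j)%:R * \prod_j (1 + 2 / xi j ^+ 2).
Proof.
move=> us; set L : R := (2 * \sum_j ell j)%:R.
have L0 : 0 <= L by rewrite /L ler0n.
have w0 t : 0 <= (1 + t ^+ 2)^-1 ^+ n.+1 by rewrite exprn_ge0 // invr_ge0 addr_ge0 // sqr_ge0.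
have w1 t : (1 + t ^+ 2)^-1 <= 1 :> R by rewrite invf_le1 ?lerDl ?sqr_ge0 // ltr_pwDl // sqr_ge0.
pose B := (\max_(t <- s) box_bound `|t|)%N.
have nb t m : `|t| = wtR xi m ->
    Normc.normc (`|t|%:C * (if 0 <= t then logc P m else conjc (logc P m))) <= L * `|t|.
  have [m0|m0] := eqVneq m mpoly.mnm0.
    by rewrite m0 wtR0 => ->; rewrite mul0r Normc.normc0 mulr0.
  move=> _; rewrite Normc.normcM [X in X * _]nrmE nsq_real sqrtr_sqr normr_id mulrC.
  apply: ler_wpM2r => //.
  have : Normc.normc (logc P m) <= L.
    by have := logc_bound Ps Qs PQ m0; rewrite -lecR -(rmorph_nat (real_complex R)).
  by case: ifP => // _; case: (logc P m) => a b /=; rewrite sqrrN.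
have h1 t : t \in s -> Normc.normc (spec_coef t) <= (if t == 0 then `|mean_weight| else 0) +
    \sum_(m <- mbox B | wtR xi m == `|t|) L * wtR xi m.
  move=> ts; rewrite /spec_coef (level_sum _ (B := B)); last exact: leq_bigmax_seq.
  apply: le_trans (le_normcD _ _) _; rewrite normcN; apply: lerD.
    case: eqP => _; last by rewrite Normc.normc0.
    by rewrite nrmE nsq_real sqrtr_sqr.
  rewrite big_distrr /=; apply: le_trans (nrm_sum _ _ _) _; apply: ler_sum => m /eqP mt.
  by rewrite mt; exact: nb.
apply: (@le_trans _ _ (\sum_(t <- s) (if t == 0 then `|mean_weight| else 0) +
   \sum_(t <- s) \sum_(m <- mbox B | wtR xi m == `|t|) L * (1 + wtR xi m ^+ 2)^-1 ^+ n)).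
  rewrite -big_split /= !big_seq; apply: ler_sum => t ts.
  apply: le_trans (ler_wpM2r (w0 t) (h1 t ts)) _; rewrite mulrDl; apply: lerD.
    by case: ifP => _; rewrite ?mul0r // ler_piMr // exprn_ile1 // invr_ge0 addr_ge0 // sqr_ge0.
  rewrite big_distrl /=; apply: ler_sum => m /eqP mt; rewrite -mulrA.
  apply: ler_wpM2l => //; rewrite mt real_normK ?num_real // exprS mulrA.
  rewrite -[leRHS]mul1r; apply: ler_wpM2r; first by rewrite exprn_ge0 // invr_ge0 addr_ge0 // sqr_ge0.
  rewrite ler_pdivrMr ?ltr_pwDl ?sqr_ge0 // mul1r.
  by have := real_normK (num_real t); have := sqr_ge0 (1 - `|t|); nra.
apply: lerD.
  have [s0|s0] := boolP (0 \in s).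
    by rewrite (bigD1_seq 0) //= eqxx big1 ?addr0 // => t /negPf ->.
  by rewrite big1_seq // => t /= ts; case: eqP => // t0; move: s0; rewrite -t0 ts.
rewrite (exchange_big_dep predT) //=.
rewrite -[2 * L * _]mulrA mulrCA.
apply: le_trans (ler_wpM2l L0 (ler_wpM2l (ltW (ltr0Sn R 1)) (sum_mbox_le B))).
rewrite !big_distrr /=; apply: ler_sum => m _.
rewrite -big_filter big_const_seq count_predT iter_addr addr0 -[_ *+ size _]mulr_natl mulrCA.
apply: ler_wpM2l => //; apply: ler_wpM2r.
  by rewrite exprn_ge0 // invr_ge0 addr_ge0 // sqr_ge0.
rewrite ler_nat.
apply: (@uniq_leq_size _ _ [:: wtR xi m; - wtR xi m]); first by rewrite filter_uniq.
move=> t; rewrite mem_filter !inE => /andP[/eqP -> _].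
by have [t0|t0] := leP 0 t; rewrite ?(ger0_norm t0) ?(ltr0_norm t0) ?opprK eqxx ?orbT.
Qed.

Lemma cRe_realM (x : R) (z : R[i]) : complex.Re (x%:C * z) = x * complex.Re z.
Proof. by rewrite cReM /= mul0r subr0. Qed.

Lemma cIm_realM (x : R) (z : R[i]) : complex.Im (x%:C * z) = x * complex.Im z.
Proof. by rewrite cImM /= mul0r addr0. Qed.

(* [hrot h = - i h] turns imaginary parts into real parts. *)
Let hrot (h : R -> R[i]) t : R[i] := complex.Im (h t) +i* (- complex.Re (h t)).

Lemma rsmoothN (u : R -> R) : rsmooth u -> rsmooth (fun t => - u t).
Proof.
move=> us m; suff -> : derive1n m (fun t => - u t) = fun t => - derive1n m u t.
  by move=> t; apply: derivableN; exact: us.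
elim: m => // m IH; apply/funext => t; rewrite !derive1nS IH !derive1E deriveN //.
Qed.

Lemma zero_functional_fourier h : test_function h ->
  mass_functional (zero_set P xi (fun=> 0)) (fun g => (tmult P xi (fun=> 0) g)%:R) (fourier h) =
  \sum_(t \in spectrum) (spec_coef t * h t).
Proof.
move=> [hs [M hM]].
(* The 5 is the margin that the Riemann sums require. *)
pose K := ((Num.truncn `|M|).+1 + 5)%N.
have MK : M < K%:R - 5.
  rewrite /K natrD addrK; apply: le_lt_trans (truncnS_gt _); exact: ler_norm.
have hK t : K%:R - 5 <= `|t| -> h t = 0 by move=> tK; apply: hM; exact: lt_le_trans tK.
have rs : smooth (hrot h).
  by move=> m t; split; [apply: (smooth_Im hs)|apply: (rsmoothN (smooth_Re hs))].
have rK t : K%:R - 5 <= `|t| -> hrot h t = 0 by move=> /hK; rewrite /hrot => -> /=; rewrite oppr0.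
rewrite (@point_masses_spectrum h K (box_bound K%:R)) //; last first.
  by move=> t tK; apply: hK; apply: le_trans tK; rewrite gerBl.
have eR := zero_pairing_Re hs hK (leqnn _).
have eI := zero_pairing_Re rs rK (leqnn _).
have rotE (z : R[i]) : complex.Re (complex.Im z +i* (- complex.Re z)) = complex.Im z by [].
have rotM (z w : R[i]) : complex.Re ((complex.Im z +i* (- complex.Re z)) * w) = complex.Im (z * w).
  by rewrite cReM cImM /=; ring.
have fI y : complex.Re (fourier (hrot h) y) = complex.Im (fourier h y).
  rewrite !fourier_cis; apply: (congr1 (Rintegral _ setT)); apply/funext => t.
  by rewrite /hrot rotM.
apply/eqP; rewrite eq_complex; apply/andP; split; apply/eqP.
  rewrite {1}/mass_functional [LHS]/= -/(zero_pairing P xi _ _) eR.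
  rewrite cReD raddfN /= cRe_realM cRe_sum; congr (_ - _).
  by apply: eq_bigr => m _; rewrite cRe_realM cReD.
rewrite {1}/mass_functional [LHS]/= -/(zero_pairing P xi _ _).
rewrite [X in zero_pairing _ _ _ X](_ : _ = fun y => complex.Re (fourier (hrot h) y)); last first.
  by apply/funext => y; rewrite fI.
rewrite eI cImD raddfN /= cIm_realM cIm_sum; congr (_ - _).
by apply: eq_bigr => m _; rewrite cIm_realM cImD /hrot !rotM.
Qed.

Let A := zero_set P xi (fun=> 0).
Let a (g : R) : CC R := (tmult P xi (fun=> 0) g)%:R.
Let T : (R -> CC R) -> CC R :=
  mass_functional A (fun g => (tmult P xi (fun=> 0) g)%:R).

Lemma zero_functional_tempered : tempered_distribution T.
Proof.
have [B hB] := zero_mass_bound2 Ps Qs PQ xi_gt0 (fun=> 0).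
by apply: (mass_functional_tempered (zero_set_lf Ps Qs PQ xi_gt0 _) _ hB) => x; rewrite ler0n.
Qed.

Lemma zero_functional_represents : represents T A a.
Proof.
have -> : a = fun x => ((tmult P xi (fun=> 0) x)%:R)%:C.
  by apply/funext => x; rewrite /a -(rmorph_nat (real_complex R)).
by apply: mass_functional_represents; exact: (zero_set_lf Ps Qs PQ xi_gt0).
Qed.

Lemma zero_fourier_pair : discrete_fourier_pair A a spectrum (spec_coef : R -> CC R).
Proof.
split; [exact: (zero_set_lf Ps Qs PQ xi_gt0)|exact: spectrum_lf|exists T; split].
- exact: zero_functional_tempered.
- exact: zero_functional_represents.
- by move=> h ht; exact: zero_functional_fourier.
Qed.

Lemma zero_fourier_quasicrystal : fourier_quasicrystal A a.
Proof.
exists spectrum, spec_coef; split; first exact: zero_fourier_pair.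
  exists T; split; first exact: zero_functional_tempered.
  rewrite (_ : (fun x => `|a x|) = a); first exact: zero_functional_represents.
  by apply/funext => x; rewrite /a normr_nat.
pose w (t : R) : R := Normc.normc (spec_coef t).
have w0 t : 0 <= w t by exact: nrm_ge0.
have hw : forall s : seq R, uniq s -> {in s, forall x, spectrum x} ->
  \sum_(x <- s) w x * (1 + x ^+ 2)^-1 ^+ n.+1 <=
  `|mean_weight| + 2 * (2 * \sum_j ell j)%:R * \prod_j (1 + 2 / xi j ^+ 2).
  by move=> s us _; exact: spec_coef_bound.
exists (mass_functional spectrum w); split.
  exact: (mass_functional_tempered spectrum_lf w0 hw).
by apply: mass_functional_represents; exact: spectrum_lf.
Qed.

End Identity.
End PowerSums.

(** * Almost periodicity *)

Section UltraLimits.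
Variable R : realType.

(** A cluster point of an ultrafilter is its limit: a set or its complement belongs to the
    filter. *)
Lemma ultra_bounded_cvg (I : Type) (Fl : set_system I) (u : I -> R) (a b : R) :
  UltraFilter Fl -> (forall i, a <= u i <= b) -> exists p : R, u i @[i --> Fl] --> p.
Proof.
move=> UF uab; have PF : ProperFilter Fl by exact: ultra_proper.
have [|p [_ pc]] := @segment_compact R a b (u @ Fl) _.
  by apply: (@filterS _ Fl _ setT) => //; [move=> i _ /=; rewrite in_itv /=; exact: uab|exact: filterT].
exists p => U pU; have [//|nU] := in_ultra_setVsetC (u @^-1` U) UF.
have [x [/= xU]] := pc (~` U) U nU pU; by [].
Qed.

End UltraLimits.

(** * Translation, uniform continuity and recurrence on the torus *)

Section AlmostPeriodicity.
Variables (R : realType) (n : nat) (P Q : mpoly.mpoly n R[i]) (ell : 'I_n -> nat) (eta : R[i]).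
Hypotheses (Ps : stable P) (Qs : stable Q) (PQ : reciprocal P Q ell eta).
Variable xi : 'I_n -> R.
Hypothesis xi_gt0 : forall j, 0 < xi j.
Implicit Types (th : 'I_n -> R) (phi : R -> R) (t y g : R).

Lemma tmult_shift th t g : tmult P xi th (g + t) = tmult P xi (fun j => th j - t * xi j) g.
Proof.
rewrite /tmult (_ : tderiv P xi th (g + t) = tderiv P xi (fun j => th j - t * xi j) g) //.
apply/funext => k; apply: eq_bigr => m _; congr (_ * (_ * cis _)).
rewrite mulrDr opprD addrA addrAC; congr (_ - _).
rewrite /wtR big_distrl /= -sumrB; apply: eq_bigr => j _; ring.
Qed.

Lemma cis_periodic x (z : int) : cis (x + z%:~R * (2 * pi)) = cis x :> R[i].
Proof.
have c2 : cis (2 * pi) = 1 :> R[i] by rewrite /cis mulr_natl cos2pi sin2pi.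
rewrite cisD; suff -> : cis (z%:~R * (2 * pi)) = 1 :> R[i] by rewrite mulr1.
case: z => k; first by rewrite cis_natr c2 expr1n.
by rewrite NegzE rmorphN mulNr cisN cis_natr c2 expr1n /= oppr0.
Qed.

(** The phase of the monomial [m] changes by [2 pi] times the integer [\sum_j m j * z j]. *)
Lemma tmult_periodic th (z : 'I_n -> int) g :
  tmult P xi (fun j => th j + (z j)%:~R * (2 * pi)) g = tmult P xi th g.
Proof.
rewrite /tmult (_ : tderiv P xi (fun j => th j + (z j)%:~R * (2 * pi)) g = tderiv P xi th g) //.
apply/funext => k; apply: eq_bigr => m _; congr (_ * (_ * _)).
rewrite -[RHS](cis_periodic _ (\sum_j (m j)%:Z * z j)); congr cis.
rewrite addrAC; congr (_ - _); rewrite /wtR rmorph_sum big_distrl -big_split /=.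
apply: eq_bigr => j _; rewrite rmorphM /= -pmulrn mulrDr.
by rewrite mulrA.
Qed.

Lemma zero_pairing_periodic th (z : 'I_n -> int) phi :
  zero_pairing P xi (fun j => th j + (z j)%:~R * (2 * pi)) phi = zero_pairing P xi th phi.
Proof.
have e : tmult P xi (fun j => th j + (z j)%:~R * (2 * pi)) = tmult P xi th.
  by apply/funext => g; exact: tmult_periodic.
by rewrite /zero_pairing /zero_set e.
Qed.

Section TestFunction.
Variables (phi : R -> R) (M : R).
Hypothesis phi_cont : continuous phi.
Hypothesis phi_supp : forall y, M < `|y| -> phi y = 0.

Lemma zero_pairing_shift th t :
  zero_pairing P xi th (fun y => phi (y - t)) = zero_pairing P xi (fun j => th j - t * xi j) phi.
Proof.
rewrite /zero_pairing (@mass_pairing_compact _ _ _ _ (M + `|t|)); last first.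
  move=> y My; apply: phi_supp; rewrite -ltrBrDr in My; apply: (lt_le_trans My).
  exact: lerB_dist.
rewrite (@mass_pairing_compact _ _ _ _ M) //.
rewrite (@reindex_fsbig _ _ _ _ _ (fun y => y + t) (zero_set P xi (fun j => th j - t * xi j))).
  by apply: eq_fsbigr => y _; rewrite tmult_shift addrK.
split.
- by move=> y; rewrite /zero_set /= tmult_shift.
- by move=> y y' _ _ /addIr.
by move=> y; rewrite /zero_set /= => h; exists (y - t); rewrite ?subrK // -tmult_shift subrK.
Qed.

Lemma compact_bounded : exists2 C, 0 <= C & forall y, `|phi y| <= C.
Proof.
pose M' := `|M|; have MM : - M' <= M' by have := normr_ge0 M; rewrite /M'; lra.
have [|c _ hc] := @EVT_max R (fun t => `|phi t|) _ _ MM.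
  by apply: continuous_subspaceT => t; apply: cvg_norm; exact: phi_cont.
exists `|phi c| => // y; have [yM|yM] := leP `|y| M'.
  by apply: hc; rewrite in_itv /= -ler_norml.
by rewrite phi_supp ?normr0 // (le_lt_trans (ler_norm M)).
Qed.

Lemma compact_decays : exists C, forall y, `|phi y| <= C * (1 + y ^+ 2)^-1 ^+ 2.
Proof.
have [C C0 hC] := compact_bounded; exists (C * (1 + M ^+ 2) ^+ 2) => y.
have y0 : 0 < 1 + y ^+ 2 by rewrite ltr_pwDl // sqr_ge0.
have [yM|yM] := leP `|y| `|M|; last first.
  rewrite phi_supp ?(le_lt_trans (ler_norm M)) // normr0 mulr_ge0 //.
    by rewrite mulr_ge0 // sqr_ge0.
  by rewrite exprn_ge0 // invr_ge0 ltW.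
apply: le_trans (hC y) _; rewrite -mulrA -exprMn ler_peMr // exprn_ege1 //.
rewrite ler_pdivlMr // mul1r lerD2l -(real_normK (num_real y)) -(real_normK (num_real M)).
by rewrite ler_sqr.
Qed.

Lemma azeros_phi_cvg (I : Type) (Fl : set_system I) {FF : ProperFilter Fl}
    (K_ : I -> nat) (th_ : I -> 'I_n -> R) th :
  (forall K, \forall i \near Fl, (K <= K_ i)%N) ->
  (forall j, th_ i j @[i --> Fl] --> th j) ->
  \sum_(y <- azeros P ell xi (K_ i) (th_ i)) phi y @[i --> Fl] --> zero_pairing P xi th phi.
Proof.
move=> hK hth; have [C hC] := compact_decays.
apply: (@azeros_cvg _ _ _ _ _ _ Ps Qs PQ _ xi_gt0 I Fl _ K_ th_ th phi (fun=> phi) C hK hth).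
- by exists C.
- by apply: nearW => i y _; exact: hC.
move=> g e e0; have /cvgrPdist_le/(_ _ e0) /= [d d0 hd] := @phi_cont g.
exists (d / 2); first by rewrite divr_gt0.
apply: nearW => i y yg; rewrite distrC; apply: hd => /=; rewrite distrC.
by apply: le_lt_trans yg _; rewrite ltr_pdivrMr // ltr_pMr // ltr1n.
Qed.

(* Diagonal argument: [zero_pairing (th_ k)] is within [1 / k.+1] of a sum over the zeros
   of an approximant, to which [azeros_phi_cvg] applies. *)
Lemma zero_pairing_cvg (Fl : set_system nat) {FF : ProperFilter Fl} (th_ : nat -> 'I_n -> R) th :
  \oo `<=` Fl -> (forall j, th_ i j @[i --> Fl] --> th j) ->
  zero_pairing P xi (th_ i) phi @[i --> Fl] --> zero_pairing P xi th phi.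
Proof.
move=> oF hth.
have ex k : exists K, (k <= K)%N /\
    `|zero_pairing P xi (th_ k) phi - \sum_(y <- azeros P ell xi K (th_ k)) phi y| <= k.+1%:R^-1.
  have h : \sum_(y <- azeros P ell xi K (th_ k)) phi y @[K --> \oo] -->
      zero_pairing P xi (th_ k) phi.
    apply: (@azeros_phi_cvg nat \oo _ id (fun=> th_ k) (th_ k)) => K.
      exact: nbhs_infty_ge.
    exact: cvg_cst.
  have k0 : 0 < k.+1%:R^-1 :> R by rewrite invr_gt0 ltr0n.
  have /cvgrPdist_le/(_ _ k0) h1 := h.
  near \oo => K; exists K; split; first by near: K; exact: nbhs_infty_ge.
  by near: K; exact: h1.
have [K_ hK] := choice ex.
have Kinf K : \forall k \near Fl, (K <= K_ k)%N.
  apply: oF; near=> k; apply: (@leq_trans k); last by have [] := hK k.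
  by near: k; exact: nbhs_infty_ge.
have /cvgrPdist_le c1 := @azeros_phi_cvg nat Fl FF K_ th_ th Kinf hth.
apply/cvgrPdist_le => e e0; have e2 : 0 < e / 2 by rewrite divr_gt0.
have c1' := c1 _ e2.
have hk : \forall k \near Fl, k.+1%:R^-1 <= e / 2.
  apply: oF; near=> k; rewrite invf_ple ?posrE ?ltr0n //.
  apply: (@le_trans _ _ k%:R); last by rewrite ler_nat.
  by near: k; exact: nbhs_infty_ger.
near=> k; rewrite -(subrKA (\sum_(y <- azeros P ell xi (K_ k) (th_ k)) phi y)).
apply: le_trans (ler_normD _ _) _; rewrite (splitr e); apply: lerD; first by near: k.
rewrite distrC; apply: (@le_trans _ _ k.+1%:R^-1); last by near: k.
by have [_] := hK k.
Unshelve. all: end_near. Qed.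

(* Periodicity in [th] confines a counterexample to a box, where all coordinates converge
   along an ultrafilter. *)
Lemma zero_pairing_unif_cont e : 0 < e -> exists2 d : R, 0 < d & forall th th',
  (forall j, `|th j - th' j| <= d) ->
  `|zero_pairing P xi th phi - zero_pairing P xi th' phi| <= e.
Proof.
move=> e0; apply: contrapT => /forall2NP h.
have ex (k : nat) : exists thh : ('I_n -> R) * ('I_n -> R),
    [/\ forall j, 0 <= thh.1 j <= 2 * pi, forall j, `|thh.1 j - thh.2 j| <= k.+1%:R^-1 &
     e < `|zero_pairing P xi thh.1 phi - zero_pairing P xi thh.2 phi|].
  have [] := h k.+1%:R^-1; first by rewrite invr_gt0 ltr0n.
  move=> /existsNP[th] /existsNP[th'] /not_implyP[hd /negP]; rewrite -ltNge => he.
  pose z j : int := - Num.floor (th j / (2 * pi)).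
  exists (fun j => th j + (z j)%:~R * (2 * pi), fun j => th' j + (z j)%:~R * (2 * pi)).
  split => /=; last by rewrite !zero_pairing_periodic.
    move=> j; have p0 : 0 < 2 * pi :> R by rewrite mulr_gt0 // pi_gt0.
    rewrite /z; move: (2 * pi) p0 => T p0.
    have /andP[] := floor_itv (th j / T).
    rewrite ler_pdivlMr // ltr_pdivrMr // rmorphD /= mulrDl mul1r rmorphN mulNr subr_ge0.
    by move=> -> /ltW h2 /=; rewrite lerBlDl.
  by move=> j; rewrite opprD addrACA subrr addr0.
have {ex} [tt htt] := choice ex.
have [Fl [UF oF]] := ultraFilterLemma eventually_filter.
have PF : ProperFilter Fl by exact: ultra_proper.
have exl j : exists p : R, (tt k).1 j @[k --> Fl] --> p.
  by apply: (@ultra_bounded_cvg _ _ _ _ 0 (2 * pi) UF) => k; have [] := htt k.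
have {exl} [th hth] := choice exl.
have hth' j : (tt k).2 j @[k --> Fl] --> th j.
  have d0 : (tt k).1 j - (tt k).2 j @[k --> Fl] --> (0 : R).
    apply/cvgrPdist_le => d d0; apply: oF; near=> k; rewrite sub0r normrN.
    have [_ h1 _] := htt k; apply: le_trans (h1 j) _; rewrite invf_ple ?posrE ?ltr0n //.
    apply: (@le_trans _ _ k%:R); last by rewrite ler_nat.
    by near: k; exact: nbhs_infty_ger.
  rewrite (_ : (fun k => _) = fun k => (tt k).1 j - ((tt k).1 j - (tt k).2 j)); last first.
    by apply/funext => k; rewrite opprB addrC subrK.
  by rewrite -[th j]subr0; apply: cvgB.
have c3 : zero_pairing P xi (tt k).1 phi - zero_pairing P xi (tt k).2 phi @[k --> Fl] --> (0 : R).
  rewrite -(subrr (zero_pairing P xi th phi)).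
  by apply: cvgB; apply: zero_pairing_cvg.
have /cvgrPdist_lt/(_ _ e0) c4 := c3.
have [k] := filter_ex c4; rewrite sub0r normrN.
by have [_ _ h1] := htt k; rewrite ltNge ltW.
Unshelve. all: end_near. Qed.

End TestFunction.

(* Fix one time [S f] in every visited cell [f] of the torus; if [x + L] lies in the cell
   [f], then [x + L - S f] returns close to the origin. *)
Lemma simultaneous_recurrence (d : R) : 0 < d -> exists2 L : R, 0 < L & forall x : R,
  exists2 tau : R, x <= tau <= x + L &
  exists z : 'I_n -> int, forall j, `|tau * xi j - (z j)%:~R * (2 * pi)| <= d.
Proof.
move=> d0; have T0 : 0 < 2 * pi :> R by rewrite mulr_gt0 // pi_gt0.
move: (2 * pi) T0 => T T0; pose M := Num.truncn (T / d).
have MT : T / M.+1%:R <= d.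
  by rewrite ler_pdivrMr ?ltr0n // mulrC -ler_pdivrMr //; apply/ltW/truncnS_gt.
pose fr (u : R) := u - (Num.floor u)%:~R.
have fr01 u : 0 <= fr u < 1.
  have /andP[h1 h2] := floor_itv u; move: h2; rewrite rmorphD /= => h2.
  by rewrite /fr subr_ge0 h1 ltrBlDl.
pose c j (t : R) := Num.truncn (M.+1%:R * fr (t * xi j / T)).
have cM j t : (c j t < M.+1)%N.
  have /andP[f0 f1] := fr01 (t * xi j / T).
  rewrite -(ltr_nat R); apply: (@le_lt_trans _ _ (M.+1%:R * fr (t * xi j / T))).
    by rewrite truncn_le // mulr_ge0.
  by rewrite -[ltRHS]mulr1 ltr_pM2l // ltr0n.
pose cell t : {ffun 'I_n -> 'I_M.+1} := [ffun j => Ordinal (cM j t)].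
(* A cell that is never visited gets the default 0; only visited cells are used below. *)
pose S f : R := xget 0 [set t | cell t = f].
pose L := \sum_f `|S f| + 1.
have SL f : `|S f| <= L.
  by rewrite /L (bigD1 f) //= -addrA lerDl addr_ge0 // sumr_ge0.
have L0 : 0 < L by rewrite ltr_wpDl // sumr_ge0.
exists (L + L); first by rewrite addr_gt0.
move=> x; set f := cell (x + L); have Sf : cell (S f) = f.
  by apply: (@xgetPex _ 0 [set t | cell t = f]); exists (x + L).
exists (x + L - S f).
  have := SL f; rewrite ler_norml => /andP[h1 h2]; apply/andP; split; lra.
exists (fun j => Num.floor ((x + L) * xi j / T) - Num.floor (S f * xi j / T)) => j.
have e : c j (S f) = c j (x + L).
  by have := congr1 (fun F : {ffun 'I_n -> 'I_M.+1} => val (F j)) Sf; rewrite /f !ffunE.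
rewrite rmorphB /=.
have -> : (x + L - S f) * xi j - ((Num.floor ((x + L) * xi j / T))%:~R -
    (Num.floor (S f * xi j / T))%:~R) * T =
    T / M.+1%:R * (M.+1%:R * fr ((x + L) * xi j / T) - M.+1%:R * fr (S f * xi j / T)).
  rewrite -mulrBr mulrA divfK ?pnatr_eq0 // /fr mulrBr !mulrBr.
  have h u : T * (u / T) = u by rewrite mulrC divfK // gt_eqF.
  by rewrite !h; ring.
rewrite normrM (ger0_norm (divr_ge0 (ltW T0) (ler0n _ _))).
apply: le_trans MT; rewrite -[leRHS]mulr1; apply: ler_wpM2l.
  by rewrite divr_ge0 // ltW.
have pos t : 0 <= M.+1%:R * fr (t * xi j / T).
  by have /andP[f0 _] := fr01 (t * xi j / T); rewrite mulr_ge0.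
have /andP[] := truncn_itv (pos (S f)); have /andP[] := truncn_itv (pos (x + L)).
rewrite -/(c j (S f)) -/(c j (x + L)) e -natr1 ler_norml => h1 h2 h3 h4.
by apply/andP; split; lra.
Qed.

(** Translation by [t + tau] is the phase vector [- (t + tau) xi]; modulo [2 pi] it differs from
    [- t xi] by at most [d] in each coordinate, whatever [t] is. *)
Lemma zero_pairing_near_period phi M e : continuous phi -> (forall y, M < `|y| -> phi y = 0) ->
  0 < e -> exists2 d : R, 0 < d & forall (tau : R) (z : 'I_n -> int),
    (forall j, `|tau * xi j - (z j)%:~R * (2 * pi)| <= d) -> forall t,
  `|zero_pairing P xi (fun=> 0) (fun y => phi (y - (t + tau))) -
    zero_pairing P xi (fun=> 0) (fun y => phi (y - t))| <= e.
Proof.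
move=> pc ps e0; have [d d0 hd] := zero_pairing_unif_cont pc ps e0.
exists d => // tau z hz t; rewrite !(zero_pairing_shift ps).
rewrite -(zero_pairing_periodic (fun j => 0 - (t + tau) * xi j) z); apply: hd => j.
rewrite (_ : _ - _ = - (tau * xi j - (z j)%:~R * (2 * pi))); last by ring.
by rewrite normrN; exact: hz.
Qed.

Lemma Re_continuous (f : R -> CC R) : continuous f -> continuous (fun y => complex.Re (f y)).
Proof.
move=> fc y; apply/cvgrPdist_le => e e0.
have ec : (0 : CC R) < e%:C by rewrite ltcR.
have /cvgrPdist_le/(_ _ ec) /= h := fc y.
near=> z; rewrite -lecR; apply: le_trans (_ : `|f y - f z| <= _); last by near: z; exact: h.
rewrite normc_nsq lecR -nrmE; apply: le_trans (Re_le_normc _).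
by rewrite cReD raddfN.
Unshelve. all: end_near. Qed.

Lemma Im_continuous (f : R -> CC R) : continuous f -> continuous (fun y => complex.Im (f y)).
Proof.
move=> fc y; apply/cvgrPdist_le => e e0.
have ec : (0 : CC R) < e%:C by rewrite ltcR.
have /cvgrPdist_le/(_ _ ec) /= h := fc y.
near=> z; rewrite -lecR; apply: le_trans (_ : `|f y - f z| <= _); last by near: z; exact: h.
rewrite normc_nsq lecR -nrmE; apply: le_trans (Im_le_normc _).
by rewrite cImD raddfN.
Unshelve. all: end_near. Qed.

Section Convolution.
Variable g : R -> CC R.
Hypotheses (g_cont : continuous g) (g_supp : compactly_supported g).

Let a (y : R) : CC R := (tmult P xi (fun=> 0) y)%:R.
Let cv := convolution (point_masses (zero_set P xi (fun=> 0)) a) g.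
Let gR y : R := complex.Re (g (- y)).
Let gI y : R := complex.Im (g (- y)).

Lemma convolutionE t : cv t =
  zero_pairing P xi (fun=> 0) (fun y => gR (y - t)) +i*
  zero_pairing P xi (fun=> 0) (fun y => gI (y - t)).
Proof.
have [M hM] := g_supp.
have cs : compactly_supported (fun y => g (t - y)).
  exists (`|t| + M) => y tM; apply: hM; rewrite distrC.
  by apply: lt_le_trans (lerB_dist _ _); rewrite ltrBrDr addrC.
rewrite /cv /convolution (_ : a = fun y => ((tmult P xi (fun=> 0) y)%:R)%:C); last first.
  by apply/funext => x; rewrite /a -(rmorph_nat (real_complex R)).
rewrite -mass_functional_compact //; last exact: (zero_set_lf Ps Qs PQ xi_gt0).
rewrite /mass_functional /zero_pairing /gR /gI.
by congr (mass_pairing _ _ _ +i* mass_pairing _ _ _); apply/funext => y; rewrite opprB.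
Qed.

Lemma convolution_near_period (e : R) : 0 < e -> exists2 d : R, 0 < d &
  forall (tau : R) (z : 'I_n -> int),
    (forall j, `|tau * xi j - (z j)%:~R * (2 * pi)| <= d) -> forall t,
  Normc.normc (cv (t + tau) - cv t) < e.
Proof.
move=> e0; have [M hM] := g_supp; have e3 : 0 < e / 3 by rewrite divr_gt0.
have oc (u : R -> R) : continuous u -> continuous (fun y => u (- y)).
  by move=> uc y; apply: (@continuous_comp _ _ _ -%R u); [exact: opp_continuous|exact: uc].
have sR y : M < `|y| -> gR y = 0 by rewrite -normrN /gR => /hM ->.
have sI y : M < `|y| -> gI y = 0 by rewrite -normrN /gI => /hM ->.
have [d1 d10 h1] := zero_pairing_near_period (oc _ (Re_continuous g_cont)) sR e3.
have [d2 d20 h2] := zero_pairing_near_period (oc _ (Im_continuous g_cont)) sI e3.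
exists (Num.min d1 d2); first by rewrite lt_min d10.
move=> tau z hz t.
have {}h1 := h1 tau z _ t; have {}h2 := h2 tau z _ t.
apply: (@le_lt_trans _ _ (e / 3 + e / 3)); last lra.
apply: le_trans (normc_le_ReIm _) _; rewrite !convolutionE cReD cImD !raddfN /=.
by apply: lerD; [apply: h1|apply: h2] => j; apply: le_trans (hz j) _; rewrite ge_min lexx ?orbT.
Qed.

Lemma convolution_bohr : bohr_almost_periodic cv.
Proof.
split.
  move=> t; apply/cvgrPdist_lt => eps eps0.
  have e0 : 0 < complex.Re eps by move: eps0; rewrite ltcE => /andP[].
  have -> : eps = (complex.Re eps)%:C.
    move: eps0; rewrite ltcE /= => /andP[/eqP h _].
    by apply/eqP; rewrite eq_complex /= h !eqxx.
  have [d d0 hd] := convolution_near_period e0.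
  pose X := 1 + \sum_j xi j.
  have xX j : xi j <= X.
    by rewrite /X (bigD1 j) //= addrCA lerDl addr_ge0 // sumr_ge0 // => i _; exact: ltW.
  have X0 : 0 < X by rewrite ltr_pwDl // sumr_ge0 // => i _; exact: ltW.
  exists (d / X) => /=; first exact: divr_gt0.
  move=> s /= st; rewrite distrC normc_nsq ltcR -nrmE.
  have -> : s = t + (s - t) by rewrite addrC subrK.
  (* A short translation is a near-period with all integers 0, so continuity follows from the same
     estimate. *)
  apply: (hd (s - t) (fun=> 0)) => j; rewrite mul0r subr0 normrM (gtr0_norm (xi_gt0 j)) distrC.
  apply: (@le_trans _ _ (d / X * X)); last by rewrite divfK // gt_eqF.
  by apply: ler_pM => //; [exact: ltW|exact: ltW].
move=> eps e0; have [d d0 hd] := convolution_near_period e0.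
have [L L0 hL] := simultaneous_recurrence d0; exists L; split => // x.
have [tau hx [z hz]] := hL x; exists tau; split => // t; exact: hd hz t.
Qed.

End Convolution.
End AlmostPeriodicity.

(** * Complex derivatives of exponential polynomials *)

Section ComplexExponential.
Variable R : realType.
Local Notation C := (CC R).

Lemma expR_sub1 (x : R) : `|x| <= 1 -> `|expR x - 1| <= expR 1 * `|x|.
Proof.
move=> x1; have := exp_taylor 1 x; rewrite /exp_part big_ord_recl big_ord0 addr0 expr0 divr1 expr1.
by move=> h; apply: le_trans h _; rewrite mulrC; apply: ler_wpM2r => //; rewrite ler_expR.
Qed.

Lemma expR_sub1D (x : R) : `|x| <= 1 -> `|expR x - (1 + x)| <= expR 1 * `|x| ^+ 2.
Proof.
move=> x1; have := exp_taylor 2 x.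
rewrite /exp_part !big_ord_recl big_ord0 addr0 expr0 divr1 /bump /= expr1 divr1.
by move=> h; apply: le_trans h _; rewrite mulrC; apply: ler_wpM2r; rewrite ?exprn_ge0 // ler_expR.
Qed.

Lemma cos_sub1 (x : R) : `|cos x - 1| <= `|x| ^+ 2.
Proof.
rewrite distrC ger0_norm ?subr_ge0 ?cos_le1 // real_normK ?num_real //.
apply: le_trans (one_sub_cos_le x) _.
by rewrite ler_pdivrMr // ler_peMr ?sqr_ge0 // ler1n.
Qed.

Lemma sin_subx (x : R) : `|sin x - x| <= `|x| ^+ 2.
Proof.
wlog x0 : x / 0 < x => [H|].
  have [x0|x0|->] := ltgtP x 0; last by rewrite sin0 subrr normr0 expr0n.
    have := H (- x); rewrite sinN -opprD !normrN => -> //; by rewrite oppr_gt0.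
  exact: H.
have [|c] := @MVT R sin cos 0 x x0 (fun t _ => is_derive_sin t).
  by apply: continuous_subspaceT => t; exact: continuous_sin.
rewrite in_itv /= sin0 !subr0 => /andP[c0 cx] ->.
have -> : cos c * x - x = (cos c - cos 0) * x by rewrite cos0; ring.
rewrite normrM expr2; apply: ler_wpM2r => //; apply: le_trans (cos_lipschitz _ _) _.
by rewrite subr0 !gtr0_norm // ltW.
Qed.

Lemma cexp_sub1D : exists2 K : R, 0 <= K & forall z : R[i], nsq z <= 1 ->
  Normc.normc (cexp (z : C) - 1 - z : R[i]) <= K * nsq z.
Proof.
pose E : R := expR 1; have E0 : 0 <= E by exact: expR_ge0.
exists (6 * E + 6); first by rewrite addr_ge0 // mulr_ge0.
case=> a b; have -> : nsq (a +i* b) = a ^+ 2 + b ^+ 2 by []; move=> ab.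
have a2 : `|a| ^+ 2 = a ^+ 2 by rewrite real_normK ?num_real.
have b2 : `|b| ^+ 2 = b ^+ 2 by rewrite real_normK ?num_real.
have ha := sqr_ge0 a; have hb := sqr_ge0 b; have na := normr_ge0 a; have nb := normr_ge0 b.
have a1 : `|a| <= 1 by rewrite -(ler_sqr (normr_ge0 a)) ?nnegrE // expr1n a2; lra.
have b1 : `|b| <= 1 by rewrite -(ler_sqr (normr_ge0 b)) ?nnegrE // expr1n b2; lra.
have e1 := expR_sub1 a1; have e2 := expR_sub1D a1; rewrite -/E in e1 e2.
have c1 := cos_sub1 b; have s1 := sin_subx b; have s2 := normr_sin_le b.
have eE : expR a <= E by rewrite ler_expR (le_trans (ler_norm _)).
apply: le_trans (normc_le_ReIm _) _ => /=.
have -> : expR a * cos b - 1 - a = (expR a - (1 + a)) + expR a * (cos b - 1) by ring.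
have -> : expR a * sin b - 0 - b = (expR a - 1) * sin b + (sin b - b) by ring.
have t1 : `|expR a * (cos b - 1)| <= E * `|b| ^+ 2.
  by rewrite normrM (gtr0_norm (expR_gt0 a)); apply: ler_pM => //; exact: expR_ge0.
have t2 : `|(expR a - 1) * sin b| <= E * (`|a| * `|b|).
  by rewrite normrM mulrA; apply: ler_pM.
have t3 : E * (`|a| * `|b|) <= E * (`|a| ^+ 2 + `|b| ^+ 2).
  by apply: ler_wpM2l => //; nra.
apply: le_trans (lerD (ler_normD _ _) (ler_normD _ _)) _.
rewrite -a2 -b2; have := sqr_ge0 `|a|; have := sqr_ge0 `|b|.
move: (`|a| ^+ 2) (`|b| ^+ 2) e2 c1 s1 t1 t3 => A B e2 c1 s1 t1 t3 B0 A0.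
have EA : 0 <= E * A by rewrite mulr_ge0.
have EB : 0 <= E * B by rewrite mulr_ge0.
nra.
Qed.

Lemma cexpD (z w : C) : cexp (z + w) = cexp z * cexp w.
Proof.
case: z w => [a b] [c d]; rewrite /cexp /= expRD cosD sinD.
by apply/eqP; rewrite eq_complex /=; apply/andP; split; apply/eqP; ring.
Qed.

(** By the addition formula, the error of the difference quotient is [k * cexp (c * s)] times
    [(cexp (c * h) - 1 - c * h) / h], which is of order [h]. *)
Lemma is_derive_cexp (k c s : C) :
  is_derive s 1 (fun z => k * cexp (c * z)) (k * c * cexp (c * s)).
Proof.
pose f (z : C) : C := k * cexp (c * z).
suff h : h^-1 *: ((f \o shift s) (h *: 1) - f s) @[h --> (0 : C)^'] --> k * c * cexp (c * s).
  apply: DeriveDef; first by apply/cvg_ex; eexists; exact: h.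
  exact: (cvg_lim (@norm_hausdorff _ C) h).
have [K K0 hK] := cexp_sub1D.
pose n1 := Normc.normc (k * cexp (c * s)); pose n2 := Normc.normc c.
have n10 : 0 <= n1 by exact: nrm_ge0.
have n20 : 0 <= n2 by exact: nrm_ge0.
pose D := n1 * K * n2 ^+ 2 + 1.
have D0 : 0 < D by rewrite ltr_wpDl // mulr_ge0 ?mulr_ge0 // exprn_ge0.
apply/cvgrPdist_le => eps eps0.
have e0 : 0 < complex.Re eps by move: eps0; rewrite ltcE => /andP[].
have -> : eps = (complex.Re eps)%:C.
  move: eps0; rewrite ltcE /= => /andP[/eqP h _].
  by apply/eqP; rewrite eq_complex /= h !eqxx.
move: (complex.Re eps) e0 => e e0.
(* The first bound makes the error at most [e]; the second gives [|c h| <= 1], as [cexp_sub1D]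
   requires. *)
pose d := Num.min (e / D) (1 / (n2 + 1)).
have d0 : 0 < d by rewrite lt_min !divr_gt0 // ltr_wpDl.
near=> h.
have h0 : h != 0 by near: h; exact: nbhs_dnbhs_neq.
have hd : `|h| < d%:C by near: h; apply: dnbhs0_lt; rewrite ltcR.
rewrite normc_nsq ltcR -nrmE lt_min in hd; move: hd => /andP[hd1 hd2].
have nh0 : 0 < Normc.normc h by rewrite nrmE sqrtr_gt0 nsq_gt0.
have -> : k * c * cexp (c * s) - h^-1 *: ((f \o shift s) (h *: 1) - f s) =
    - (k * cexp (c * s) * (h^-1 * (cexp (c * h) - 1 - c * h))).
  rewrite /f /= /GRing.scale /= mulr1 (mulrDr c) cexpD.
  have e1 : h^-1 * h = 1 by rewrite mulVf.
  rewrite !mulrBr mulr1 [in RHS](mulrCA h^-1) e1.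
  ring.
rewrite normrN normc_nsq lecR -nrmE Normc.normcM -/n1 Normc.normcM.
have q : Normc.normc (cexp (c * h) - 1 - c * h) <= K * (n2 * Normc.normc h) ^+ 2.
  rewrite exprMn !nrm_sqr -nsqM; apply: hK; rewrite nsqM -!nrm_sqr -exprMn -/n2.
  rewrite -(expr1n _ 2) ler_sqr ?nnegrE ?mulr_ge0 ?(ltW nh0) //.
  rewrite ltr_pdivlMr ?ltr_wpDl // in hd2.
  apply: le_trans (ltW hd2); rewrite mulrC; apply: ler_wpM2l; first exact: ltW.
  by rewrite lerDl.
have -> : Normc.normc (h^-1 : C) = (Normc.normc h)^-1.
  apply: (mulfI (lt0r_neq0 nh0)); rewrite divff ?gt_eqF // -Normc.normcM divff //.
  by rewrite nrmE /nsq /= expr1n expr0n addr0 sqrtr1.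
apply: (@le_trans _ _ (n1 * ((Normc.normc h)^-1 * (K * (n2 * Normc.normc h) ^+ 2)))).
  apply: ler_wpM2l => //; apply: ler_wpM2l => //; by rewrite invr_ge0 ltW.
have -> : n1 * ((Normc.normc h)^-1 * (K * (n2 * Normc.normc h) ^+ 2)) =
   (D - 1) * Normc.normc h.
  by rewrite /D; field; rewrite gt_eqF.
rewrite ltr_pdivlMr // in hd1; apply: le_trans (ltW hd1); rewrite mulrC.
by apply: ler_wpM2l; [exact: ltW|rewrite gerBl].
Unshelve. all: end_near. Qed.

End ComplexExponential.

(** * The entire function F, its derivatives and its zeros *)

Section ExponentialPolynomial.
Variables (R : realType) (n : nat).
Implicit Types (P Q : mpoly.mpoly n R[i]) (xi : 'I_n -> R) (s : CC R) (g : R).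
Local Notation C := (CC R).

Lemma cexp_wtR (x : R) s :
  cexp (- x%:C * s) = (expR (- (x * complex.Re s)))%:C * cis (0 - x * complex.Im s) :> R[i].
Proof.
case: s => a b /=; rewrite /cexp /cis sub0r.
apply/eqP; rewrite eq_complex /=; apply/andP; split; apply/eqP.
  by rewrite !(mul0r, subr0, mulNr, oppr0, addr0, add0r).
by rewrite !(mul0r, subr0, mulNr, oppr0, addr0, add0r).
Qed.

Lemma exp_poly_twisted P xi s :
  exp_poly P xi s = twisted P xi (fun=> 0) (complex.Re s) (complex.Im s).
Proof. by rewrite twistedE; apply: mpoly.meval_eq => j; rewrite cexp_wtR. Qed.

Definition exp_poly_deriv P xi (k : nat) s : C :=
  \sum_(m <- mpoly.msupp P)
    (mpoly.mcoeff m P * ((- wtR xi m) ^+ k)%:C) * cexp (- (wtR xi m)%:C * s).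

Lemma exp_poly_deriv0 P xi : exp_poly P xi = exp_poly_deriv P xi 0.
Proof.
apply/funext => s; rewrite exp_poly_twisted; apply: eq_bigr => m _.
rewrite expr0 mulr1 cexp_wtR /term; congr (_ * (_ * cis _)).
by rewrite /wtR big1 // => j _; rewrite mulr0.
Qed.

Lemma exp_poly_deriv_im P xi k g :
  exp_poly_deriv P xi k (0 +i* g) = tderiv P xi (fun=> 0) g k.
Proof.
apply: eq_bigr => m _; rewrite cexp_wtR /= mulr0 oppr0 expR0 mul1r -mulrA.
congr (_ * (_ * cis (_ - _))).
by rewrite /wtR big1 // => j _; rewrite mulr0.
Qed.

Lemma is_derive_exp_poly P xi k s :
  is_derive s 1 (exp_poly_deriv P xi k) (exp_poly_deriv P xi k.+1 s).
Proof.
rewrite /exp_poly_deriv.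
elim: (mpoly.msupp P) => [|m r IH].
  rewrite big_nil (_ : (fun z => _) = cst 0); first exact: is_derive_cst.
  by apply/funext => z; rewrite big_nil.
pose u (z : C) : C := mpoly.mcoeff m P * ((- wtR xi m) ^+ k)%:C * cexp (- (wtR xi m)%:C * z).
rewrite big_cons (_ : (fun z => _) =
    u + (fun z => \sum_(m <- r) mpoly.mcoeff m P * ((- wtR xi m) ^+ k)%:C * cexp (- (wtR xi m)%:C * z))).
  apply: is_deriveD IH.
  have := is_derive_cexp (mpoly.mcoeff m P * ((- wtR xi m) ^+ k)%:C) (- (wtR xi m)%:C) s.
  congr is_derive; rewrite exprSr real_complexM rmorphN /= mulrA //.
by apply/funext => z; rewrite big_cons.
Qed.

Lemma derive1n_exp_poly P xi k : derive1n k (exp_poly P xi) = exp_poly_deriv P xi k.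
Proof.
elim: k => [|k IH]; first by rewrite derive1n0 exp_poly_deriv0.
rewrite derive1nS IH; apply/funext => s; rewrite derive1E.
by have [_ ->] := is_derive_exp_poly P xi k s.
Qed.

Lemma exp_poly_derivable P xi s : derivable (exp_poly P xi) s 1.
Proof. by rewrite exp_poly_deriv0; have [h _] := is_derive_exp_poly P xi 0 s. Qed.

Lemma zero_mult_exp_poly P xi g :
  zero_mult (exp_poly P xi) (0 +i* g) = tmult P xi (fun=> 0) g.
Proof.
rewrite /zero_mult /tmult; congr (xget _ _); apply/funext => k /=.
rewrite derive1n_exp_poly exp_poly_deriv_im; congr (_ /\ _).
apply/propext; split => h j /h; by rewrite derive1n_exp_poly exp_poly_deriv_im.
Qed.

(** For [s < 0] the points [w j] lie outside the closed disc, so their inverses lie inside;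
    reciprocity there makes the value of [P] at [w] a factor of a nonzero value of [Q]. *)
Lemma twisted_neq0_left P Q (ell : 'I_n -> nat) (eta : R[i]) xi (s g : R) :
  stable Q -> reciprocal P Q ell eta -> (forall j, 0 < xi j) -> s < 0 ->
  twisted P xi (fun=> 0) s g != 0.
Proof.
move=> Qs PQ xi0 s0; rewrite twistedE.
set w := fun j => _ * _.
have w0 j : w j != 0.
  by rewrite mulf_neq0 ?cis_neq0 // -nsq_eq0 nsq_real sqrf_eq0 gt_eqF ?expR_gt0.
have := Qs (fun j => (w j)^-1); rewrite (PQ _ (fun j => invr_neq0 (w0 j))).
have h j : `|(w j)^-1| < 1.
  rewrite normrV ?unitfE // invf_lt1 ?normr_gt0 // normrM normr_cis mulr1 normc_nsq nsq_real.
  rewrite sqrtr_sqr gtr0_norm ?expR_gt0 // ltcR expR_gt1 oppr_gt0.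
  by rewrite nmulr_llt0.
move=> /(_ h); rewrite mulf_eq0 negb_or => /andP[_].
suff -> : mpoly.meval (fun j => ((w j)^-1)^-1) P = mpoly.meval w P by [].
by apply: mpoly.meval_eq => j; rewrite invrK.
Qed.

End ExponentialPolynomial.

Theorem theorem1 (R : realType) (n : nat) (n_gt0 : (0 < n)%N)
    (P Q : mpoly.mpoly n (CC R))
    (P_stable : D_stable P) (Q_stable : D_stable Q)
    (PQ : exists (ell : 'I_n -> nat) (eta : CC R),
        (forall j, (0 < ell j)%N) /\ reciprocal_pair P Q ell eta)
    (b : 'I_n -> R) (b_gt1 : forall j, 1 < b j) :
  let F : CC R -> CC R := exp_poly P (fun j => ln (b j)) in
  let Lambda : set R := [set gamma : R | F (0 +i* gamma) = 0] in
  let m : R -> CC R := fun lambda => (zero_mult F (0 +i* lambda))%:R in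
  [/\ (forall s : CC R, derivable F s 1)
      /\ (forall s : CC R, F s = 0 -> complex.Re s = 0),
      crystalline Lambda m /\ positive_masses Lambda m,
      fourier_quasicrystal Lambda m &
      almost_periodic_measure (point_masses Lambda m)].
Proof.
move=> F Lambda m; case: PQ => ell [eta [_ PQ]].
set xi : 'I_n -> R := fun j => ln (b j) in F Lambda m *.
have xi_gt0 j : 0 < xi j by exact: ln_gt0.
have P0 : const_coef P != 0 := const_coef_neq0 P_stable.
have LE : Lambda = zero_set P xi (fun=> 0).
  apply/funext => g; apply/propext.
  rewrite /Lambda /F /= exp_poly_twisted /zero_set /= (tmult_neq0 _ _ xi_gt0 P0).
  by split => /eqP.
have mE : m = fun g => (tmult P xi (fun=> 0) g)%:R.
  by apply/funext => g; rewrite /m zero_mult_exp_poly.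
rewrite LE mE; split.
- split=> s; first exact: exp_poly_derivable.
  rewrite /F exp_poly_twisted => s0; have [h|h|//] := ltgtP (complex.Re s) 0.
    by have := twisted_neq0_left (complex.Im s) Q_stable PQ xi_gt0 h; rewrite s0 eqxx.
  by have := twisted_neq0 (fun=> 0) (complex.Im s) P_stable xi_gt0 h; rewrite s0 eqxx.
- split; last by move=> x _; exact: ler0n.
  exists (spectrum xi), (spec_coef P ell xi).
  exact: (zero_fourier_pair P_stable Q_stable PQ xi_gt0).
- exact: (zero_fourier_quasicrystal P_stable Q_stable PQ xi_gt0).
- move=> g gc gs.
  exact: (convolution_bohr P_stable Q_stable PQ xi_gt0 gc gs).
Qed.
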